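(* Let $(\mathcal G(A,D),p)$ be a framework in $\mathbb R^2$ with generic configuration $p$, constructed starting from the single edge $(1,2)$ (two vertices with distinct positions, each assigned to $\mathcal V_A$ or $\mathcal V_D$) in one of the following two ways, where $k\ge 1$: (a) by $k$ steps of 2-vertex additions, so that $\mathcal G$ has $2k+2$ vertices and $3k+1$ edges; (b) by $k-1$ steps of 2-vertex additions and one step of 1-vertex addition that adds exactly two edges (Type $A_1$, $D_1$ or $A_2$), so that $\mathcal G$ has $2k+1$ vertices and $3k$ edges. Then, with $n=|\mathcal V|$, the number of edges equals $\lceil\frac{3n-4}{2}\rceil$, and $(\mathcal G(A,D),p)$ is minimally globally SA-RoD rigid, i.e. it is globally SA-RoD rigid and the deletion of an arbitrary edge of $\mathcal G$ destroys global SA-RoD rigidity.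
   Context: $\mathcal{G}=(\mathcal V,\mathcal E)$ is a finite simple undirected graph, $\mathcal V=\{1,\dots,n\}$. A node bipartition is $\mathcal V=\mathcal V_A\cup\mathcal V_D$ with $\mathcal V_A,\mathcal V_D$ disjoint and (for the constructed framework) nonempty; $\mathcal K(A,D)$ is the complete graph on $\mathcal V$ with the same bipartition. A framework has configuration $p=(p_1^\top,\dots,p_n^\top)^\top\in\mathbb R^{2n}$ with pairwise distinct $p_i\in\mathbb R^2$. $p$ is generic if its coordinates satisfy no nonzero polynomial equation with integer coefficients. $b_{ij}=(p_j-p_i)/\|p_j-p_i\|$. $\mathcal T_A=\{(u,v,w)\in\mathcal V^3: u\in\mathcal V_A,(u,v),(u,w)\in\mathcal E,v<w\}$, $\mathcal T_D$ likewise with $u\in\mathcal V_D$. $\alpha_{rst}\in[0,2\pi)$ is the counter-clockwise signed angle from $b_{rs}$ to $b_{rt}$; $\kappa_{ijk}=\|p_k-p_i\|/\|p_j-p_i\|$. $f_{\mathcal G(A,D)}(p)=(\ldots,\alpha_{rst},\ldots,\kappa_{ijk},\ldots)^\top$, $(r,s,t)\in\mathcal T_A$, $(i,j,k)\in\mathcal T_D$, defined where adjacent vertices are distinct; likewise $f_{\mathcal K(A,D)}$. The framework is globally SA-RoD rigid if $f^{-1}_{\mathcal{G}(A,D)}(f_{\mathcal{G}(A,D)}(p))=f^{-1}_{\mathcal{K}(A,D)}(f_{\mathcal{K}(A,D)}(p))$. In the additions below, old vertices keep their part ($\mathcal V_A\subseteq\mathcal V_A'$, $\mathcal V_D\subseteq\mathcal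 V_D'$). 1-vertex addition (current vertices $1,\dots,N$): add vertex $N+1$ with position $p_{N+1}$ and two edges joining it to two distinct existing vertices $i,j$. Type $A_1$: $N+1\in\mathcal V_A'$, and $i\in\mathcal V_D$ or $j\in\mathcal V_D$. Type $D_1$: $N+1\in\mathcal V_D'$, and $i\in\mathcal V_A$ or $j\in\mathcal V_A$. Type $A_2$: $N+1\in\mathcal V_A'$, $i,j\in\mathcal V_A$, and $p_i,p_j,p_{N+1}$ are non-collinear. 2-vertex addition (current vertices $1,\dots,N$): add vertices $N+1,N+2$ and three edges $(j,N+1),(N+1,N+2),(N+2,i)$, where $i\ne j$ are existing vertices, such that exactly three of $i,j,N+1,N+2$ belong to $\mathcal V_A'$, these three are non-collinear, and the remaining one belongs to $\mathcal V_D'$. *)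

(* Defs.v *)
From mathcomp Require Import all_boot all_order all_algebra.
From mathcomp Require Import all_classical all_reals all_analysis.
(* The notations of mpoly clash with those of the analysis library. *)
From mathcomp Require mpoly.
Import -(notations) mpoly.

Set Implicit Arguments.
Unset Strict Implicit.
Unset Printing Implicit Defensive.

Import Order.TTheory GRing.Theory Num.Theory.

Local Open Scope set_scope.
Local Open Scope ring_scope.

Section Plane.
Variable R : realType.
Implicit Types u v a b c : 'rV[R]_2.

Definition dot u v : R := \sum_k u 0 k * v 0 k.

(* The Euclidean norm; `|u| on 'rV[R]_2 would be the sup norm. *)
Definition norm2 u : R := Num.sqrt (dot u u).

Definition cross u v : R := u 0 0 * v 0 1 - u 0 1 * v 0 0.

(* For unit vectors u and v: the counter-clockwise angle from u to v,
   in [0, 2 pi[. *)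
Definition ccw_angle u v : R :=
  if 0 <= cross u v then acos (dot u v) else pi *+ 2 - acos (dot u v).

Definition collinear a b c : Prop :=
  exists x v : 'rV[R]_2, exists r s t : R,
    [/\ v != 0, a = x + r *: v, b = x + s *: v & c = x + t *: v].

End Plane.

Section Graph.
Variable n : nat.
Implicit Types (VA VD U : {set 'I_n}) (E : {set {set 'I_n}}).

(* A simple graph on 'I_n is given by its set of edges, which are
   two-element subsets of 'I_n. *)
Definition complete_graph : {set {set 'I_n}} :=
  [set e : {set 'I_n} | #|e| == 2%N].

Definition bipartition VA VD : Prop :=
  [/\ VA :|: VD = [set: 'I_n], [disjoint VA & VD],
      VA != finset.set0 & VD != finset.set0].

Definition triples E U : {set 'I_n * 'I_n * 'I_n} :=
  [set t : 'I_n * 'I_n * 'I_n |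
    [&& t.1.1 \in U, [set t.1.1; t.1.2] \in E,
        [set t.1.1; t.2] \in E & (t.1.2 < t.2)%N]].

End Graph.

Section Framework.
Variables (R : realType) (n : nat).
Implicit Types (VA VD : {set 'I_n}) (E : {set {set 'I_n}}).
(* Row i of a configuration is the position of vertex i, and mxvec p is the
   stacked vector of the 2n coordinates. *)
Implicit Types p q : 'M[R]_(n, 2).

Definition generic p : Prop :=
  forall P : mpoly.mpoly (n * 2) int, P != 0 ->
    mpoly.mmap intr (fun k => mxvec p 0 k) P != 0.

Definition bearing p (i j : 'I_n) : 'rV[R]_2 :=
  (norm2 (row j p - row i p))^-1 *: (row j p - row i p).

Definition signed_angle p (t : 'I_n * 'I_n * 'I_n) : R :=
  let: (i, j, k) := t in ccw_angle (bearing p i j) (bearing p i k).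

Definition ratio_of_distance p (t : 'I_n * 'I_n * 'I_n) : R :=
  let: (i, j, k) := t in norm2 (row k p - row i p) / norm2 (row j p - row i p).

Definition SARoD E VA VD p : 'cV[R]_(#|triples E VA| + #|triples E VD|) :=
  col_mx (\col_k signed_angle p (enum_val k))
         (\col_k ratio_of_distance p (enum_val k)).

Definition SARoD_domain E : set 'M[R]_(n, 2) :=
  [set q | forall i j : 'I_n, i != j -> [set i; j]%SET \in E ->
           row i q != row j q]%classic.

(* The fibre of the partial function SARoD through p. *)
Definition SARoD_fibre E VA VD p : set 'M[R]_(n, 2) :=
  [set q | SARoD_domain E q /\ SARoD E VA VD q = SARoD E VA VD p]%classic.

Definition globally_rigid E VA VD p : Prop :=
  SARoD_fibre E VA VD p = SARoD_fibre (complete_graph n) VA VD p.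

Definition minimally_globally_rigid E VA VD p : Prop :=
  globally_rigid E VA VD p /\
  forall e, e \in E -> ~ globally_rigid (E :\ e) VA VD p.

Definition type_A1 VA VD (i j x : 'I_n) : Prop :=
  x \in VA /\ (i \in VD \/ j \in VD).

Definition type_D1 VA VD (i j x : 'I_n) : Prop :=
  x \in VD /\ (i \in VA \/ j \in VA).

Definition type_A2 VA p (i j x : 'I_n) : Prop :=
  [/\ x \in VA, i \in VA, j \in VA & ~ collinear (row i p) (row j p) (row x p)].

Definition two_vertex_condition VA VD p (i j x y : 'I_n) : Prop :=
  let S := [set i; j; x; y] in
  [/\ #|S :&: VA| = 3%N, #|S :&: VD| = 1%N &
      forall a b c, S :&: VA = [set a; b; c] ->
        ~ collinear (row a p) (row b p) (row c p)].

(* constructed VA VD p t o N E: the graph with vertices 0, ..., N - 1 and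
   edges E arises from the edge {0, 1} by t two-vertex additions and o
   one-vertex additions, in any order.  Vertices never move nor change part,
   so VA, VD and p are those of the final framework on 'I_n throughout, and an
   intermediate framework only uses their restriction to the vertices < N. *)
Inductive constructed VA VD p :
    nat -> nat -> nat -> {set {set 'I_n}} -> Prop :=
| start_edge (x y : 'I_n) :
    x = 0%N :> nat -> y = 1%N :> nat -> row x p != row y p ->
    constructed VA VD p 0 0 2 [set [set x; y]]
| one_vertex_addition t o N E (i j x : 'I_n) :
    constructed VA VD p t o N E ->
    (i < N)%N -> (j < N)%N -> i != j -> x = N :> nat ->
    [\/ type_A1 VA VD i j x, type_D1 VA VD i j x | type_A2 VA p i j x] ->
    constructed VA VD p t o.+1 N.+1
      (E :|: [set [set x; i]; [set x; j]])
| two_vertex_addition t o N E (i j x y : 'I_n) :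
    constructed VA VD p t o N E ->
    (i < N)%N -> (j < N)%N -> i != j -> x = N :> nat -> y = N.+1 :> nat ->
    two_vertex_condition VA VD p i j x y ->
    constructed VA VD p t.+1 o N.+2
      (E :|: [set [set j; x]; [set x; y]; [set y; i]]).

End Framework.

(* Main.v *)
(* Put the plane in the complex numbers.  A second configuration q of the
   framework is recorded by its edge factors z_uv = (q_v - q_u) / (p_v - p_u):
   it lies in the fibre of p iff, at every vertex, the incident factors have the
   same argument (vertices of V_A) or the same modulus (vertices of V_D), i.e.
   are related to a common frame f_v.  Frameworks in the fibre of the complete
   graph are the similar ones.

   Rigidity follows the construction: along an added path the factors are
   related to the frame z of the old part, and the closing equation of the path
   forces all of them to be equal to z.

   For minimality we follow, from the deletion of an edge on, small nontrivial
   states of what remains.  Each later two-vertex addition extends any state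
   near p, by solving a real linear system (Cramer).  A one-vertex addition
   imposes one real equation F = 0, so we carry a whole loop of states around p,
   passing through p + r nu and p - r nu along a flex nu whose edge factors are
   real.  There F = r c(nu) + O(r^2) with c linear: if c(nu) <> 0, F vanishes
   somewhere on the loop.  If c(nu) = 0, then either F vanishes at p + r nu, or
   some other such flex has c <> 0 because p is generic: the rank of the linear
   system defining the flexes extended by c is maximal at p, so that c = 0 on
   all flexes would persist at degenerate positions, where it is refuted. *)

Require Import Defs.
From HB Require Import structures.
From mathcomp Require Import all_boot all_order all_algebra.
From mathcomp Require Import all_classical all_reals all_analysis.
From mathcomp Require Import complex ring lra zify.
From mathcomp Require mpoly.
Import -(notations) mpoly.

Set Implicit Arguments.
Unset Strict Implicit.
Unset Printing Implicit Defensive.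

Import Order.TTheory GRing.Theory Num.Theory.
Import numFieldNormedType.Exports.

Local Open Scope classical_set_scope.
Local Open Scope ring_scope.

(** The argument is shaped by a count. A state has three real unknowns per vertex, two for the
    position and one for the frame, of which only the argument or the modulus matters; an edge
    imposes two real conditions, one at each end. So the initial edge leaves the four parameters of
    the similarities, a two-vertex addition is balanced, and a one-vertex addition is overdetermined
    by one. Deleting an edge frees two parameters, and the single one-vertex addition uses up one of
    them. Hence a loop in a two-parameter family is carried up to that addition, and only a curve
    after it.

    States stay near the base because angle vertices ask for positive quotients while the equations
    only yield real ones; a real number near 1 is positive. Flexes with real edge factors are
    singled out because the frames along them are positive reals: the extensions by Cramer's rule
    are then exactly affine in $r$, and $F$ is exactly $rc+r^2d$. Genericity has to deal with the
    quadratic term: for two types of one-vertex addition, $c=0$ does not force $d=0$. *)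

HB.instance Definition _ (R : realType) := NormedModule.copy R[i] R[i]^o.

(** * Complex numbers as vectors of the plane: cross products and Cramer's rule *)

Section ComplexPlane.
Variable R : realType.
Local Notation C := R[i].
Implicit Types (a b c z s t : C).

Lemma conjc_realP z : reflect (conjc z = z) (z \is Num.real).
Proof.
apply: (iffP (complex_realP z)) => [[k ->]|]; first by rewrite conjc_real.
case: z => x y [] /eqP; rewrite -subr_eq0 -opprD oppr_eq0 => hy.
exists x; apply/eqP; rewrite eq_complex /= eqxx /=.
by move: hy; rewrite -mulr2n mulrn_eq0.
Qed.

Lemma conjcM a b : conjc (a * b) = conjc a * conjc b.
Proof. exact: rmorphM. Qed.

Lemma conjcD a b : conjc (a + b) = conjc a + conjc b.
Proof. exact: rmorphD. Qed.

Lemma conjcB a b : conjc (a - b) = conjc a - conjc b.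
Proof. exact: rmorphB. Qed.

(* [cr a b] is -2i times the cross product of [a] and [b]. *)
Definition cr a b : C := a * conjc b - conjc a * b.

Lemma conj_cr a b : conjc (cr a b) = - cr a b.
Proof. by rewrite /cr rmorphB !rmorphM /= !conjcK; ring. Qed.

Lemma crN a b : cr b a = - cr a b.
Proof. by rewrite /cr; ring. Qed.

Lemma crDl a b c : cr (a + b) c = cr a c + cr b c.
Proof. by rewrite /cr rmorphD; ring. Qed.

Lemma crDr a b c : cr c (a + b) = cr c a + cr c b.
Proof. by rewrite /cr rmorphD; ring. Qed.

Lemma crrr a : cr a a = 0.
Proof. by rewrite /cr; ring. Qed.

Lemma crZl s a b : s \is Num.real -> cr (s * a) b = s * cr a b.
Proof. by move=> /conjc_realP hs; rewrite /cr rmorphM /= hs; ring. Qed.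

Lemma crZr s a b : s \is Num.real -> cr a (s * b) = s * cr a b.
Proof. by move=> /conjc_realP hs; rewrite /cr rmorphM /= hs; ring. Qed.

Lemma cr_mul2 z a b : cr (z * a) (z * b) = `|z| ^+ 2 * cr a b.
Proof. by rewrite /cr !rmorphM /= sqr_normc; ring. Qed.

Lemma cr_ratio_real a b c d : cr a b / cr c d \is Num.real.
Proof.
by apply/conjc_realP; rewrite rmorphM fmorphV /= !conj_cr invrN mulrNN.
Qed.

(** Taking [cr] of the relation with [b], then with [a], kills one of the two terms each time. *)
Lemma cr_indep s t a b : s \is Num.real -> t \is Num.real -> cr a b != 0 ->
  s * a + t * b = 0 -> s = 0 /\ t = 0.
Proof.
move=> rs rt h e.
have e1 : s * cr a b = 0.
  have := congr1 (fun x => cr x b) e.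
  by rewrite /= crDl !crZl // crrr mulr0 addr0 => ->; rewrite /cr rmorph0; ring.
have e2 : t * cr a b = 0.
  have := congr1 (fun x => cr a x) e.
  by rewrite /= crDr !crZr // crrr mulr0 add0r => ->; rewrite /cr rmorph0; ring.
by split; apply/eqP; [move: e1|move: e2] => /eqP; rewrite mulf_eq0 (negPf h) orbF.
Qed.

Lemma cramer a b c : cr a b != 0 ->
  c = cr c b / cr a b * a + cr a c / cr a b * b.
Proof.
move=> h; have e : cr a b * c = cr c b * a + cr a c * b by rewrite /cr; ring.
by rewrite ![_ / _ * _]mulrAC -mulrDl -e mulrC mulKf.
Qed.

End ComplexPlane.

(** * The relation between a frame and the factor of an incident edge *)

Section FrameRelation.
Variables (R : realType) (n : nat) (A : {set 'I_n}).
Local Notation C := R[i].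
Implicit Types (c z w : C) (v : 'I_n).

(* The stretch-rotation factors [z] of the edges at [v] are those related to a
   common frame [c]: same argument if [v] measures angles, same modulus if it
   measures ratios of distances. *)
Definition frel v c z : Prop :=
  if v \in A then is_true (0 < z / c) else `|z| = `|c| /\ c != 0.

(** In the angle case the convention $z/0=0$ makes positivity of the quotient exclude a zero
    frame. *)
Lemma frel_neq0l v c z : frel v c z -> c != 0.
Proof.
rewrite /frel; case: ifP => _; last by case.
by move=> h; apply: contraTneq h => ->; rewrite invr0 mulr0 ltxx.
Qed.

Lemma frel_neq0r v c z : frel v c z -> z != 0.
Proof.
rewrite /frel; case: ifP => _.
  by move=> h; apply: contraTneq h => ->; rewrite mul0r ltxx.
by move=> [e h]; rewrite -normr_eq0 e normr_eq0.
Qed.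

Lemma frel_refl v c : c != 0 -> frel v c c.
Proof. by rewrite /frel; case: ifP => // _ h; rewrite divff. Qed.

Lemma frel_sym v c z : frel v c z -> frel v z c.
Proof.
move=> h; have h0 := frel_neq0r h; move: h; rewrite /frel; case: ifP => _.
  by rewrite -invr_gt0 invf_div.
by move=> [-> _].
Qed.

Lemma frel_trans v c z w : frel v c z -> frel v z w -> frel v c w.
Proof.
move=> h1 h2; have h0 := frel_neq0l h2; move: h1 h2.
rewrite /frel; case: ifP => _; last by move=> [-> ->] [->].
move=> h1 h2; have -> : w / c = (z / c) * (w / z) by rewrite [RHS]mulrC mulrA divfK.
by rewrite mulr_gt0.
Qed.

Lemma frelM v k c z : k != 0 -> frel v c z -> frel v (k * c) (k * z).
Proof.
move=> k0; rewrite /frel; case: ifP => _; first by rewrite -mulf_div divff // mul1r.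
by move=> [e c0]; rewrite !normrM e mulf_neq0.
Qed.

Lemma frelA v c z : v \in A -> frel v c z = (0 < z / c) :> Prop.
Proof. by rewrite /frel => ->. Qed.

Lemma frelD v c z : v \notin A -> frel v c z = (`|z| = `|c| /\ c != 0) :> Prop.
Proof. by rewrite /frel => /negPf ->. Qed.

End FrameRelation.

(** * States: a position and a frame for every vertex *)

Section States.
Variables (R : realType) (n : nat) (A : {set 'I_n}) (P : 'I_n -> R[i]).
Local Notation C := R[i].
Implicit Types (q c : 'I_n -> C) (E : {set {set 'I_n}}).

Definition edge_factor q (u v : 'I_n) : C := (q v - q u) / (P v - P u).

Lemma edge_factorC q u v : edge_factor q u v = edge_factor q v u.
Proof.
by rewrite /edge_factor -(opprB (q u)) -(opprB (P u)) invrN mulrNN.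
Qed.

(** Ordered pairs are quantified over, so every edge is tested at both ends. The relation is a
    parameter because finite states ([frel]) and infinitesimal ones ([lrel], below) have the same
    shape. *)
Definition edges_satisfy (rel : 'I_n -> C -> C -> Prop) E q c : Prop :=
  forall u v, u != v -> [set u; v]%SET \in E ->
    rel u (c u) (edge_factor q u v).

(** The trivial states of the part built so far. The frames have to agree with the factor [z] too,
    so a state that moves no vertex can still be nontrivial through its frames. *)
Definition similar_below N q c : Prop :=
  exists z t : C, forall v : 'I_n, (v < N)%N ->
    q v = z * P v + t /\ frel A v (c v) z.

Lemma edges_satisfyS rel E E' q c : E' \subset E -> edges_satisfy rel E q c ->
  edges_satisfy rel E' q c.
Proof. by move=> /fintype.subsetP s h u v uv /s; apply: h. Qed.

Lemma edges_satisfyU rel E E' q c : edges_satisfy rel E q c ->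
  edges_satisfy rel E' q c -> edges_satisfy rel (E :|: E') q c.
Proof. by move=> h h' u v uv; rewrite inE => /orP[]; [apply: h|apply: h']. Qed.

Lemma edges_satisfy1 rel q c a b :
  rel a (c a) (edge_factor q a b) -> rel b (c b) (edge_factor q a b) ->
  edges_satisfy rel [set [set a; b]]%SET q c.
Proof.
move=> ha hb u v uv; rewrite inE => /eqP e.
have : u \in [set a; b]%SET by rewrite -e !inE eqxx.
have : v \in [set a; b]%SET by rewrite -e !inE eqxx orbT.
rewrite !inE => /orP[] /eqP ev /orP[] /eqP eu; move: uv; rewrite eu ev ?eqxx // => _.
by rewrite edge_factorC.
Qed.

Lemma edges_satisfy_ext rel (S : pred 'I_n) E q c q' c' :
  (forall e, e \in E -> forall v, v \in e -> S v) ->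
  (forall v : 'I_n, S v -> q v = q' v /\ c v = c' v) ->
  edges_satisfy rel E q c -> edges_satisfy rel E q' c'.
Proof.
move=> hE hN h u v uv he; have := h u v uv he.
have [eu eu'] : q u = q' u /\ c u = c' u by apply/hN/(hE _ he); rewrite !inE eqxx.
have [ev _] : q v = q' v /\ c v = c' v by apply/hN/(hE _ he); rewrite !inE eqxx orbT.
by rewrite eu' /edge_factor eu ev.
Qed.

Lemma similar_below_ext N N' q c q' c' : (N <= N')%N ->
  (forall v : 'I_n, (v < N)%N -> q v = q' v /\ c v = c' v) ->
  similar_below N' q' c' -> similar_below N q c.
Proof.
move=> hN e [z [t h]]; exists z, t => v hv; have [-> ->] := e v hv.
by apply: h; apply: leq_trans hN.
Qed.

End States.

Notation compatible A P := (edges_satisfy P (frel A)).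

(** * Fibres of the measurement map *)

Lemma unit_mul_field (F : fieldType) (a' b a na nb : F) : a != 0 -> na != 0 ->
  nb != 0 -> a' * a = na * na -> a' / na * (b / nb) = b / a / (nb / na).
Proof.
move=> a0 na0 nb0 e; have -> : a' = na * na / a by rewrite -e mulfK.
by field; rewrite a0 na0 nb0.
Qed.

Lemma div_divC (F : fieldType) (a b c d : F) :
  a / b / (c / d) = a / c / (b / d).
Proof. by rewrite !invf_div mulf_div [RHS]mulf_div [b * c]mulrC. Qed.

Lemma div_swap_iff (F : fieldType) (a b c d : F) : b != 0 -> c != 0 -> d != 0 ->
  a / b = c / d <-> a / c = b / d.
Proof.
move=> b0 c0 d0; split=> /eqP; rewrite eqr_div // => /eqP e; apply/eqP.
  by rewrite eqr_div // e mulrC.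
by rewrite eqr_div // e mulrC.
Qed.

Section Measurements.
Variable R : realType.
Local Notation C := R[i].
Implicit Types (u v : 'rV[R]_2) (a b : C).

Definition toC u : C := Complex (u 0 0) (u 0 1).

Lemma toC_inj : injective toC.
Proof.
move=> u v [e0 e1]; apply/rowP => k; case: k => -[|[|//]] h.
  by rewrite (_ : Ordinal h = 0) //; apply: val_inj.
by rewrite (_ : Ordinal h = 1) //; apply: val_inj.
Qed.

Lemma toCB u v : toC (u - v) = toC u - toC v.
Proof. by rewrite /toC !mxE. Qed.

Lemma toCZ (k : R) u : toC (k *: u) = k%:C%C * toC u.
Proof. by rewrite /toC !mxE; apply/eqP; rewrite eq_complex /= !mul0r subr0 addr0 !eqxx. Qed.

Lemma dotE u v : dot u v = u 0 0 * v 0 0 + u 0 1 * v 0 1.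
Proof.
rewrite /dot big_ord_recl big_ord1 (_ : lift ord0 ord0 = 1) //.
exact: val_inj.
Qed.

Lemma norm2E u : (norm2 u)%:C%C = `|toC u|.
Proof.
by rewrite normc_def /norm2 dotE /= !expr2.
Qed.

Lemma dot_crossE u v : Complex (dot u v) (cross u v) = conjc (toC u) * toC v.
Proof.
by apply/eqP; rewrite eq_complex dotE /cross /= !mulNr opprK !eqxx.
Qed.

Lemma dot_unit_le1 u v : `|toC u| = 1 -> `|toC v| = 1 -> -1 <= dot u v <= 1.
Proof.
move=> hu hv; have := normc_ge_Re (conjc (toC u) * toC v).
rewrite normrM normcJ hu hv mul1r -dot_crossE /= -[1]/(1%:C%C) lecR ler_norml.
by [].
Qed.

Lemma cross_dot_unit u v : `|toC u| = 1 -> `|toC v| = 1 ->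
  dot u v ^+ 2 + cross u v ^+ 2 = 1.
Proof.
move=> hu hv; apply: complexI.
have := add_Re2_Im2 (conjc (toC u) * toC v).
by rewrite normrM normcJ hu hv mul1r expr1n -dot_crossE /=.
Qed.

(** The first branch of [ccw_angle] takes values at most $\pi$; in the second the negative cross
    product excludes the cosine $-1$, so the values exceed $\pi$. Equal angles thus come from the
    same branch, with equal cosines, and the cross product is determined by its square and its
    sign. *)
Lemma ccw_angle_eq u v u' v' : `|toC u| = 1 -> `|toC v| = 1 ->
  `|toC u'| = 1 -> `|toC v'| = 1 ->
  ccw_angle u v = ccw_angle u' v' <->
  conjc (toC u) * toC v = conjc (toC u') * toC v'.
Proof.
move=> hu hv hu' hv'; rewrite -!dot_crossE; split=> [|[e1 e2]]; last first.
  by rewrite /ccw_angle e1 e2.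
have d1 := dot_unit_le1 hu hv; have d2 := dot_unit_le1 hu' hv'.
have s1 := cross_dot_unit hu hv; have s2 := cross_dot_unit hu' hv'.
rewrite /ccw_angle => e.
have dd : dot u v = dot u' v' -> (0 <= cross u v) = (0 <= cross u' v') ->
    Complex (dot u v) (cross u v) = Complex (dot u' v') (cross u' v').
  move=> de ce; rewrite de; congr Complex.
  have : cross u v ^+ 2 = cross u' v' ^+ 2.
    by apply: (addrI (dot u v ^+ 2)); rewrite s1 de s2.
  move/eqP; rewrite eqf_sqr => /orP[/eqP //|/eqP h].
  by move: ce h; case: ltP => h1; case: ltP => h2 // _ h3; lra.
have small w w' : `|toC w| = 1 -> `|toC w'| = 1 -> ~~ (0 <= cross w w') ->
    acos (dot w w') < pi.
  move=> hw hw' h; have hd := dot_unit_le1 hw hw'.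
  rewrite lt_neqAle acos_lepi // andbT; apply/eqP => hpi.
  have : dot w w' = -1 by rewrite -(acosK (x := dot w w')) ?hpi ?cospi // in_itv.
  have := cross_dot_unit hw hw' => + h'; rewrite h' sqrrN expr1n => h''.
  have /eqP : cross w w' ^+ 2 = 0 by lra.
  by rewrite expf_eq0 /= => /eqP h3; move: h; rewrite h3 lexx.
have acos_inj x y : -1 <= x <= 1 -> -1 <= y <= 1 -> acos x = acos y -> x = y :> R.
  by move=> hx hy h; rewrite -(acosK (x := x)) ?in_itv // h acosK ?in_itv.
case: ifPn e => h1; case: ifPn => h2 e.
- by apply: dd; rewrite ?h1 ?h2 //; apply: acos_inj.
- have := small _ _ hu' hv' h2; have := acos_lepi d1; rewrite e mulr2n => a3 a4; exfalso; move: a3 a4; clear; lra.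
- have := small _ _ hu hv h1; have := acos_lepi d2; rewrite -e mulr2n => a3 a4; exfalso; move: a3 a4; clear; lra.
- apply: dd; last by rewrite (negPf h1) (negPf h2).
  by apply: acos_inj => //; apply: oppr_inj; apply: (addrI (pi *+ 2)).
Qed.

Lemma unit_eqP a b : a != 0 -> b != 0 ->
  a / `|a| = b / `|b| <-> 0 < a / b.
Proof.
move=> a0 b0; have na : `|a| != 0 by rewrite normr_eq0.
have nb : `|b| != 0 by rewrite normr_eq0.
split=> [e|h].
  have -> : a = `|a| / `|b| * b by rewrite mulrAC -mulrA -e mulrC divfK.
  by rewrite mulfK // divr_gt0 ?normr_gt0.
have e : a = (a / b) * b by rewrite divfK.
by rewrite {1 2}e normrM (gtr0_norm h) -mulf_div divff ?mul1r // lt0r_neq0.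
Qed.

End Measurements.

Section Fibres.
Variables (R : realType) (n : nat).
Local Notation C := R[i].
Implicit Types (p q : 'M[R]_(n, 2)) (E : {set {set 'I_n}}) (u v w : 'I_n).

Lemma subr_neq (a b : C) : (a != b) = (a - b != 0).
Proof. by rewrite subr_eq0. Qed.

Definition positions p (v : 'I_n) : C := toC (row v p).

Lemma toC_bearing p u v :
  toC (bearing p u v) = (positions p v - positions p u) / `|positions p v - positions p u|.
Proof.
by rewrite /bearing toCZ fmorphV /= norm2E toCB mulrC.
Qed.

(** The angle is the argument of $(p_w-p_u)/(p_v-p_u)$. Equality for [p] and [q] says that the
    quotient of the two ratios is positive, and that quotient is $z_{uw}/z_{uv}$. *)
Lemma signed_angle_eq p q u v w :
  positions p v != positions p u -> positions p w != positions p u ->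
  positions q v != positions q u -> positions q w != positions q u ->
  signed_angle q (u, v, w) = signed_angle p (u, v, w) <->
  0 < edge_factor (positions p) (positions q) u w
      / edge_factor (positions p) (positions q) u v.
Proof.
have nu (a : C) : a != 0 -> `|a / `|a| | = 1.
  by move=> a0; rewrite normf_div normr_id divff // normr_eq0.
have cj (a b : C) : a != 0 -> b != 0 ->
    conjc (a / `|a|) * (b / `|b|) = (b / a) / `|b / a|.
  move=> a0 b0; have na : `|a| != 0 by rewrite normr_eq0.
  have nb : `|b| != 0 by rewrite normr_eq0.
  rewrite conjcM conjc_inv (conjc_realP _ (normr_real a)).
  by rewrite normf_div (unit_mul_field (a' := conjc a) b a0 na nb) // mulrC -sqr_normc expr2.
move=> pv pw qv qw; rewrite subr_neq in pv; rewrite subr_neq in pw.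
rewrite subr_neq in qv; rewrite subr_neq in qw; rewrite /= ccw_angle_eq ?toC_bearing ?nu // !cj //.
rewrite unit_eqP ?mulf_neq0 ?invr_neq0 // /edge_factor.
by rewrite div_divC.
Qed.

Lemma ratio_of_distance_eq p q u v w :
  positions p v != positions p u -> positions p w != positions p u ->
  positions q v != positions q u -> positions q w != positions q u ->
  ratio_of_distance q (u, v, w) = ratio_of_distance p (u, v, w) <->
  `|edge_factor (positions p) (positions q) u w|
    = `|edge_factor (positions p) (positions q) u v|.
Proof.
move=> pv pw qv qw; rewrite subr_neq -normr_eq0 in pv.
rewrite subr_neq -normr_eq0 in pw; rewrite subr_neq -normr_eq0 in qv.
rewrite subr_neq -normr_eq0 in qw; rewrite /= /edge_factor !normf_div.
apply: (iff_trans _ (div_swap_iff _ _ _ _)) => //.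
rewrite -!toCB -!norm2E -!fmorphV -!rmorphM; split=> [->//|].
exact: complexI.
Qed.

(** The order $v<w$ of [triples] is dropped: exchanging [v] and [w] inverts the quotient, and for
    $v=w$ the conditions hold as soon as the factor is nonzero. *)
Definition edges_match E (VA VD : {set 'I_n}) p q : Prop :=
  forall u v w : 'I_n, [set u; v]%SET \in E -> [set u; w]%SET \in E ->
    let z x := edge_factor (positions p) (positions q) u x in
    (u \in VA -> 0 < z w / z v) /\ (u \in VD -> `|z w| = `|z v|).

Variables (VA VD : {set 'I_n}) (p : 'M[R]_(n, 2)).
Hypothesis hinj : injective (fun i : 'I_n => row i p).

Lemma positions_inj : injective (positions p).
Proof. by move=> u v /toC_inj /hinj. Qed.

Lemma edge_neq E u v : E \subset complete_graph n -> [set u; v]%SET \in E -> u != v.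
Proof.
by move=> /fintype.subsetP s /s; rewrite inE cards2; case: (u == v).
Qed.

Lemma SARoD_fibreP E q : E \subset complete_graph n ->
  SARoD_fibre E VA VD p q <->
  (forall u v, u != v -> [set u; v]%SET \in E -> positions q u != positions q v) /\
  edges_match E VA VD p q.
Proof.
move=> sE; rewrite /SARoD_fibre /=.
have domE : SARoD_domain E q <->
    (forall u v, u != v -> [set u; v]%SET \in E -> positions q u != positions q v).
  split=> h u v uv huv; have := h u v uv huv; apply: contra_neq.
    exact: toC_inj.
  by rewrite /positions => ->.
split=> -[hd hm]; [have {}hd := domE.1 hd|have hd' := domE.2 hd]; split=> //.
  have hp u v : u != v -> positions p v != positions p u.
    by rewrite eq_sym; apply: contra_neq => /positions_inj.
  have hq u v : [set u; v]%SET \in E -> positions q v != positions q u.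
    by move=> h; rewrite eq_sym hd // (edge_neq sE h).
  have [hA hD] := eq_col_mx hm.
  have ef0 u v : [set u; v]%SET \in E ->
      edge_factor (positions p) (positions q) u v != 0.
    move=> h; rewrite /edge_factor mulf_neq0 ?invr_neq0 // subr_eq0 ?hq ?hp //.
    exact: edge_neq h.
  move=> u v w hv hw /=; split=> hu.
    case: (ltngtP v w) => hvw; last by rewrite (val_inj hvw) divff ?ef0.
      have ht : (u, v, w) \in triples E VA by rewrite inE /= hu hv hw.
      have := congr1 (fun M : 'cV_ _ => M (enum_rank_in ht (u, v, w)) 0) hA.
      rewrite !mxE enum_rankK_in // signed_angle_eq ?hq ?hp ?(edge_neq sE hv) ?(edge_neq sE hw) //.
    have ht : (u, w, v) \in triples E VA by rewrite inE /= hu hv hw.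
    have := congr1 (fun M : 'cV_ _ => M (enum_rank_in ht (u, w, v)) 0) hA.
    rewrite !mxE enum_rankK_in // signed_angle_eq ?hq ?hp ?(edge_neq sE hv) ?(edge_neq sE hw) //.
    by rewrite -invr_gt0 invf_div.
  case: (ltngtP v w) => hvw; last by rewrite (val_inj hvw).
    have ht : (u, v, w) \in triples E VD by rewrite inE /= hu hv hw.
    have := congr1 (fun M : 'cV_ _ => M (enum_rank_in ht (u, v, w)) 0) hD.
    by rewrite !mxE enum_rankK_in // ratio_of_distance_eq ?hq ?hp ?(edge_neq sE hv) ?(edge_neq sE hw).
  have ht : (u, w, v) \in triples E VD by rewrite inE /= hu hv hw.
  have := congr1 (fun M : 'cV_ _ => M (enum_rank_in ht (u, w, v)) 0) hD.
  by rewrite !mxE enum_rankK_in // ratio_of_distance_eq ?hq ?hp ?(edge_neq sE hv) ?(edge_neq sE hw).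
have hp u v : u != v -> positions p v != positions p u.
  by rewrite eq_sym; apply: contra_neq => /positions_inj.
have hq u v : [set u; v]%SET \in E -> positions q v != positions q u.
  by move=> h; rewrite eq_sym hd // (edge_neq sE h).
rewrite /SARoD; congr col_mx; apply/colP => k; rewrite !mxE.
  have := enum_valP k; case: (enum_val k) => -[u v] w; rewrite inE /= => /and4P[hu hv hw _].
  rewrite signed_angle_eq ?hq ?hp ?(edge_neq sE hv) ?(edge_neq sE hw) //.
  by have [+ _] := hm u v w hv hw; apply.
have := enum_valP k; case: (enum_val k) => -[u v] w; rewrite inE /= => /and4P[hu hv hw _].
rewrite ratio_of_distance_eq ?hq ?hp ?(edge_neq sE hv) ?(edge_neq sE hw) //.
by have [_ +] := hm u v w hv hw; apply.
Qed.

Hypothesis hAD : bipartition VA VD.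

Lemma notin_VA v : (v \notin VA) = (v \in VD).
Proof.
case: hAD => /setP /(_ v) + hd _ _; rewrite !inE.
by have := disjointFr hd (x := v); case: (v \in VA) => [-> //|_ /= ->].
Qed.

Lemma compatible_fibre E q c : E \subset complete_graph n ->
  compatible VA (positions p) E (positions q) c -> SARoD_fibre E VA VD p q.
Proof.
move=> sE h; apply/SARoD_fibreP => //; split=> [u v uv /(h u v uv) /frel_neq0r|].
  by rewrite /edge_factor; apply: contraNneq => ->; rewrite subrr mul0r.
move=> u v w hv hw /=.
have := frel_trans (frel_sym (h u v (edge_neq sE hv) hv)) (h u w (edge_neq sE hw) hw).
by rewrite /frel -notin_VA; case: ifP => // _ [].
Qed.

Lemma fibre_compatible E q : E \subset complete_graph n ->
  SARoD_fibre E VA VD p q ->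
  exists c, compatible VA (positions p) E (positions q) c.
Proof.
move=> sE /(SARoD_fibreP _ sE) [hd hm].
(* Any incident edge supplies the frame, since the factors around a vertex are all related; an
   isolated vertex gets the arbitrary frame 1. *)
pose c u : C := if [pick v | [set u; v]%SET \in E] is Some v
  then edge_factor (positions p) (positions q) u v else 1.
exists c => u v uv huv; rewrite /c; case: pickP => [w hw|/(_ v)]; last by rewrite huv.
have [hA hD] := hm u w v hw huv.
rewrite /frel -/(edge_factor _ _ _ _); case: ifPn => [/hA //|].
rewrite notin_VA => /hD ->; split=> //.
rewrite /edge_factor mulf_neq0 ?invr_neq0 // subr_eq0.
  by rewrite eq_sym hd // (edge_neq sE hw).
by rewrite eq_sym; apply: contra_neq (edge_neq sE hw) => /positions_inj.
Qed.

Definition matrix_of (q : 'I_n -> C) : 'M[R]_(n, 2) :=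
  \matrix_(i, j) if j == 0 then complex.Re (q i) else complex.Im (q i).

Lemma positions_matrix_of (q : 'I_n -> C) v : positions (matrix_of q) v = q v.
Proof. by rewrite /positions /toC !mxE /=; case: (q v). Qed.

Lemma edge_factor_similar (z t : C) (q : 'I_n -> C) u v : u != v ->
  q u = z * positions p u + t -> q v = z * positions p v + t ->
  edge_factor (positions p) q u v = z.
Proof.
move=> uv eu ev; rewrite /edge_factor eu ev opprD addrACA subrr addr0 -mulrBr mulfK //.
by rewrite subr_eq0 eq_sym; apply: contra_neq uv => /positions_inj.
Qed.

(** One inclusion holds because the complete graph imposes all the conditions of [E]. For the other,
    a similar copy has the constant factor [z], which is compatible with the constant frame [z] on
    every edge. *)
Lemma globally_rigidI E : E \subset complete_graph n ->
  (forall q c : 'I_n -> C, compatible VA (positions p) E q c ->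
    exists z t : C, z != 0 /\ forall v, q v = z * positions p v + t) ->
  globally_rigid E VA VD p.
Proof.
move=> sE h; rewrite /globally_rigid; apply/seteqP; split=> q.
  move=> /(fibre_compatible sE) [c /h [z [t [z0 e]]]].
  apply: (@compatible_fibre _ _ (fun=> z)) => // u v uv _.
  by rewrite (edge_factor_similar uv (e u) (e v)); apply: frel_refl.
move=> /(SARoD_fibreP _ (subxx _)) [hd hm].
apply/(SARoD_fibreP _ sE); split=> [u v uv _|u v w hv hw].
  by apply: hd => //; rewrite inE cards2 uv.
by apply: hm; apply: (fintype.subsetP sE).
Qed.

(** The fibre of the complete graph is not computed directly: it equals that of the rigid framework
    on [E], which consists of similar copies. *)
Lemma globally_rigidE E E' (q c : 'I_n -> C) : E \subset complete_graph n -> E' \subset E ->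
  (forall q c : 'I_n -> C, compatible VA (positions p) E q c ->
    exists z t : C, z != 0 /\ forall v, q v = z * positions p v + t) ->
  globally_rigid E' VA VD p -> compatible VA (positions p) E' q c ->
  exists z t : C, z != 0 /\ forall v, q v = z * positions p v + t.
Proof.
move=> sE sE' h; have sE'' := fintype.subset_trans sE' sE.
have hK := globally_rigidI sE h; move=> hK' hc.
have : SARoD_fibre E' VA VD p (matrix_of q).
  apply: (@compatible_fibre _ _ c) => //.
  by rewrite (_ : positions (matrix_of q) = q) //; apply: funext => v; rewrite positions_matrix_of.
rewrite hK' -hK => /(fibre_compatible sE) [c' /h [z [t [z0 e]]]].
by exists z, t; split=> // v; rewrite -e positions_matrix_of.
Qed.

End Fibres.

(** * Rigidity of the constructed frameworks *)

Section Constructions.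
Variables (R : realType) (n : nat) (A : {set 'I_n}) (P : 'I_n -> R[i]).
Hypothesis P_inj : injective P.
Local Notation C := R[i].
Implicit Types (q f : 'I_n -> C) (E : {set {set 'I_n}}).
Implicit Types (i j a b c d x y u v : 'I_n).

Lemma subP_neq0 u v : u != v -> P u - P v != 0.
Proof. by rewrite subr_eq0; apply: contra_neq => /P_inj. Qed.

Lemma edge_factorK q u v : u != v -> edge_factor P q u v * (P v - P u) = q v - q u.
Proof. by move=> uv; rewrite /edge_factor divfK // subP_neq0 // eq_sym. Qed.

(** An added path [a], [b], [c], [d] has exactly one distance vertex; up to reversal it is the end
    [d] or the inner vertex [b]. The cross product says that the other three vertices form a proper
    triangle. *)
Definition ear_cond a b c d : Prop :=
  [/\ d \notin A, a \in A, b \in A & c \in A] /\ cr (P b - P a) (P c - P b) != 0 \/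
  [/\ b \notin A, a \in A, c \in A & d \in A] /\ cr (P c - P a) (P d - P c) != 0.

(** Listing the classes of [i], [x], [j] in this order, the cases are AAA (with a proper triangle),
    DAA, ADA, ADD and DAD. Reversing the path covers the remaining admissible types. *)
Definition link_cond i x j : Prop :=
  [/\ x \in A, i \in A, j \in A & cr (P x - P i) (P j - P x) != 0] \/
  [\/ [/\ x \in A, i \notin A & j \in A], [/\ x \notin A, i \in A & j \in A],
      [/\ x \notin A, i \in A & j \notin A] | [/\ x \in A, i \notin A & j \notin A]].

(* [built o N E]: as [constructed], with [o] one-vertex additions, and with the
   old and new vertices of each addition listed along the added path. *)
Inductive built : nat -> nat -> {set {set 'I_n}} -> Prop :=
| built_edge a b : a = 0%N :> nat -> b = 1%N :> nat -> built 0 2 [set [set a; b]]%SET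
| built_link o N E i j x : built o N E -> (i < N)%N -> (j < N)%N -> i != j ->
    x = N :> nat -> link_cond i x j ->
    built o.+1 N.+1 (E :|: [set [set i; x]; [set x; j]])%SET
| built_ear o N E a b c d : built o N E -> (a < N)%N -> (d < N)%N -> a != d ->
    (N <= b < N.+2)%N -> (N <= c < N.+2)%N -> b != c -> ear_cond a b c d ->
    built o N.+2 (E :|: [set [set a; b]; [set b; c]; [set c; d]])%SET.

Lemma built_edge_lt o N E : built o N E -> forall e, e \in E ->
  exists u v, [/\ e = [set u; v]%SET, u != v, (u < N)%N & (v < N)%N].
Proof.
elim=> {o N E}.
- move=> a b ea eb e; rewrite inE => /eqP ->; exists a, b.
  by split; rewrite ?ea ?eb //; rewrite -val_eqE /= ea eb.
- move=> o N E i j x _ IH hi hj ij hx _ e; rewrite !inE.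
  case/orP=> [/IH [u [v [-> uv hu hv]]]|].
    by exists u, v; split=> //; apply: ltnW.
  by case/orP=> /eqP ->; [exists i, x|exists x, j]; split; rewrite // -?val_eqE /=; lia.
move=> o N E a b c d _ IH ha hd ad hb hc bc _ e; rewrite !inE.
case/orP=> [/IH [u [v [-> uv hu hv]]]|]; first by exists u, v; split=> //; lia.
by case/orP=> [/orP[]|] /eqP ->; [exists a, b|exists b, c|exists c, d];
  split; rewrite // -?val_eqE /=; lia.
Qed.

Lemma built_complete o N E : built o N E -> E \subset complete_graph n.
Proof.
move=> h; apply/fintype.subsetP => e /(built_edge_lt h) [u [v [-> uv _ _]]].
by rewrite inE cards2 uv.
Qed.

Lemma pos_norm1 (x : C) : 0 < x -> `|x| = 1 -> x = 1.
Proof. by move=> /gtr0_norm ->. Qed.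

Lemma gt0_divl (x y : C) : 0 < x -> 0 < y / x -> 0 < y.
Proof. by move=> h; rewrite pmulr_lgt0 // invr_gt0. Qed.

Lemma gt0_divr (x y : C) : 0 < y -> 0 < y / x -> 0 < x.
Proof. by move=> h; rewrite pmulr_rgt0 // invr_gt0. Qed.

(** Angle vertices force positive factors. If [d] is the distance vertex, then $|w|=1$ gives $w=1$;
    if it is [b], then $|x|=|y|$ gives $x=y$. Either way the closing equation becomes a real linear
    relation between two nonparallel vectors. *)
Lemma ear_rigid a b c d (x y w : C) : ear_cond a b c d ->
  frel A a 1 x -> frel A b x y -> frel A c y w -> frel A d 1 w ->
  x * (P b - P a) + y * (P c - P b) + w * (P d - P c) = P d - P a ->
  [/\ x = 1, y = 1 & w = 1].
Proof.
case=> -[[h1 h2 h3 h4] h].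
  rewrite (frelA _ _ h2) (frelA _ _ h3) (frelA _ _ h4) (frelD _ _ h1) normr1 divr1 => x0 hy hw [w1 _].
  have y0 := gt0_divl x0 hy; have w0 := gt0_divl y0 hw.
  rewrite (pos_norm1 w0 w1) => e.
  have [] := @cr_indep _ (x - 1) (y - 1) _ _ _ _ h.
  - by rewrite rpredB ?rpred1 ?gtr0_real.
  - by rewrite rpredB ?rpred1 ?gtr0_real.
  - apply/eqP; move: e => /eqP; rewrite -subr_eq0.
    by congr (_ == 0); ring.
  by move=> /eqP; rewrite subr_eq0 => /eqP -> /eqP; rewrite subr_eq0 => /eqP ->.
rewrite (frelA _ _ h2) (frelA _ _ h3) (frelA _ _ h4) (frelD _ _ h1) !divr1 => x0 [hy _] hw w0.
have y0 := gt0_divr w0 hw.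
have xy : y = x by rewrite -(gtr0_norm y0) hy gtr0_norm.
rewrite xy => e; have [] := @cr_indep _ (x - 1) (w - 1) _ _ _ _ h.
- by rewrite rpredB ?rpred1 ?gtr0_real.
- by rewrite rpredB ?rpred1 ?gtr0_real.
- apply/eqP; move: e => /eqP; rewrite -subr_eq0.
  by congr (_ == 0); ring.
by move=> /eqP; rewrite subr_eq0 => /eqP -> /eqP; rewrite subr_eq0 => /eqP ->.
Qed.

(** For three angle vertices the closing equation is a real relation between nonparallel vectors. In
    the other types the conditions at the vertices either fix $z=1$ or give $w=z$, and one unknown
    is left. *)
Lemma link_rigid i x j (z w : C) : link_cond i x j -> i != j -> x != j ->
  frel A i 1 z -> frel A x z w -> frel A j 1 w ->
  z * (P x - P i) + w * (P j - P x) = P j - P i -> z = 1 /\ w = 1.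
Proof.
move=> + ij xj; have ji0 : P j - P i != 0 by rewrite subP_neq0 // eq_sym.
have jx0 : P j - P x != 0 by rewrite subP_neq0 // eq_sym.
have e1 (y : C) : y * (P x - P i) + y * (P j - P x) = P j - P i -> y = 1.
  by move=> e; apply: (mulIf ji0); rewrite mul1r -[RHS]e; ring.
have e2 : 1 * (P x - P i) + w * (P j - P x) = P j - P i -> w = 1.
  move=> e; apply: (mulIf jx0); apply: (addrI (1 * (P x - P i))).
  by rewrite e; ring.
case=> [[h1 h2 h3 h]|[[h1 h2 h3]|[h1 h2 h3]|[h1 h2 h3]|[h1 h2 h3]]].
- rewrite (frelA _ _ h1) (frelA _ _ h2) (frelA _ _ h3) !divr1 => z0 _ w0 e.
  have [] := @cr_indep _ (z - 1) (w - 1) _ _ _ _ h.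
  + by rewrite rpredB ?rpred1 ?gtr0_real.
  + by rewrite rpredB ?rpred1 ?gtr0_real.
  + apply/eqP; move: e => /eqP; rewrite -subr_eq0.
    by congr (_ == 0); ring.
  by move=> /eqP; rewrite subr_eq0 => /eqP -> /eqP; rewrite subr_eq0 => /eqP ->.
- rewrite (frelA _ _ h1) (frelD _ _ h2) (frelA _ _ h3) normr1 !divr1 => -[z1 _] wz w0.
  by rewrite (pos_norm1 (gt0_divr w0 wz) z1) => /e2 ->.
- rewrite (frelD _ _ h1) (frelA _ _ h2) (frelA _ _ h3) !divr1 => z0 [wz _] w0.
  have -> : w = z by rewrite -(gtr0_norm w0) wz gtr0_norm.
  by move=> /e1 ->.
- rewrite (frelD _ _ h1) (frelA _ _ h2) (frelD _ _ h3) normr1 divr1 => z0 [wz _] [w1 _].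
  rewrite (pos_norm1 z0 _); last by rewrite -wz.
  by move=> /e2 ->.
rewrite (frelA _ _ h1) (frelD _ _ h2) (frelD _ _ h3) normr1 => -[z1 z0] wz [w1 _].
have -> : w = z.
  have hz : z != 0 by rewrite -normr_eq0 z1 oner_eq0.
  by rewrite -[w](divfK hz) (pos_norm1 wz) ?mul1r // normf_div z1 w1 divr1.
by move=> /e1 ->.
Qed.

Lemma frel_scale v (z c w : C) : frel A v c z -> frel A v c w -> frel A v 1 (w / z).
Proof.
move=> h1 h2; have z0 := frel_neq0r h1.
have := frelM (invr_neq0 z0) (frel_trans (frel_sym h1) h2).
by rewrite mulVf // mulrC.
Qed.

Lemma frel_scale2 v (z c w k : C) : k != 0 -> frel A v c z -> frel A v c w ->
  frel A v (z / k) (w / k).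
Proof.
move=> k0 h1 h2; have := frelM (invr_neq0 k0) (frel_trans (frel_sym h1) h2).
by rewrite ![k^-1 * _]mulrC.
Qed.

(** The conclusion keeps the relation between the frames and [z] because the next path meets the old
    part through the frames of its two ends. *)
Lemma built_rigid o N E q f : built o N E -> compatible A P E q f ->
  exists z t : C, z != 0 /\
    forall v, (v < N)%N -> q v = z * P v + t /\ frel A v (f v) z.
Proof.
move=> hb; elim: hb => {o N E}.
- move=> a b ea eb h; have ab : a != b by rewrite -val_eqE /= ea eb.
  have hab := h a b ab (set11 _).
  have hba : frel A b (f b) (edge_factor P q a b).
    by rewrite edge_factorC; apply: h; rewrite 1?eq_sym // finset.setUC set11.
  exists (edge_factor P q a b), (q a - edge_factor P q a b * P a).
  split=> [|v hv]; first exact: frel_neq0r hab.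
  have [->|vb] : v = a \/ v = b.
    have [v0|v0] := posnP v; [left|right]; apply: val_inj => /=; lia.
    by rewrite addrC subrK.
  by rewrite vb addrCA -mulrBr edge_factorK // addrC subrK.
- move=> o N E i j x hb IH hi hj ij hx hl h.
  have [z [t [z0 hz]]] := IH (edges_satisfyS (finset.subsetUl _ _) h).
  have [[qi fi] [qj fj]] := (hz i hi, hz j hj).
  have ix : i != x by rewrite -val_eqE /=; lia.
  have xj : x != j by rewrite -val_eqE /=; lia.
  have mi : [set i; x]%SET \in (E :|: [set [set i; x]; [set x; j]])%SET.
    by rewrite !inE eqxx !orbT.
  have mj : [set x; j]%SET \in (E :|: [set [set i; x]; [set x; j]])%SET.
    by rewrite !inE eqxx !orbT.
  have h1 := h i x ix mi; have h4 := h x j xj mj.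
  have h2 : frel A x (f x) (edge_factor P q i x).
    by rewrite edge_factorC; apply: h; rewrite 1?eq_sym // finset.setUC.
  have h3 : frel A j (f j) (edge_factor P q x j).
    by rewrite edge_factorC; apply: h; rewrite 1?eq_sym // finset.setUC.
  have [] := @link_rigid i x j (edge_factor P q i x / z) (edge_factor P q x j / z) hl ij xj.
  - exact: frel_scale fi h1.
  - exact: frel_scale2 h2 h4.
  - exact: frel_scale fj h3.
  - rewrite mulrAC edge_factorK // mulrAC edge_factorK // -mulrDl addrC subrKA qi qj.
    by rewrite opprD addrACA subrr addr0 -mulrBr mulrAC divff // mul1r.
  move=> e1 _; have {}e1 : edge_factor P q i x = z.
    by rewrite -[LHS](divfK z0) e1 mul1r.
  exists z, t; split=> // v; rewrite ltnS leq_eqVlt => /orP[/eqP vN|]; last exact: hz.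
  have -> : v = x by apply: val_inj; rewrite /= vN.
  split; last by rewrite -e1.
  have := edge_factorK q ix; rewrite e1 qi => /eqP; rewrite eq_sym subr_eq => /eqP ->.
  by rewrite addrA -mulrDr subrK.
move=> o N E a b c d hb IH ha hd ad hb' hc bc he h.
have [z [t [z0 hz]]] := IH (edges_satisfyS (finset.subsetUl _ _) h).
have [[qa fa] [qd fd]] := (hz a ha, hz d hd).
have ab : a != b by rewrite -val_eqE /=; lia.
have cd : c != d by rewrite -val_eqE /=; lia.
set E' := (_ :|: _)%SET in h *.
have m1 : [set a; b]%SET \in E' by rewrite !inE eqxx !orbT.
have m2 : [set b; c]%SET \in E' by rewrite !inE eqxx !orbT.
have m3 : [set c; d]%SET \in E' by rewrite !inE eqxx !orbT.
have h1 := h _ _ ab m1; have h3 := h _ _ bc m2; have h5 := h _ _ cd m3.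
have h2 : frel A b (f b) (edge_factor P q a b).
  by rewrite edge_factorC; apply: h; rewrite 1?eq_sym // finset.setUC.
have h4 : frel A c (f c) (edge_factor P q b c).
  by rewrite edge_factorC; apply: h; rewrite 1?eq_sym // finset.setUC.
have h6 : frel A d (f d) (edge_factor P q c d).
  by rewrite edge_factorC; apply: h; rewrite 1?eq_sym // finset.setUC.
have [] := @ear_rigid a b c d (edge_factor P q a b / z)
  (edge_factor P q b c / z) (edge_factor P q c d / z) he.
- exact: frel_scale fa h1.
- exact: frel_scale2 h2 h3.
- exact: frel_scale2 h4 h5.
- exact: frel_scale fd h6.
- rewrite mulrAC edge_factorK // mulrAC edge_factorK // mulrAC edge_factorK //.
  rewrite -!mulrDl (addrC (q b - q a)) subrKA addrC subrKA qa qd.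
  by rewrite opprD addrACA subrr addr0 -mulrBr mulrAC divff // mul1r.
move=> e1 _ e3; have {}e1 : edge_factor P q a b = z by rewrite -[LHS](divfK z0) e1 mul1r.
have {}e3 : edge_factor P q c d = z by rewrite -[LHS](divfK z0) e3 mul1r.
exists z, t; split=> // v hv; have [vN|vN] := ltnP v N; first exact: hz.
have [->|->] : v = b \/ v = c.
  have [/eqP h'|h'] := boolP (v == b :> nat); first by left; apply: val_inj.
  right; apply: val_inj => /=; move: bc; rewrite -val_eqE /=; lia.
  split; last by rewrite -e1.
  have := edge_factorK q ab; rewrite e1 qa => /eqP; rewrite eq_sym subr_eq => /eqP ->.
  by rewrite addrA -mulrDr subrK.
split; last by rewrite -e3.
have := edge_factorK q cd; rewrite e3 qd => /eqP; rewrite eq_sym subr_eq eq_sym => /eqP e.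
by apply: (addrI (z * (P d - P c))); rewrite e mulrBr addrA subrK.
Qed.

End Constructions.

Lemma cards3_uniq (T : finType) (x y z : T) : uniq [:: x; y; z] ->
  #|[set x; y; z]%SET| = 3%N.
Proof.
move=> h; rewrite (eq_card (B := mem [:: x; y; z])); first exact: card_uniqP h.
by move=> w; rewrite !inE orbA.
Qed.

(** * From the two kinds of additions to added paths *)

Section FromConstructed.
Variables (R : realType) (n : nat) (VA VD : {set 'I_n}) (p : 'M[R]_(n, 2)).
Hypothesis hinj : injective (fun i : 'I_n => row i p).
Hypothesis hAD : bipartition VA VD.
Local Notation P := (positions p).
Implicit Types (i j a b c d x y : 'I_n) (E : {set {set 'I_n}}).

Lemma cr_eq0 (u w : R[i]) : u != 0 -> cr u w = 0 ->
  exists k : R, w = k%:C%C * u.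
Proof.
move=> u0 h; have hr : w / u \is Num.real.
  apply/conjc_realP; rewrite conjcM conjc_inv.
  have cu0 : conjc u != 0 by rewrite conjc_eq0.
  apply: (mulIf u0); rewrite divfK // mulrAC; apply: (mulIf cu0); rewrite divfK //.
  by move/eqP: h; rewrite /cr subr_eq0 => /eqP e; rewrite mulrC e mulrC.
have [k e] := complex_realP _ hr.
by exists k; rewrite -e divfK.
Qed.

Lemma noncollinear_cr a b c : a != b ->
  ~ collinear (row a p) (row b p) (row c p) -> cr (P b - P a) (P c - P b) != 0.
Proof.
move=> ab hn; apply/negP => /eqP h; apply: hn.
have u0 : P b - P a != 0 by apply: (subP_neq0 (positions_inj hinj)); rewrite eq_sym.
have [k e] := cr_eq0 u0 h.
exists (row a p), (row b p - row a p), 0, 1, (1 + k); split.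
- by move: u0; apply: contraNneq => e0; rewrite -toCB e0 /toC !mxE.
- by rewrite scale0r addr0.
- by rewrite scale1r addrC subrK.
apply: toC_inj; rewrite scalerDl scale1r addrA addrCA subrr addr0.
have -> : toC (row b p + k *: (row b p - row a p)) =
    toC (row b p) + toC (k *: (row b p - row a p)) by rewrite /toC !mxE.
by rewrite toCZ toCB -e addrC subrK.
Qed.

Lemma card_meet4 (S : {set 'I_n}) i j x y : uniq [:: i; j; x; y] ->
  #|([set i; j; x; y] :&: S)%SET| = ((i \in S) + (j \in S) + (x \in S) + (y \in S))%N.
Proof.
move=> hu; rewrite (eq_card (B := mem [seq z <- [:: i; j; x; y] | z \in S])).
  rewrite (card_uniqP (filter_uniq _ hu)) size_filter /=; lia.
by move=> z; rewrite !inE mem_filter !inE andbC !orbA.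
Qed.

(** The path is read from the side that puts its distance vertex in the second or in the last
    place. *)
Lemma two_vertex_ear i j x y : uniq [:: i; j; x; y] ->
  two_vertex_condition VA VD p i j x y ->
  ear_cond VA P j x y i \/ ear_cond VA P i y x j.
Proof.
move=> hu [+ _ hn]; rewrite card_meet4 // => h3.
have hcol a b c z : [set i; j; x; y]%SET = [set a; b; c; z]%SET -> z \notin VA ->
    a \in VA -> b \in VA -> c \in VA -> a != b ->
    cr (P b - P a) (P c - P b) != 0.
  move=> e hz ha hb hc ab; apply: (noncollinear_cr ab); apply: hn; rewrite e.
  apply/setP => w; rewrite !inE; case: (boolP (w \in VA)) => hw; rewrite ?andbT ?andbF.
    by rewrite orbC (_ : w == z = false) //; apply: contraTF hw => /eqP ->.
  by apply/esym/negbTE; apply: contra hw => /orP[/orP[]|] /eqP ->.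
move: hu; rewrite /= !inE !negb_or => /and4P[/and3P[ij ix iy] /andP[jx jy] xy _].
case: (boolP (i \in VA)) h3 => hi; case: (boolP (j \in VA)) => hj;
  case: (boolP (x \in VA)) => hx; case: (boolP (y \in VA)) => hy //= _.
- right; right; split=> //; apply: (hcol _ _ _ y) => //.
  by apply/setP => w; rewrite !inE; do 4!case: eqP.
- left; right; split=> //; apply: (hcol _ _ _ x) => //.
  by apply/setP => w; rewrite !inE; do 4!case: eqP.
- right; left; split=> //; apply: (hcol _ _ _ j) => //.
  by apply/setP => w; rewrite !inE; do 4!case: eqP.
left; left; split=> //; apply: (hcol _ _ _ i) => //.
by apply/setP => w; rewrite !inE; do 4!case: eqP.
Qed.

Lemma one_vertex_link i j x : i != x ->
  [\/ type_A1 VA VD i j x, type_D1 VA VD i j x | type_A2 VA p i j x] ->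
  link_cond VA P i x j \/ link_cond VA P j x i.
Proof.
move=> ix; rewrite /type_A1 /type_D1 /type_A2 -!(notin_VA hAD).
case=> [[hx h]|[hx h]|[hx hi hj hn]].
- case: (boolP (i \in VA)) h => hi; case: (boolP (j \in VA)) => hj h.
  + by case: h.
  + by right; right; apply: Or41.
  + by left; right; apply: Or41.
  + by left; right; apply: Or44.
- case: (boolP (i \in VA)) h => hi; case: (boolP (j \in VA)) => hj h.
  + by left; right; apply: Or42.
  + by left; right; apply: Or43.
  + by right; right; apply: Or43.
  + by case: h.
left; left; split=> //; apply: noncollinear_cr => //.
move=> [w [v [r [s [t [v0 ea eb ec]]]]]]; apply: hn.
by exists w, v, r, t, s.
Qed.

Lemma constructed_built t o N E : constructed VA VD p t o N E ->
  [/\ built VA P o N E, N = (2 * t + o + 2)%N & #|E| = (3 * t + 2 * o + 1)%N].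
Proof.
(* Every new edge has a new end, hence is not an old edge, and the edge counts add up. *)
have cardD (E' F : {set {set 'I_n}}) (m : nat) : (forall e, e \in E' -> forall v, v \in e -> (v < m)%N) ->
    (forall e, e \in F -> exists2 v : 'I_n, v \in e & (m <= v)%N) ->
    #|(E' :|: F)%SET| = (#|E'| + #|F|)%N.
  move=> hE hF; rewrite cardsU (_ : (E' :&: F)%SET = finset.set0) ?cards0 ?subn0 //.
  apply/setP => e; rewrite !inE; apply/negbTE; apply/negP => /andP[/hE h1 /hF [v hv]].
  by rewrite leqNgt h1.
have lt_built o' N' E' : built VA P o' N' E' ->
    forall e, e \in E' -> forall v, v \in e -> (v < N')%N.
  move=> hb e /(built_edge_lt hb) [u [v [-> _ hu hv]]] w.
  by rewrite !inE => /orP[] /eqP ->.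
elim=> {t o N E} [x y hx hy _|t o N E i j x _ [hb hN hE] hi hj ij hx hc|].
- by split; rewrite ?cards1 //; apply: built_edge.
- split; [|lia|].
    have ix : i != x by rewrite -val_eqE /=; lia.
    have [hl|hl] := one_vertex_link ix hc.
      by rewrite (finset.setUC [set x] [set i])%SET; apply: built_link.
    rewrite (finset.setUC [set x] [set j])%SET.
    by rewrite (finset.setUC [set [set x; i]])%SET; apply: built_link; rewrite // eq_sym.
  rewrite (cardD _ _ N) ?hE; first 1 last.
  + exact: lt_built hb.
  + by move=> e; rewrite !inE => /orP[] /eqP ->; exists x; rewrite ?inE ?eqxx ?hx.
  rewrite cards2 (_ : _ != _); first by lia.
  apply/eqP => /setP /(_ j); rewrite !inE eqxx orbT (eq_sym j i) (negPf ij) orbF.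
  by rewrite -val_eqE /=; lia.
move=> t o N E i j x y _ [hb hN hE] hi hj ij hx hy hc.
have xy : x != y by rewrite -val_eqE /=; lia.
have iy : i != y by rewrite -val_eqE /=; lia.
have jy : j != y by rewrite -val_eqE /=; lia.
have jx : j != x by rewrite -val_eqE /=; lia.
have ix : i != x by rewrite -val_eqE /=; lia.
split; [|lia|].
  have [] := two_vertex_ear _ hc.
  + by rewrite /= !inE !negb_or ij ix iy jx jy xy.
  + by move=> h; apply: built_ear; rewrite // ?[_ == i]eq_sym //; lia.
  + rewrite (finset.setUC [set j] [set x])%SET (finset.setUC [set x] [set y])%SET.
    rewrite (finset.setUC [set y] [set i])%SET finset.setUC.
    rewrite (_ : _ :|: _ :|: [set [set i; y]] =
      [set [set i; y]; [set y; x]; [set x; j]])%SET.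
      move=> h; rewrite finset.setUC; apply: built_ear; rewrite // 1?eq_sym //; lia.
    by apply/setP => e; rewrite !inE; do 3!case: eqP.
rewrite (cardD _ _ N) ?hE; first 1 last.
+ exact: lt_built hb.
+ move=> e; rewrite !inE => /orP[/orP[]|] /eqP ->; [exists x|exists x|exists y];
    by rewrite ?inE ?eqxx ?orbT //; lia.
rewrite cards3_uniq; first by lia.
rewrite /= !inE negb_or andbT; apply/andP; split; first (apply/andP; split).
- apply/eqP => /setP /(_ j); rewrite !inE eqxx (negPf jx) (negPf jy) //.
- apply/eqP => /setP /(_ j); rewrite !inE eqxx (negPf jy) (eq_sym j i) (negPf ij) //.
by apply/eqP => /setP /(_ x); rewrite !inE eqxx (negPf xy) (eq_sym x i) (negPf ix).
Qed.

End FromConstructed.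

(** * Extending flexes along two-vertex additions *)

Section ComplexLimits.
Variable R : realType.
Local Notation C := R[i].

(** The direction of [z]: at an angle vertex only this part of the frame matters, at a distance
    vertex only the modulus. *)
Definition hat (z : C) : C := z / `|z|.

Lemma norm_hat z : z != 0 -> `|hat z| = 1.
Proof. by move=> z0; rewrite /hat normf_div normr_id divff // normr_eq0. Qed.

Lemma hat_pos z : 0 < z -> hat z = 1.
Proof. by move=> h; rewrite /hat (gtr0_norm h) divff // lt0r_neq0. Qed.

Lemma hat_neq0 z : z != 0 -> hat z != 0.
Proof. by move=> /norm_hat h; rewrite -normr_eq0 h oner_eq0. Qed.

Lemma hat_div k z : z != 0 -> k * hat z / z = k / `|z|.
Proof. by move=> z0; rewrite /hat mulrA mulrAC mulfK. Qed.

Lemma normM_hat k z : z != 0 -> `|k * hat z| = `|k|.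
Proof. by move=> z0; rewrite normrM norm_hat // mulr1. Qed.

Lemma mulf_hatK k z : z != 0 -> k * hat z / hat z = k.
Proof. by move=> z0; rewrite mulfK // hat_neq0. Qed.

Lemma cr_hat z a b : z != 0 -> cr (hat z * a) (hat z * b) = cr a b.
Proof. by move=> z0; rewrite cr_mul2 norm_hat // expr1n mul1r. Qed.

Context {T : Type} {F : set_system T} {FF : Filter F}.
Implicit Types (f g : T -> C) (a b : C).

Lemma cvg_conjc f a : f @ F --> a -> (fun x => conjc (f x)) @ F --> conjc a.
Proof.
move=> /cvgrPdist_lt h; apply/cvgrPdist_lt => e e0.
by have := h e e0; apply: filterS => x; rewrite -conjcB normcJ.
Qed.

Lemma cvgMC f g a b : f @ F --> a -> g @ F --> b ->
  (fun x => f x * g x) @ F --> a * b.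
Proof. exact: cvgM. Qed.

Lemma cvgMk f a k : f @ F --> a -> (fun x => f x * k) @ F --> a * k.
Proof. by move=> fa; apply: cvgMC fa _; apply: cvg_cst. Qed.

Lemma cvgDC f g a b : f @ F --> a -> g @ F --> b ->
  (fun x => f x + g x) @ F --> a + b.
Proof. exact: cvgD. Qed.

Lemma cvgBC f g a b : f @ F --> a -> g @ F --> b ->
  (fun x => f x - g x) @ F --> a - b.
Proof. exact: cvgB. Qed.

Lemma cvgVC f a : a != 0 -> f @ F --> a -> (fun x => (f x)^-1) @ F --> a^-1.
Proof. exact: cvgV. Qed.

Lemma cvg_normC f a : f @ F --> a -> (fun x => `|f x|) @ F --> `|a|.
Proof. exact: cvg_norm. Qed.

Lemma cvg_cr f g a b : f @ F --> a -> g @ F --> b ->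
  (fun x => cr (f x) (g x)) @ F --> cr a b.
Proof.
move=> fa gb.
exact: (cvgB (cvgM fa (cvg_conjc gb)) (cvgM (cvg_conjc fa) gb)).
Qed.

Lemma cvg_hat f a : a != 0 -> f @ F --> a -> (fun x => hat (f x)) @ F --> hat a.
Proof.
move=> a0 fa; have na : `|a| != 0 by rewrite normr_eq0.
exact: (cvgM fa (cvgV na (cvg_norm fa))).
Qed.

Lemma cvg_Re f a : f @ F --> a ->
  (fun x => complex.Re (f x)) @ F --> complex.Re a.
Proof.
move=> /cvgrPdist_lt h; apply/cvgrPdist_lt => e e0.
have /h : (0 : C) < e%:C%C by rewrite -[0]/(0%:C%C) ltcR.
apply: filterS => x hx; have := le_lt_trans (normc_ge_Re _) hx.
by rewrite ltcR; case: (a) (f x) => [a1 a2] [b1 b2].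
Qed.

Lemma cvg_real_complex (f : T -> R) (a : R) : f @ F --> a ->
  (fun x => (f x)%:C%C) @ F --> a%:C%C.
Proof.
move=> /cvgrPdist_lt h; apply/cvgrPdist_lt => e e0.
have re : e \is Num.real by apply: gtr0_real.
have /h : (0 : R) < complex.Re e by rewrite -ltcR (RRe_real re).
apply: filterS => x hx; rewrite -rmorphB normc_def /= expr0n addr0 sqrtr_sqr.
by rewrite -(RRe_real re) ltcR.
Qed.

Lemma real_cvg1_gt0 f : (forall x, f x \is Num.real) -> f @ F --> (1 : C) ->
  \forall x \near F, 0 < f x.
Proof.
move=> hr /cvgrPdist_lt /(_ 1 ltr01); apply: filterS => x.
rewrite real_ltr_norml ?rpredB ?rpred1 //.
by move=> /andP[_]; rewrite ltrBlDr -{1}[1]addr0 ltrD2l.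
Qed.

Lemma cvg_neq0 f a : a != 0 -> f @ F --> a -> \forall x \near F, f x != 0.
Proof. by move=> a0 h; apply: (cvgr_neq0 _ h a0). Qed.

End ComplexLimits.

(** * Extending a state along a path with two new vertices *)

Section EarExtension.
Variables (R : realType) (n : nat) (A : {set 'I_n}) (P : 'I_n -> R[i]).
Hypothesis P_inj : injective P.
Local Notation C := R[i].
Implicit Types (q f nu al : 'I_n -> C) (E : {set {set 'I_n}}).
Implicit Types (i j a b c d x y u v : 'I_n).

(* Stretch factors of an infinitesimal flex that keeps all edge directions. *)
Definition lrel v (al w : C) : Prop := w \is Num.real /\ (v \notin A -> w = al).

Definition parallel_flex E nu al : Prop :=
  (forall v, al v \is Num.real) /\ edges_satisfy P lrel E nu al.

Definition ear_ok a b c d (rel : 'I_n -> C -> C -> Prop)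
    (qa fa qb fb qc fc qd fd : C) : Prop :=
  [/\ rel a fa ((qb - qa) / (P b - P a)) /\ rel b fb ((qb - qa) / (P b - P a)),
      rel b fb ((qc - qb) / (P c - P b)) /\ rel c fc ((qc - qb) / (P c - P b)) &
      rel c fc ((qd - qc) / (P d - P c)) /\ rel d fd ((qd - qc) / (P d - P c))].

(** A common interface for both kinds of path: explicit positions and frames of the new vertices as
    functions of the state at the two ends, correct and continuous where [ear_good] holds, which
    includes all states near the base, and exactly affine along parallel flexes. *)
Record ear_extension a b c d := EarExtension {
  extb : C -> C -> C -> C -> C;
  frmb : C -> C -> C -> C -> C;
  extc : C -> C -> C -> C -> C;
  frmc : C -> C -> C -> C -> C;
  ear_good : C -> C -> C -> C -> Prop;
  ext_base : [/\ extb (P a) 1 (P d) 1 = P b, frmb (P a) 1 (P d) 1 = 1,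
                 extc (P a) 1 (P d) 1 = P c & frmc (P a) 1 (P d) 1 = 1];
  ear_good_base : ear_good (P a) 1 (P d) 1;
  ext_cvg : forall T (F : set_system T) (FF : Filter F) (qa fa qd fd : T -> C)
      (la ka ld kd : C), qa @ F --> la -> fa @ F --> ka ->
      qd @ F --> ld -> fd @ F --> kd -> ear_good la ka ld kd ->
    [/\ (fun t => extb (qa t) (fa t) (qd t) (fd t)) @ F --> extb la ka ld kd,
        (fun t => frmb (qa t) (fa t) (qd t) (fd t)) @ F --> frmb la ka ld kd,
        (fun t => extc (qa t) (fa t) (qd t) (fd t)) @ F --> extc la ka ld kd &
        (fun t => frmc (qa t) (fa t) (qd t) (fd t)) @ F --> frmc la ka ld kd];
  ear_good_near : forall T (F : set_system T) (FF : Filter F)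
      (qa fa qd fd : T -> C), qa @ F --> P a -> fa @ F --> (1 : C) ->
      qd @ F --> P d -> fd @ F --> (1 : C) ->
    \forall t \near F, ear_good (qa t) (fa t) (qd t) (fd t);
  ext_ok : forall qa fa qd fd : C, ear_good qa fa qd fd ->
    ear_ok a b c d (frel A) qa fa (extb qa fa qd fd) (frmb qa fa qd fd)
      (extc qa fa qd fd) (frmc qa fa qd fd) qd fd;
  ext_linear : forall na aa nd ad : C, aa \is Num.real -> ad \is Num.real ->
    exists nb ab nc ac : C, [/\ ab \is Num.real, ac \is Num.real,
      ear_ok a b c d lrel na aa nb ab nc ac nd ad &
      forall r : C, r \is Num.real -> 0 < 1 + r * aa -> 0 < 1 + r * ad ->
        [/\ extb (P a + r * na) (1 + r * aa) (P d + r * nd) (1 + r * ad) = P b + r * nb,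
            frmb (P a + r * na) (1 + r * aa) (P d + r * nd) (1 + r * ad) = 1 + r * ab,
            extc (P a + r * na) (1 + r * aa) (P d + r * nd) (1 + r * ad) = P c + r * nc &
            frmc (P a + r * na) (1 + r * aa) (P d + r * nd) (1 + r * ad) = 1 + r * ac]]
}.

End EarExtension.

Section EarConstruction.
Variables (R : realType) (n : nat) (A : {set 'I_n}) (P : 'I_n -> R[i]).
Hypothesis P_inj : injective P.
Local Notation C := R[i].
Implicit Types (qa fa qd fd z r s : C).

Lemma cr_affine r (x y z : C) : r \is Num.real -> cr (x + r * y) z = cr x z + r * cr y z.
Proof. by move=> hr; rewrite crDl crZl. Qed.

Lemma cr_affiner r (x y z : C) : r \is Num.real -> cr z (x + r * y) = cr z x + r * cr z y.
Proof. by move=> hr; rewrite crDr crZr. Qed.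

Lemma div_scaled z (x y : C) : y != 0 -> x = z * y -> x / y = z.
Proof. by move=> y0 ->; rewrite mulfK. Qed.

Section Cases.
Variables a b c d : 'I_n.
Hypotheses (ab : a != b) (bc : b != c) (cd : c != d).
Let u1 : C := P b - P a.
Let u2 : C := P c - P b.
Let u3 : C := P d - P c.

Let u1_neq0 : u1 != 0. Proof. by rewrite subP_neq0 // eq_sym. Qed.
Let u2_neq0 : u2 != 0. Proof. by rewrite subP_neq0 // eq_sym. Qed.
Let u3_neq0 : u3 != 0. Proof. by rewrite subP_neq0 // eq_sym. Qed.

Let hat1 : hat 1 = 1 :> C. Proof. by rewrite hat_pos. Qed.

(** The angle vertices [a], [b], [c] pass the direction of the frame at [a] on to all three edges,
    and [d] fixes the modulus of the last factor. This places [c]; then [b] comes from decomposing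
    $q_c-q_a$ along the two rotated edge vectors, with positive coefficients. *)
Lemma ear_extension_end : [/\ d \notin A, a \in A, b \in A & c \in A] ->
  cr u1 u2 != 0 -> inhabited (ear_extension A P a b c d).
Proof.
move=> [hd ha hb hc] D0.
pose xc qa fa qd fd : C := qd - `|fd| * hat fa * u3.
pose sb qa fa qd fd : C := cr (xc qa fa qd fd - qa) (hat fa * u2) / cr u1 u2.
pose tb qa fa qd fd : C := cr (hat fa * u1) (xc qa fa qd fd - qa) / cr u1 u2.
pose xb qa fa qd fd : C := qa + sb qa fa qd fd * (hat fa * u1).
pose fr (qa fa qd fd : C) := hat fa.
pose good qa fa qd fd :=
  [/\ fa != 0, fd != 0, 0 < sb qa fa qd fd & 0 < tb qa fa qd fd].
have xc1 : xc (P a) 1 (P d) 1 = P c.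
  by rewrite /xc hat1 normr1 !mul1r /u3 opprB addrC subrK.
have ca : P c - P a = u1 + u2 by rewrite /u1 /u2; ring.
have sb1 : sb (P a) 1 (P d) 1 = 1.
  by rewrite /sb xc1 hat1 mul1r ca crDl crrr addr0 divff.
have tb1 : tb (P a) 1 (P d) 1 = 1.
  by rewrite /tb xc1 hat1 mul1r ca crDr crrr add0r divff.
have hcvg : forall T (F : set_system T) (FF : Filter F) (qa fa qd fd : T -> C)
      (la ka ld kd : C), qa @ F --> la -> fa @ F --> ka ->
      qd @ F --> ld -> fd @ F --> kd -> ka != 0 ->
    [/\ (fun t => xc (qa t) (fa t) (qd t) (fd t)) @ F --> xc la ka ld kd,
        (fun t => sb (qa t) (fa t) (qd t) (fd t)) @ F --> sb la ka ld kd,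
        (fun t => tb (qa t) (fa t) (qd t) (fd t)) @ F --> tb la ka ld kd &
        (fun t => xb (qa t) (fa t) (qd t) (fd t)) @ F --> xb la ka ld kd].
  move=> T F FF qa fa qd fd la ka ld kd hqa hfa hqd hfd k0.
  have hh : (fun t => hat (fa t)) @ F --> hat ka by apply: cvg_hat.
  have hu1 : (fun t => hat (fa t) * u1) @ F --> hat ka * u1 by apply: cvgMk.
  have hu2 : (fun t => hat (fa t) * u2) @ F --> hat ka * u2 by apply: cvgMk.
  have hxc : (fun t => xc (qa t) (fa t) (qd t) (fd t)) @ F --> xc la ka ld kd.
    exact: (cvgBC hqd (cvgMk (cvgMC (cvg_normC hfd) hh))).
  have hsb : (fun t => sb (qa t) (fa t) (qd t) (fd t)) @ F --> sb la ka ld kd.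
    exact: (cvgMk (cvg_cr (cvgBC hxc hqa) hu2)).
  split; [exact: hxc|exact: hsb| |].
    exact: (cvgMk (cvg_cr hu1 (cvgBC hxc hqa))).
  exact: (cvgDC hqa (cvgMC hsb hu1)).
split; apply: (@EarExtension R n A P a b c d xb fr xc fr good).
- by rewrite /xb /fr xc1 sb1 hat1 !mul1r /u1 addrC subrK.
- by split; rewrite ?sb1 ?tb1 ?oner_neq0 ?ltr01.
- move=> T F FF qa fa qd fd la ka ld kd hqa hfa hqd hfd [k0 _ _ _].
  have [h1 _ _ h2] := hcvg _ _ _ _ _ _ _ _ _ _ _ hqa hfa hqd hfd k0.
  have h3 : (fun t => hat (fa t)) @ F --> hat ka by apply: cvg_hat.
  by split; [exact: h2|exact: h3|exact: h1|exact: h3].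
- move=> T F FF qa fa qd fd hqa hfa hqd hfd.
  have [_ h2 h3 _] := hcvg _ _ _ _ _ _ _ _ _ _ _ hqa hfa hqd hfd (oner_neq0 _).
  rewrite sb1 in h2; rewrite tb1 in h3.
  have g1 : \forall t \near F, fa t != 0 by apply: cvg_neq0 hfa; apply: oner_neq0.
  have g2 : \forall t \near F, fd t != 0 by apply: cvg_neq0 hfd; apply: oner_neq0.
  have g3 : \forall t \near F, 0 < sb (qa t) (fa t) (qd t) (fd t).
    by apply: (real_cvg1_gt0 _ h2) => t; apply: cr_ratio_real.
  have g4 : \forall t \near F, 0 < tb (qa t) (fa t) (qd t) (fd t).
    by apply: (real_cvg1_gt0 _ h3) => t; apply: cr_ratio_real.
  by near=> t; split; near: t.
- move=> qa fa qd fd [fa0 fd0 s0 t0].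
  have nfa : 0 < `|fa| by rewrite normr_gt0.
  have hW := @cramer R (hat fa * u1) (hat fa * u2) (xc qa fa qd fd - qa).
  rewrite cr_hat // in hW; have {}hW := hW D0.
  have e1 : (xb qa fa qd fd - qa) / (P b - P a) = sb qa fa qd fd * hat fa.
    by apply: div_scaled => //; rewrite /xb addrC addKr mulrA.
  have e2 : (xc qa fa qd fd - xb qa fa qd fd) / (P c - P b) = tb qa fa qd fd * hat fa.
    apply: div_scaled => //; rewrite /xb opprD addrA hW -/(sb qa fa qd fd).
    by rewrite -/(tb qa fa qd fd) addrC addKr mulrA.
  have e3 : (qd - xc qa fa qd fd) / (P d - P c) = `|fd| * hat fa.
    by apply: div_scaled => //; rewrite /xc opprB addrC subrK.
  rewrite /ear_ok e1 e2 e3 /frel ha hb hc (negPf hd) /fr !hat_div //.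
  rewrite !(mulf_hatK _ fa0) (normM_hat _ fa0) normr_id.
  have nfd : 0 < `|fd| by rewrite normr_gt0.
  by do ?split=> //; apply: divr_gt0.
move=> na aa nd ad raa rad.
pose nc : C := nd - ad * u3; pose s' : C := cr (nc - na) u2 / cr u1 u2.
pose t' : C := cr u1 (nc - na) / cr u1 u2.
pose nb : C := na + s' * u1.
have hW : nc - na = s' * u1 + t' * u2 by apply: cramer.
have e1 : (nb - na) / (P b - P a) = s'.
  by apply: div_scaled => //; rewrite /nb addrC addKr.
have e2 : (nc - nb) / (P c - P b) = t'.
  by apply: div_scaled => //; rewrite /nb opprD addrA hW addrC addKr.
have e3 : (nd - nc) / (P d - P c) = ad.
  by apply: div_scaled => //; rewrite /nc opprB addrC subrK.
(* The new frames are pure directions, equal to 1 along a parallel flex, so their stretch factors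
   are zero. *)
exists nb, 0, nc, 0; split; rewrite ?rpred0 //.
  rewrite /ear_ok e1 e2 e3 /lrel ha hb hc hd.
  by split; split; split=> //; apply: cr_ratio_real.
move=> r hr r1 r2.
have ec : xc (P a + r * na) (1 + r * aa) (P d + r * nd) (1 + r * ad) = P c + r * nc.
  rewrite /xc hat_pos // gtr0_norm // mulr1 /nc.
  have -> : P d = P c + u3 by rewrite /u3 addrC subrK.
  ring.
have esb : sb (P a + r * na) (1 + r * aa) (P d + r * nd) (1 + r * ad) = 1 + r * s'.
  rewrite /sb ec hat_pos // mul1r opprD addrACA -mulrBr ca cr_affine //.
  by rewrite crDl crrr addr0 mulrDl divff // -mulrA.
rewrite /xb esb ec /fr hat_pos // mulr0 addr0; split=> //.
rewrite mul1r /nb; have -> : P b = P a + u1 by rewrite /u1 addrC subrK.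
by ring.
Unshelve. all: by end_near.
Qed.

(** The edge [ab] has the direction of the frame at [a], the edges [bc] and [cd] that of the frame
    at [d], and [ab], [bc] have a common modulus because of [b]. The common modulus and that of [cd]
    are the two unknowns of the closing equation $q_d-q_a=rU+sV$. *)
Lemma ear_extension_mid : [/\ b \notin A, a \in A, c \in A & d \in A] ->
  cr (P c - P a) u3 != 0 -> inhabited (ear_extension A P a b c d).
Proof.
move=> [hb ha hc hd] D0.
have ca : P c - P a = u1 + u2 by rewrite /u1 /u2; ring.
have da : P d - P a = P c - P a + u3 by rewrite /u3; ring.
pose U fa fd : C := hat fa * u1 + hat fd * u2.
pose V fd : C := hat fd * u3.
pose rb qa fa qd fd : C := cr (qd - qa) (V fd) / cr (U fa fd) (V fd).
pose sb qa fa qd fd : C := cr (U fa fd) (qd - qa) / cr (U fa fd) (V fd).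
pose xb qa fa qd fd : C := qa + rb qa fa qd fd * (hat fa * u1).
pose xc qa fa qd fd : C := qd - sb qa fa qd fd * V fd.
pose fr (qa fa qd fd : C) := hat fd.
pose good qa fa qd fd := [/\ fa != 0, fd != 0, cr (U fa fd) (V fd) != 0,
  0 < rb qa fa qd fd & 0 < sb qa fa qd fd].
have U1 : U 1 1 = P c - P a by rewrite /U hat1 !mul1r ca.
have V1 : V 1 = u3 by rewrite /V hat1 mul1r.
have rb1 : rb (P a) 1 (P d) 1 = 1.
  by rewrite /rb U1 V1 da crDl crrr addr0 divff.
have sb1 : sb (P a) 1 (P d) 1 = 1.
  by rewrite /sb U1 V1 da crDr crrr add0r divff.
have hcvg : forall T (F : set_system T) (FF : Filter F) (qa fa qd fd : T -> C)
      (la ka ld kd : C), qa @ F --> la -> fa @ F --> ka ->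
      qd @ F --> ld -> fd @ F --> kd -> ka != 0 -> kd != 0 ->
      cr (U ka kd) (V kd) != 0 ->
    [/\ (fun t => cr (U (fa t) (fd t)) (V (fd t))) @ F --> cr (U ka kd) (V kd),
        (fun t => rb (qa t) (fa t) (qd t) (fd t)) @ F --> rb la ka ld kd,
        (fun t => sb (qa t) (fa t) (qd t) (fd t)) @ F --> sb la ka ld kd &
        (fun t => xb (qa t) (fa t) (qd t) (fd t)) @ F --> xb la ka ld kd /\
        (fun t => xc (qa t) (fa t) (qd t) (fd t)) @ F --> xc la ka ld kd].
  move=> T F FF qa fa qd fd la ka ld kd hqa hfa hqd hfd k0 k0' hD.
  have hh : (fun t => hat (fa t)) @ F --> hat ka by apply: cvg_hat.
  have hh' : (fun t => hat (fd t)) @ F --> hat kd by apply: cvg_hat.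
  have hU : (fun t => U (fa t) (fd t)) @ F --> U ka kd.
    exact: (cvgDC (cvgMk hh) (cvgMk hh')).
  have hV : (fun t => V (fd t)) @ F --> V kd by apply: cvgMk.
  have hUV : (fun t => cr (U (fa t) (fd t)) (V (fd t))) @ F --> cr (U ka kd) (V kd).
    exact: cvg_cr.
  have hrb : (fun t => rb (qa t) (fa t) (qd t) (fd t)) @ F --> rb la ka ld kd.
    exact: (cvgMC (cvg_cr (cvgBC hqd hqa) hV) (cvgVC hD hUV)).
  have hsb : (fun t => sb (qa t) (fa t) (qd t) (fd t)) @ F --> sb la ka ld kd.
    exact: (cvgMC (cvg_cr hU (cvgBC hqd hqa)) (cvgVC hD hUV)).
  split; [exact: hUV|exact: hrb|exact: hsb|split].
    exact: (cvgDC hqa (cvgMC hrb (cvgMk hh))).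
  exact: (cvgBC hqd (cvgMC hsb hV)).
split; apply: (@EarExtension R n A P a b c d xb rb xc fr good).
- rewrite /xb /fr /xc rb1 sb1 V1 hat1 !mul1r.
  by rewrite /u1 (addrC (P a)) subrK /u3 opprB (addrC (P d)) subrK.
- by split; rewrite ?U1 ?V1 ?rb1 ?sb1 ?oner_neq0 ?ltr01.
- move=> T F FF qa fa qd fd la ka ld kd hqa hfa hqd hfd [k0 k0' hD _ _].
  have [_ h1 _ [h2 h3]] := hcvg _ _ _ _ _ _ _ _ _ _ _ hqa hfa hqd hfd k0 k0' hD.
  have h4 : (fun t => hat (fd t)) @ F --> hat kd by apply: cvg_hat.
  by split; [exact: h2|exact: h1|exact: h3|exact: h4].
- move=> T F FF qa fa qd fd hqa hfa hqd hfd.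
  have hD : cr (U 1 1) (V 1) != 0 by rewrite U1 V1.
  have [h1 h2 h3 _] := hcvg _ _ _ _ _ _ _ _ _ _ _ hqa hfa hqd hfd
    (oner_neq0 _) (oner_neq0 _) hD.
  rewrite rb1 in h2; rewrite sb1 in h3.
  have g1 : \forall t \near F, fa t != 0 by apply: cvg_neq0 hfa; apply: oner_neq0.
  have g2 : \forall t \near F, fd t != 0 by apply: cvg_neq0 hfd; apply: oner_neq0.
  have g3 : \forall t \near F, 0 < rb (qa t) (fa t) (qd t) (fd t).
    by apply: (real_cvg1_gt0 _ h2) => t; apply: cr_ratio_real.
  have g4 : \forall t \near F, 0 < sb (qa t) (fa t) (qd t) (fd t).
    by apply: (real_cvg1_gt0 _ h3) => t; apply: cr_ratio_real.
  have g5 : \forall t \near F, cr (U (fa t) (fd t)) (V (fd t)) != 0.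
    exact: cvg_neq0 hD h1.
  by near=> t; split; near: t.
- move=> qa fa qd fd [fa0 fd0 hD r0 s0].
  have hW := @cramer R (U fa fd) (V fd) (qd - qa) hD.
  rewrite -/(rb qa fa qd fd) -/(sb qa fa qd fd) in hW.
  have e1 : (xb qa fa qd fd - qa) / (P b - P a) = rb qa fa qd fd * hat fa.
    by apply: div_scaled => //; rewrite /xb addrC addKr mulrA.
  have e2 : (xc qa fa qd fd - xb qa fa qd fd) / (P c - P b) = rb qa fa qd fd * hat fd.
    apply: div_scaled => //; rewrite -/u2 /xb /xc.
    move: hW; move: (rb _ _ _ _) (sb _ _ _ _) => rr ss hW.
    have -> : qd = qa + (rr * U fa fd + ss * V fd) by rewrite -hW addrC subrK.
    by rewrite /U; ring.
  have e3 : (qd - xc qa fa qd fd) / (P d - P c) = sb qa fa qd fd * hat fd.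
    by apply: div_scaled => //; rewrite /xc opprB addrC subrK mulrA.
  rewrite /ear_ok e1 e2 e3 /frel ha hc hd (negPf hb) /fr !hat_div //.
  have r0' := lt0r_neq0 r0.
  rewrite !(normM_hat _ fa0) !(normM_hat _ fd0) !(mulf_hatK _ fd0).
  have nfa : 0 < `|fa| by rewrite normr_gt0.
  have nfd : 0 < `|fd| by rewrite normr_gt0.
  by do ?split=> //; apply: divr_gt0.
move=> na aa nd ad raa rad.
pose ab' : C := cr (nd - na) u3 / cr (P c - P a) u3.
pose s' : C := cr (P c - P a) (nd - na) / cr (P c - P a) u3.
pose nb : C := na + ab' * u1; pose nc : C := nd - s' * u3.
have hW : nd - na = ab' * (P c - P a) + s' * u3 by apply: cramer.
have e1 : (nb - na) / (P b - P a) = ab'.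
  by apply: div_scaled => //; rewrite /nb addrC addKr.
have e2 : (nc - nb) / (P c - P b) = ab'.
  apply: div_scaled => //; rewrite -/u2 /nb /nc.
  have -> : nd = na + (ab' * (P c - P a) + s' * u3) by rewrite -hW addrC subrK.
  by rewrite ca; ring.
have e3 : (nd - nc) / (P d - P c) = s'.
  by apply: div_scaled => //; rewrite /nc opprB addrC subrK.
exists nb, ab', nc, 0; split; rewrite ?rpred0 ?cr_ratio_real //.
  rewrite /ear_ok e1 e2 e3 /lrel ha hb hc hd.
  by split; split; split=> //; apply: cr_ratio_real.
move=> r hr r1 r2.
have eU : U (1 + r * aa) (1 + r * ad) = P c - P a by rewrite /U !hat_pos // !mul1r ca.
have eV : V (1 + r * ad) = u3 by rewrite /V hat_pos // mul1r.
have er : rb (P a + r * na) (1 + r * aa) (P d + r * nd) (1 + r * ad) = 1 + r * ab'.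
  rewrite /rb eU eV opprD addrACA -mulrBr da cr_affine //.
  by rewrite crDl crrr addr0 mulrDl divff // -mulrA.
have es : sb (P a + r * na) (1 + r * aa) (P d + r * nd) (1 + r * ad) = 1 + r * s'.
  rewrite /sb eU eV opprD addrACA -mulrBr da cr_affiner //.
  by rewrite crDr crrr add0r mulrDl divff // -mulrA.
rewrite /xb /xc er es eV /fr !hat_pos // mulr0 addr0; split=> //.
  rewrite mul1r /nb; have -> : P b = P a + u1 by rewrite /u1 addrC subrK.
  by ring.
rewrite /nc; have -> : P d = P c + u3 by rewrite /u3 addrC subrK.
by ring.
Unshelve. all: by end_near.
Qed.

Lemma ear_extension_exists : ear_cond A P a b c d ->
  inhabited (ear_extension A P a b c d).
Proof.
by move=> [[h1 h2]|[h1 h2]]; [apply: ear_extension_end|apply: ear_extension_mid].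
Qed.

End Cases.
End EarConstruction.

(** * Curves and loops of nontrivial states near the base *)

Section Families.
Variables (R : realType) (n : nat) (A : {set 'I_n}) (P : 'I_n -> R[i]).
Hypothesis P_inj : injective P.
Local Notation C := R[i].
Implicit Types (q f nu al : 'I_n -> C) (E : {set {set 'I_n}}) (N : nat).
Implicit Types (a b c d u v : 'I_n) (r phi : R).

Definition tends_to_base T (F : set_system T) (q f : T -> 'I_n -> C) : Prop :=
  forall v, (fun t => q t v) @ F --> P v /\ (fun t => f t v) @ F --> (1 : C).

(* Convergence of the first component to 0 from the right, uniformly in the
   second one. *)
Definition uniform_at_right : set_system (R * R) :=
  fun S => \forall r \near (0 : R)^'+, forall phi, S (r, phi).

Global Instance uniform_at_right_filter : ProperFilter uniform_at_right.
Proof.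
split.
  move=> h; have [r hr] := filter_ex
    (h : \forall r \near (0 : R)^'+, forall phi, set0 (r, phi)).
  exact: (hr 0).
split; first exact: (@filterE _ (0 : R)^'+ _ _ (fun _ _ => I)).
  move=> S S' h h'; rewrite /uniform_at_right in h h' *; apply: filterS2 h h' => r h h' phi.
  by split.
move=> S S' s h; rewrite /uniform_at_right in h *; apply: filterS h => r h phi.
exact: s.
Qed.

Definition moves E N q f : Prop :=
  compatible A P E q f /\ ~ similar_below A P N q f.

Definition nearby_flex E N : Prop :=
  exists q f : R -> 'I_n -> C, tends_to_base (0 : R)^'+ q f /\
    \forall r \near (0 : R)^'+, moves E N (q r) (f r).

(* A loop of nontrivial compatible states around the base state, which joins
   its first order displacement along a parallel flex to the opposite one. *)
Definition flex_path E N nu al : Prop :=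
  parallel_flex A P E nu al /\
  exists q f : R * R -> 'I_n -> C,
  [/\ tends_to_base uniform_at_right q f,
      \forall r \near (0 : R)^'+, forall phi, moves E N (q (r, phi)) (f (r, phi)),
      \forall r \near (0 : R)^'+, forall phi v,
        (fun psi => q (r, psi) v) @ phi --> q (r, phi) v /\
        (fun psi => f (r, psi) v) @ phi --> f (r, phi) v
    & \forall r \near (0 : R)^'+, forall v, (v < N)%N ->
        [/\ q (r, 0) v = P v + r%:C%C * nu v, f (r, 0) v = 1 + r%:C%C * al v,
            q (r, pi) v = P v + (- r)%:C%C * nu v &
            f (r, pi) v = 1 + (- r)%:C%C * al v]].

Definition below E N : Prop := forall e, e \in E -> forall v, v \in e -> (v < N)%N.

Lemma moves_sub E E' N q f : E' \subset E -> moves E N q f -> moves E' N q f.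
Proof. by move=> s [h1 h2]; split=> //; apply: edges_satisfyS h1. Qed.

Lemma nearby_flex_sub E E' N : E' \subset E -> nearby_flex E N -> nearby_flex E' N.
Proof.
move=> s [q [f [h1 h2]]]; exists q, f; split=> //.
by apply: filterS h2 => r; apply: moves_sub.
Qed.

Lemma flex_path_sub E E' N nu al : E' \subset E -> flex_path E N nu al ->
  flex_path E' N nu al.
Proof.
move=> s [[h1 h2] [q [f [h3 h4 h5 h6]]]]; split.
  by split=> //; apply: edges_satisfyS h2.
exists q, f; split=> //; apply: filterS h4 => r h4 phi.
exact: moves_sub (h4 phi).
Qed.

Lemma flex_path_nearby E N nu al : flex_path E N nu al -> nearby_flex E N.
Proof.
move=> [_ [q [f [h1 h2 h3 h4]]]].
exists (fun r => q (r, 0)), (fun r => f (r, 0)); split.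
  have h0 : (fun r : R => (r, 0 : R)) @ (0 : R)^'+ --> uniform_at_right.
    move=> S hS; have hS' : \forall r \near (0 : R)^'+, forall phi, S (r, phi) by exact: hS.
    by have : \forall r \near (0 : R)^'+, S (r, 0) by apply: filterS hS' => r; apply.
  move=> v; have [hq hf] := h1 v; split.
    exact: (cvg_comp _ _ h0 hq).
  exact: (cvg_comp _ _ h0 hf).
by apply: filterS h2 => r; apply.
Qed.

Lemma cvg_affine_at_right (k : C) : (fun r : R => 1 + r%:C%C * k) @ (0 : R)^'+ --> (1 : C).
Proof.
rewrite -[X in _ --> X]addr0 -[X in 1 + X](mul0r k).
apply: cvgDC; first exact: cvg_cst.
apply: cvgMk; rewrite -[X in _ --> X]/(0%:C%C); apply: cvg_real_complex.
exact/cvg_at_right_filter/cvg_id.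
Qed.

Lemma affine_gt0_near (k : C) : k \is Num.real ->
  \forall r \near (0 : R)^'+, 0 < 1 + r%:C%C * k /\ 0 < 1 + (- r)%:C%C * k.
Proof.
move=> hk; have hr (k' : C) : k' \is Num.real ->
    \forall r \near (0 : R)^'+, 0 < 1 + r%:C%C * k'.
  move=> hk'; apply: (real_cvg1_gt0 _ (cvg_affine_at_right k')) => r.
  by rewrite rpredD ?rpred1 // rpredM //; apply/complex_realP; exists r.
have h1 := hr k hk; have h2 := hr (- k); rewrite rpredN in h2.
apply: filterS2 h1 (h2 hk) => r h1'; split=> //.
by rewrite rmorphN mulNr -mulrN.
Qed.

Section Ear.
Variables (N : nat) (a b c d : 'I_n) (X : ear_extension A P a b c d).
Hypotheses (ha : (a < N)%N) (hd : (d < N)%N) (hb : (N <= b)%N) (hc : (N <= c)%N).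
Hypothesis bc : b != c.

Definition ext_q q f v : C :=
  if v == b then extb X (q a) (f a) (q d) (f d)
  else if v == c then extc X (q a) (f a) (q d) (f d) else q v.

Definition ext_f q f v : C :=
  if v == b then frmb X (q a) (f a) (q d) (f d)
  else if v == c then frmc X (q a) (f a) (q d) (f d) else f v.

Lemma ext_below q f v : (v < N)%N -> ext_q q f v = q v /\ ext_f q f v = f v.
Proof.
move=> hv; rewrite /ext_q /ext_f.
have /negPf -> : v != b by apply: contraTneq hv => ->; rewrite -leqNgt.
by have /negPf -> : v != c by apply: contraTneq hv => ->; rewrite -leqNgt.
Qed.

Definition ear_edges : {set {set 'I_n}} :=
  [set [set a; b]; [set b; c]; [set c; d]]%SET.

Lemma ear_edges_satisfy (rel : 'I_n -> C -> C -> Prop) q f :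
  ear_ok P a b c d rel (q a) (f a) (q b) (f b) (q c) (f c) (q d) (f d) ->
  edges_satisfy P rel ear_edges q f.
Proof.
move=> [[h1 h2] [h3 h4] [h5 h6]].
by apply: edges_satisfyU; [apply: edges_satisfyU|]; apply: edges_satisfy1.
Qed.

Lemma ext_q_b q f : ext_q q f b = extb X (q a) (f a) (q d) (f d).
Proof. by rewrite /ext_q eqxx. Qed.

Lemma ext_f_b q f : ext_f q f b = frmb X (q a) (f a) (q d) (f d).
Proof. by rewrite /ext_f eqxx. Qed.

Lemma ext_q_c q f : ext_q q f c = extc X (q a) (f a) (q d) (f d).
Proof. by rewrite /ext_q eq_sym (negPf bc) eqxx. Qed.

Lemma ext_f_c q f : ext_f q f c = frmc X (q a) (f a) (q d) (f d).
Proof. by rewrite /ext_f eq_sym (negPf bc) eqxx. Qed.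

Lemma ext_moves E M q f : below E N -> (N <= M)%N ->
  ear_good X (q a) (f a) (q d) (f d) ->
  moves E N q f -> moves (E :|: ear_edges) M (ext_q q f) (ext_f q f).
Proof.
move=> hE hM hg [h1 h2]; have eb v : (v < N)%N ->
    q v = ext_q q f v /\ f v = ext_f q f v.
  by move=> hv; have [-> ->] := ext_below q f hv.
split; last by move=> h; apply: h2; apply: similar_below_ext eb h.
apply: edges_satisfyU; first exact: (edges_satisfy_ext (S := fun v : 'I_n => (v < N)%N) hE eb h1).
apply: ear_edges_satisfy; rewrite ext_q_b ext_f_b ext_q_c ext_f_c.
have [-> ->] := ext_below q f ha; have [-> ->] := ext_below q f hd.
exact: ext_ok.
Qed.

Lemma ext_cvg_state T (F : set_system T) {FF : Filter F} (q f : T -> 'I_n -> C)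
    (ql fl : 'I_n -> C) :
  (forall v, (fun t => q t v) @ F --> ql v /\ (fun t => f t v) @ F --> fl v) ->
  ear_good X (ql a) (fl a) (ql d) (fl d) ->
  forall v, (fun t => ext_q (q t) (f t) v) @ F --> ext_q ql fl v /\
            (fun t => ext_f (q t) (f t) v) @ F --> ext_f ql fl v.
Proof.
move=> h hg v; have [hqa hfa] := h a; have [hqd hfd] := h d.
have [h1 h2 h3 h4] := ext_cvg FF hqa hfa hqd hfd hg.
rewrite /ext_q /ext_f; case: (v == b); first by split; [exact: h1|exact: h2].
by case: (v == c); [split; [exact: h3|exact: h4]|exact: h].
Qed.

Lemma ext_base_state v : ext_q P (fun=> 1) v = P v /\ ext_f P (fun=> 1) v = 1.
Proof.
have [h1 h2 h3 h4] := ext_base X; rewrite /ext_q /ext_f.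
by case: eqVneq => [->|_]; [|case: eqVneq => [->|_]].
Qed.

Lemma ext_tends T (F : set_system T) {FF : Filter F} (q f : T -> 'I_n -> C) :
  tends_to_base F q f ->
  tends_to_base F (fun t => ext_q (q t) (f t)) (fun t => ext_f (q t) (f t)).
Proof.
move=> h v; have [h1 h2] := ext_cvg_state (fl := fun=> 1) h (ear_good_base X) v.
by have [e1 e2] := ext_base_state v; rewrite e1 in h1; rewrite e2 in h2.
Qed.

Lemma ext_good_near T (F : set_system T) {FF : Filter F} (q f : T -> 'I_n -> C) :
  tends_to_base F q f ->
  \forall t \near F, ear_good X (q t a) (f t a) (q t d) (f t d).
Proof.
by move=> h; have [h1 h2] := h a; have [h3 h4] := h d; apply: ear_good_near.
Qed.

Lemma nearby_flex_ear E M : below E N -> (N <= M)%N ->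
  nearby_flex E N -> nearby_flex (E :|: ear_edges) M.
Proof.
move=> hE hM [q [f [h1 h2]]].
exists (fun r => ext_q (q r) (f r)), (fun r => ext_f (q r) (f r)); split.
  exact: ext_tends.
by apply: filterS2 (ext_good_near h1) h2 => r hg; apply: ext_moves.
Qed.

(** The affine formulas of [ext_linear], taken at [r] and at [- r], keep the two marked points of
    each loop on the line of the extended flex. *)
Lemma flex_path_ear E M nu al : below E N -> (N <= M)%N ->
  (forall v, (v < M)%N -> (v < N)%N \/ v = b \/ v = c) ->
  flex_path E N nu al -> exists nu' al',
    (forall v, (v < N)%N -> nu' v = nu v /\ al' v = al v) /\
    flex_path (E :|: ear_edges) M nu' al'.
Proof.
move=> hE hM hMv [[hal hnu] [q [f [h1 h2 h3 h4]]]].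
have [nb [ab [nc [ac [rab rac hok hlin]]]]] :=
  ext_linear X (nu a) (nu d) (hal a) (hal d).
pose nu' v := if v == b then nb else if v == c then nc else nu v.
pose al' v := if v == b then ab else if v == c then ac else al v.
have eb v : (v < N)%N -> nu v = nu' v /\ al v = al' v.
  move=> hv; rewrite /nu' /al'.
  have /negPf -> : v != b by apply: contraTneq hv => ->; rewrite -leqNgt.
  by have /negPf -> : v != c by apply: contraTneq hv => ->; rewrite -leqNgt.
exists nu', al'; split; first by move=> v hv; have [-> ->] := eb v hv.
split.
  split; first by move=> v; rewrite /al'; case: ifP => // _; case: ifP.
  apply: edges_satisfyU; first exact: (edges_satisfy_ext (S := fun v : 'I_n => (v < N)%N) hE eb hnu).
  apply: ear_edges_satisfy; have [<- <-] := eb a ha; have [<- <-] := eb d hd.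
  by rewrite /nu' /al' eqxx eq_sym (negPf bc) eqxx.
exists (fun t => ext_q (q t) (f t)), (fun t => ext_f (q t) (f t)).
have hg : \forall r \near (0 : R)^'+, forall phi,
    ear_good X (q (r, phi) a) (f (r, phi) a) (q (r, phi) d) (f (r, phi) d).
  exact: (ext_good_near h1).
split.
- exact: ext_tends.
- by apply: filterS2 hg h2 => r hg h2 phi; apply: ext_moves (hg phi) (h2 phi).
- by apply: filterS2 hg h3 => r hg h3 phi; apply: ext_cvg_state (h3 phi) (hg phi).
apply: filterS3 h4 (affine_gt0_near (hal a)) (affine_gt0_near (hal d)).
move=> r h4 [pa pa'] [pd pd'] v hv; have rr (s : R) : (s%:C%C : C) \is Num.real.
  by apply/complex_realP; exists s.
have [e1 e2 e3 e4] := h4 a ha; have [e5 e6 e7 e8] := h4 d hd.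
have [g1 g2 g3 g4] := hlin _ (rr r) pa pd.
have [g5 g6 g7 g8] := hlin _ (rr (- r)) pa' pd'.
have [hN|[->|->]] := hMv v hv.
- by have [<- <-] := eb v hN; rewrite !(ext_below _ _ hN).1 !(ext_below _ _ hN).2; apply: h4.
- rewrite !ext_q_b !ext_f_b e1 e2 e3 e4 e5 e6 e7 e8 /nu' /al' eqxx.
  by split.
rewrite !ext_q_c !ext_f_c e1 e2 e3 e4 e5 e6 e7 e8 /nu' /al' eq_sym (negPf bc) eqxx.
by split.
Qed.

End Ear.
End Families.

(** * Flexes created by the deletion of an edge *)

Section LoopParameters.
Variables (R : realType).
Local Notation C := R[i].
Implicit Types (g : R -> R) (k : C) (t : R * R) (r phi : R).

(** The two parameters freed by a deletion run round the circle $(r\cos\varphi,r\sin\varphi)$. A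
    quantity driven by the cosine moves with slope [k] and then [- k] at the marked angles $0$ and
    $\pi$; one driven by the sine is at rest there. *)
Definition aff k g t : C := 1 + (t.1 * g t.2)%:C%C * k.

Definition rot g t : C := hat (aff 'i%C g t).

Lemma aff_tends k g : (forall x, `|g x| <= 1) ->
  aff k g @ @uniform_at_right R --> (1 : C).
Proof.
move=> hg; rewrite -[X in _ --> X]addr0 -[X in 1 + X](mul0r k).
apply: cvgDC; first exact: cvg_cst.
apply: cvgMk; rewrite -[X in _ --> X]/(0%:C%C); apply: cvg_real_complex.
apply/cvgrPdist_lt => e e0; rewrite /prop_near1 /nbhs /= /uniform_at_right.
near=> r => phi /=; rewrite sub0r normrN normrM.
have r0 : 0 < r by near: r; apply: nbhs_right_gt.
apply: (le_lt_trans (y := r)); last by near: r; apply: nbhs_right_lt.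
by rewrite (gtr0_norm r0) ler_piMr // ltW.
Unshelve. all: by end_near.
Qed.

Lemma aff_cont k g r phi : continuous g ->
  (fun psi => aff k g (r, psi)) @ phi --> aff k g (r, phi).
Proof.
move=> hg; apply: cvgDC; first exact: cvg_cst.
by apply: cvgMk; apply: cvg_real_complex; apply: cvgM; [apply: cvg_cst|apply: hg].
Qed.

Lemma aff_i g t : aff 'i%C g t = Complex 1 (t.1 * g t.2).
Proof. by apply/eqP; rewrite eq_complex /=; apply/andP; split; apply/eqP; ring. Qed.

Lemma aff_i_neq0 g t : aff 'i%C g t != 0.
Proof. by rewrite aff_i eq_complex /= oner_eq0. Qed.

Lemma aff_i_real g t : aff 'i%C g t \is Num.real -> t.1 * g t.2 = 0.
Proof. by rewrite aff_i complex_real => /eqP. Qed.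

Lemma rot_tends g : (forall x, `|g x| <= 1) -> rot g @ @uniform_at_right R --> (1 : C).
Proof.
move=> hg; have h := aff_tends 'i%C hg.
by rewrite -[X in _ --> X](hat_pos ltr01); apply: cvg_hat; rewrite ?oner_neq0.
Qed.

Lemma rot_cont g r phi : continuous g ->
  (fun psi => rot g (r, psi)) @ phi --> rot g (r, phi).
Proof. by move=> hg; apply: cvg_hat; [apply: aff_i_neq0|apply: aff_cont]. Qed.

Lemma norm_rot g t : `|rot g t| = 1.
Proof. by rewrite norm_hat // aff_i_neq0. Qed.

Lemma rot_neq0 g t : rot g t != 0.
Proof. by rewrite hat_neq0 // aff_i_neq0. Qed.

Lemma rot_eq1 g t : rot g t = 1 -> t.1 * g t.2 = 0.
Proof.
move=> h; apply: aff_i_real.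
have n0 : `|aff 'i%C g t| != 0 by rewrite normr_eq0 aff_i_neq0.
by rewrite -[aff _ _ _](divfK n0) -/(hat _) -/(rot _ _) h mul1r normr_real.
Qed.

Lemma aff1_eq1 g t : aff 1 g t = 1 -> t.1 * g t.2 = 0.
Proof.
rewrite /aff mulr1 => /eqP; rewrite addrC -subr_eq0 addrK => /eqP e.
by have [] := e.
Qed.

Lemma aff1_real g t : aff 1 g t \is Num.real.
Proof. by rewrite rpredD ?rpred1 // mulr1; apply/complex_realP; eexists. Qed.

Lemma aff1_gt0 g : (forall x, `|g x| <= 1) ->
  \forall r \near (0 : R)^'+, forall phi, 0 < aff 1 g (r, phi).
Proof.
move=> hg; exact: (real_cvg1_gt0 (fun t => aff1_real g t) (aff_tends 1 hg)).
Qed.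

Lemma abs_cos_le1 x : `|cos x : R| <= 1.
Proof. by rewrite ler_norml cos_geN1 cos_le1. Qed.

Lemma abs_sin_le1 x : `|sin x : R| <= 1.
Proof. by rewrite ler_norml sin_geN1 sin_le1. Qed.

Lemma loop_nontrivial r phi : 0 < r -> r * cos phi = 0 -> r * sin phi = 0 -> False.
Proof.
move=> r0 /eqP; rewrite mulf_eq0 (gt_eqF r0) /= => /eqP hc.
move=> /eqP; rewrite mulf_eq0 (gt_eqF r0) /= => /eqP hs.
by have := cos2Dsin2 phi; rewrite hc hs expr0n addr0 => /eqP; rewrite eq_sym oner_eq0.
Qed.

Lemma aff_cos0 k r : aff k cos (r, 0) = 1 + r%:C%C * k.
Proof. by rewrite /aff /= cos0 mulr1. Qed.
Lemma aff_cospi k r : aff k cos (r, pi) = 1 + (- r)%:C%C * k.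
Proof. by rewrite /aff /= cospi mulrN1. Qed.
Lemma aff_sin0 k r : aff k sin (r, 0) = 1.
Proof. by rewrite /aff /= sin0 mulr0 mul0r addr0. Qed.
Lemma aff_sinpi k r : aff k sin (r, pi) = 1.
Proof. by rewrite /aff /= sinpi mulr0 mul0r addr0. Qed.
Lemma rot_sin0 r : rot sin (r, 0) = 1.
Proof. by rewrite /rot aff_sin0 hat_pos. Qed.
Lemma rot_sinpi r : rot sin (r, pi) = 1.
Proof. by rewrite /rot aff_sinpi hat_pos. Qed.

End LoopParameters.

(** * Hanging vertices and the deletion of an edge of a long path *)

Section Deletions.
Variables (R : realType) (n : nat) (A : {set 'I_n}) (P : 'I_n -> R[i]).
Hypothesis P_inj : injective P.
Local Notation C := R[i].
Implicit Types (nu al : 'I_n -> C) (q f : R * R -> 'I_n -> C) (E : {set {set 'I_n}}) (N : nat).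
Implicit Types (a b c d u v m x : 'I_n) (r phi : R).

Definition loop_factor (zeta : R * R -> C) (z1 : C) : Prop :=
  [/\ z1 \is Num.real, zeta @ @uniform_at_right R --> (1 : C),
      forall r phi, (fun psi => zeta (r, psi)) @ phi --> zeta (r, phi) &
      forall r, zeta (r, 0) = 1 + r%:C%C * z1 /\ zeta (r, pi) = 1 + (- r)%:C%C * z1].

(** This is [flex_path] without nontriviality, and with the marked points controlled on an arbitrary
    set [S], so that loops can be assembled one vertex at a time. *)
Definition loop_data E (S : {set 'I_n}) nu al q f : Prop :=
  parallel_flex A P E nu al /\
  [/\ tends_to_base P (@uniform_at_right R) q f,
      \forall r \near (0 : R)^'+, forall phi, compatible A P E (q (r, phi)) (f (r, phi)),
      \forall r \near (0 : R)^'+, forall phi v,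
        (fun psi => q (r, psi) v) @ phi --> q (r, phi) v /\
        (fun psi => f (r, psi) v) @ phi --> f (r, phi) v
    & \forall r \near (0 : R)^'+, forall v, v \in S ->
        [/\ q (r, 0) v = P v + r%:C%C * nu v, f (r, 0) v = 1 + r%:C%C * al v,
            q (r, pi) v = P v + (- r)%:C%C * nu v &
            f (r, pi) v = 1 + (- r)%:C%C * al v]].

Lemma loop_flex_path E N S nu al q f : loop_data E S nu al q f ->
  (forall v, (v < N)%N -> v \in S) ->
  (\forall r \near (0 : R)^'+, forall phi,
    ~ similar_below A P N (q (r, phi)) (f (r, phi))) ->
  flex_path A P E N nu al.
Proof.
move=> [h0 [h1 h2 h3 h4]] hS h5; split=> //; exists q, f; split=> //.
  by apply: filterS2 h2 h5 => r h2 h5 phi; split.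
by apply: filterS h4 => r h4 v hv; apply/h4/hS.
Qed.

Lemma edge_factor_base u v : u != v -> edge_factor P P u v = 1.
Proof. by move=> uv; rewrite /edge_factor divff // subP_neq0 // eq_sym. Qed.

Lemma base_loop E S : loop_data E S (fun=> 0) (fun=> 0) (fun=> P) (fun=> fun=> 1).
Proof.
split; [split|split].
- by move=> v; apply: rpred0.
- by move=> u v uv _; rewrite /edge_factor subr0 mul0r; split; rewrite ?rpred0.
- by move=> v; split; apply: cvg_cst.
- apply: nearW => r phi u v uv _; rewrite edge_factor_base //.
  by apply: frel_refl; apply: oner_neq0.
- by apply: nearW => r phi v; split; apply: cvg_cst.
by apply: nearW => r v _; rewrite !mulr0 !addr0; split.
Qed.

Definition upd (g : 'I_n -> C) x (z : C) v : C := if v == x then z else g v.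

Lemma updE g x z : upd g x z x = z. Proof. by rewrite /upd eqxx. Qed.

Lemma upd_neq g x z v : v != x -> upd g x z v = g v.
Proof. by rewrite /upd => /negPf ->. Qed.

(** The new vertex takes the factor of its only edge as its frame, so the relation at [m] is the
    only condition to be met. *)
Lemma pendant_loop E S nu al q f m x (eta : R * R -> C) (e1 : C) :
  loop_data E S nu al q f -> (forall e, e \in E -> forall v, v \in e -> v \in S) ->
  m \in S -> x \notin S ->
  loop_factor eta e1 -> (m \notin A -> e1 = al m) ->
  (\forall r \near (0 : R)^'+, forall phi, frel A m (f (r, phi) m) (eta (r, phi))) ->
  loop_data (E :|: [set [set m; x]])%SET (x |: S)%SET
    (upd nu x (nu m + e1 * (P x - P m))) (upd al x e1)
    (fun t => upd (q t) x (q t m + eta t * (P x - P m)))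
    (fun t => upd (f t) x (eta t)).
Proof.
move=> [[hal hnu] [h1 h2 h3 h4]] hE hm hx [re1 ht hc he] hma hfr.
have nx v : v \in S -> v != x by move=> hv; apply: contraTneq hv => ->.
have mx := nx m hm; have Pmx : P x - P m != 0 by rewrite subP_neq0 // eq_sym.
have ef g z : edge_factor P (upd g x (g m + z * (P x - P m))) m x = z.
  by rewrite /edge_factor updE upd_neq // addrC addKr mulfK.
split; [split|split].
- by move=> v; rewrite /upd; case: ifP.
- apply: edges_satisfyU.
    apply: (edges_satisfy_ext (S := fun v => v \in S) hE _ hnu) => v /nx hv.
    by rewrite !upd_neq.
  apply: edges_satisfy1; rewrite ef // /lrel ?updE //; split=> //.
  by rewrite upd_neq.
- move=> v; rewrite /upd; case: eqVneq => [->|_]; last exact: h1.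
  split; last exact: ht.
  have ePx : P x = P m + 1 * (P x - P m) by rewrite mul1r addrC subrK.
  rewrite [X in _ --> X]ePx; have [hqm _] := h1 m.
  exact: (cvgDC hqm (cvgMk ht)).
- apply: filterS2 h2 hfr => r h2 hfr phi; apply: edges_satisfyU.
    apply: (edges_satisfy_ext (S := fun v => v \in S) hE _ (h2 phi)) => v /nx hv.
    by rewrite !upd_neq.
  apply: edges_satisfy1; rewrite ef // ?updE ?upd_neq //.
  by apply: frel_refl; apply: frel_neq0r (hfr phi).
- apply: filterS h3 => r h3 phi v; rewrite /upd; case: eqVneq => [_|_]; last exact: h3.
  split; last exact: hc.
  have [hqm _] := h3 phi m; exact: (cvgDC hqm (cvgMk (hc r phi))).
apply: filterS h4 => r h4 v; rewrite !inE => /orP[/eqP ->|hv]; last first.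
  by rewrite !(upd_neq _ _ (nx v hv)); apply: h4.
have [e2 _ e3 _] := h4 m hm; have [e4 e5] := he r.
have ePx : P x = P m + (P x - P m) by rewrite addrC subrK.
by rewrite !updE e2 e3 e4 e5 {2 5}ePx; split=> //; ring.
Qed.

Lemma affc_factor : loop_factor (aff 1 cos) 1.
Proof.
split; [exact: rpred1|exact: aff_tends (@abs_cos_le1 R)| |].
  by move=> r phi; apply: aff_cont; apply: continuous_cos.
by move=> r; rewrite aff_cos0 aff_cospi.
Qed.

Lemma affs_factor : loop_factor (aff 1 sin) 0.
Proof.
split; [exact: rpred0|exact: aff_tends (@abs_sin_le1 R)| |].
  by move=> r phi; apply: aff_cont; apply: continuous_sin.
by move=> r; rewrite aff_sin0 aff_sinpi !mulr0 addr0.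
Qed.

Lemma rots_factor : loop_factor (rot sin) 0.
Proof.
split; [exact: rpred0|exact: rot_tends (@abs_sin_le1 R)| |].
  by move=> r phi; apply: rot_cont; apply: continuous_sin.
by move=> r; rewrite rot_sin0 rot_sinpi !mulr0 addr0.
Qed.

Lemma affc_rots_factor : loop_factor (fun t => aff 1 cos t * rot sin t) 1.
Proof.
have [r1 h1 h2 h3] := affc_factor; have [_ h1' h2' h3'] := rots_factor.
split; [exact: r1| | |].
- by rewrite -[X in _ --> X]mulr1; exact: (cvgMC h1 h1').
- by move=> r phi; exact: (cvgMC (h2 r phi) (h2' r phi)).
by move=> r; have [-> ->] := h3 r; rewrite rot_sin0 rot_sinpi !mulr1.
Qed.

Section EarDeletion.
Variables (N : nat) (E : {set {set 'I_n}}) (v0 v1 : 'I_n).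
Hypotheses (hE : below E N) (h01 : v0 != v1) (hv0 : (v0 < N)%N) (hv1 : (v1 < N)%N).

(** A similarity that fixes two distinct points is the identity. *)
Lemma base_similar M (q f : 'I_n -> C) : (N <= M)%N -> q v0 = P v0 -> q v1 = P v1 ->
  similar_below A P M q f -> forall v, (v < M)%N -> q v = P v.
Proof.
move=> hM e0 e1 [z [t h]].
have [q0 _] := h v0 (leq_trans hv0 hM); have [q1 _] := h v1 (leq_trans hv1 hM).
have z1 : z = 1.
  apply: (mulIf (subP_neq0 P_inj h01)); rewrite mul1r mulrBr.
  have := congr2 (fun s1 s2 : C => s1 - s2) q0 q1; rewrite /= e0 e1 => ->.
  by rewrite opprD addrACA subrr addr0.
have t0 : t = 0.
  by apply: (addrI (z * P v0)); rewrite -q0 e0 z1 mul1r addr0.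
by move=> v hv; have [-> _] := h v hv; rewrite z1 t0 mul1r addr0.
Qed.

(* Two successive pendant vertices [b], attached to [a], and [c], attached to
   [m], where [m] is [b] or an old vertex. *)
Lemma two_pendants a b c m (zeta eta : R * R -> C) (z1 e1 : C) :
  (a < N)%N -> (N <= b < N.+2)%N -> (N <= c < N.+2)%N -> b != c ->
  m = b \/ (m < N)%N ->
  loop_factor zeta z1 -> (a \notin A -> z1 = 0) ->
  loop_factor eta e1 -> (m \notin A -> e1 = if m == b then z1 else 0) ->
  (\forall r \near (0 : R)^'+, forall phi,
     [/\ frel A a 1 (zeta (r, phi)),
         frel A m (if m == b then zeta (r, phi) else 1) (eta (r, phi)) &
         ~ (zeta (r, phi) = 1 /\ eta (r, phi) = 1)]) ->
  exists nu al,
    flex_path A P (E :|: [set [set a; b]] :|: [set [set m; c]])%SET N.+2 nu al.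
Proof.
move=> ha hb hc bc hm hz hz1 he he1 hr.
pose S0 : {set 'I_n} := [set v : 'I_n | (v < N)%N]%SET.
have hb0 : b \notin S0 by rewrite inE; lia.
have mc : m != c.
  by case: hm => [->//|]; apply: contraTneq => ->; lia.
have hm1 : m \in (b |: S0)%SET.
  by rewrite !inE; case: hm => [->|->]; rewrite ?eqxx ?orbT.
have hc1 : c \notin (b |: S0)%SET by rewrite !inE negb_or eq_sym bc; lia.
have h1 := pendant_loop (base_loop E S0) (m := a) (x := b) (eta := zeta) (e1 := z1).
have hE0 e : e \in E -> forall v, v \in e -> v \in S0.
  by move=> he' v hv; rewrite inE; apply: hE hv.
have {}h1 := h1 hE0; rewrite inE in h1.
have {}h1 := h1 ha hb0 hz hz1.
have h2 : \forall r \near (0 : R)^'+, forall phi, frel A a 1 (zeta (r, phi)).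
  by apply: filterS hr => r hr phi; have [] := hr phi.
have {}h1 := h1 h2.
have hE1 e : e \in (E :|: [set [set a; b]])%SET -> forall v, v \in e -> v \in (b |: S0)%SET.
  rewrite !inE => /orP[he' v hv|/eqP -> v]; first by rewrite !inE (hE he' hv) orbT.
  by rewrite !inE => /orP[] /eqP ->; rewrite ?eqxx // ha orbT.
have h3 := pendant_loop h1 hE1 hm1 hc1 he.
have h4 : m \notin A -> e1 = upd (fun=> 0) b z1 m.
  by move=> /he1; rewrite /upd.
have {}h3 := h3 h4.
have h5 : \forall r \near (0 : R)^'+, forall phi,
    frel A m (upd (fun=> 1) b (zeta (r, phi)) m) (eta (r, phi)).
  by apply: filterS hr => r hr phi; have [] := hr phi.
have {}h3 := h3 h5.
eexists; eexists; apply: (loop_flex_path h3).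
  move=> v hv; rewrite !inE; have [vN|vN] := ltnP v N; first by rewrite !orbT.
  have : v == c \/ v == b by rewrite -!val_eqE /=; move: bc; rewrite -val_eqE /=; lia.
  by case=> ->; rewrite ?orbT.
apply: filterS hr => r hr phi hs; have [_ _ hn] := hr phi.
have nb v : (v < N)%N -> v != b by move=> hv; apply: contraTneq hv => ->; lia.
have nc v : (v < N)%N -> v != c by move=> hv; apply: contraTneq hv => ->; lia.
have hM : (N <= N.+2)%N by lia.
have hq g g' v : (v < N)%N -> upd (upd P b g) c g' v = P v.
  by move=> hv; rewrite !upd_neq ?nb ?nc.
have hP := base_similar hM (hq _ _ v0 hv0) (hq _ _ v1 hv1) hs.
have hPb : P a + zeta (r, phi) * (P b - P a) = P b.
  have /= := hP b; rewrite (upd_neq _ _ bc) updE; apply; lia.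
have ab : b != a by rewrite eq_sym nb.
have z1' : zeta (r, phi) = 1.
  apply: (mulIf (subP_neq0 P_inj ab)); rewrite mul1r.
  by apply: (addrI (P a)); rewrite hPb addrC subrK.
apply: hn; split=> //.
have /= := hP c; rewrite updE => hPc.
have hPm : upd P b (P a + zeta (r, phi) * (P b - P a)) m = P m.
  by have [->|mb] := eqVneq m b; rewrite ?updE ?upd_neq //.
have cm : c != m by rewrite eq_sym.
apply: (mulIf (subP_neq0 P_inj cm)); rewrite mul1r; apply: (addrI (P m)).
rewrite -{1}hPm [P m + (P c - P m)]addrC subrK; apply: hPc; lia.
Qed.

Let gt0 := nbhs_right_gt (0 : R).

(** What remains of the path hangs at [a]. A factor may be stretched at an angle vertex and turned
    at a distance vertex. One of [a], [b] is an angle vertex; its stretch is driven by the cosine,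
    so that the flex at the marked angles has real edge factors. *)
Lemma delete_last a b c : (a < N)%N -> (N <= b < N.+2)%N -> (N <= c < N.+2)%N ->
  b != c -> (a \in A) || (b \in A) ->
  exists nu al,
    flex_path A P (E :|: [set [set a; b]] :|: [set [set b; c]])%SET N.+2 nu al.
Proof.
move=> ha hb hc bc hA; have hm : b = b \/ (b < N)%N by left.
have [aA|aA] := boolP (a \in A); have [bA|bA] := boolP (b \in A).
- apply: (two_pendants ha hb hc bc hm affs_factor _ affc_factor); rewrite ?aA ?bA //.
  apply: filterS3 gt0 (aff1_gt0 (@abs_cos_le1 R)) (aff1_gt0 (@abs_sin_le1 R)).
  move=> r r0 h1 h2 phi; rewrite eqxx /frel aA bA divr1; split=> //.
    exact: divr_gt0.
  by move=> [/aff1_eq1 e1 /aff1_eq1 e2]; apply: loop_nontrivial r0 e2 e1.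
- apply: (two_pendants ha hb hc bc hm affc_factor _ affc_rots_factor);
    rewrite ?aA ?bA ?eqxx //.
  apply: filterS2 gt0 (aff1_gt0 (@abs_cos_le1 R)) => r r0 h1 phi.
  rewrite ?eqxx /frel aA (negPf bA) divr1; split=> //.
    by rewrite normrM norm_rot mulr1; split=> //; apply: lt0r_neq0.
  move=> [e1]; rewrite e1 mul1r => /rot_eq1 e2.
  exact: loop_nontrivial r0 (aff1_eq1 e1) e2.
- have hp : loop_factor (fun t => rot sin t * aff 1 cos t) 1.
    have -> : (fun t => rot sin t * aff 1 cos t) = (fun t => aff 1 cos t * rot sin t) :> (R * R -> C).
      by apply: funext => t; rewrite mulrC.
    exact: affc_rots_factor.
  apply: (two_pendants ha hb hc bc hm rots_factor _ hp); rewrite ?(negPf aA) ?bA //.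
  apply: filterS2 gt0 (aff1_gt0 (@abs_cos_le1 R)) => r r0 h1 phi.
  rewrite eqxx /frel (negPf aA) bA normr1 norm_rot oner_neq0; split=> //.
    by rewrite mulrAC divff ?mul1r // rot_neq0.
  move=> [e1]; rewrite e1 mul1r => e2.
  exact: loop_nontrivial r0 (aff1_eq1 e2) (rot_eq1 e1).
by move: hA; rewrite (negPf aA) (negPf bA).
Qed.

(** With the edge [bc] gone, [b] hangs at [a] and [c] at [d], independently. The stretch at an angle
    vertex among [a], [d] is driven by the cosine, as in [delete_last]. *)
Lemma delete_middle a b c d : (a < N)%N -> (d < N)%N ->
  (N <= b < N.+2)%N -> (N <= c < N.+2)%N ->
  b != c -> (a \in A) || (d \in A) ->
  exists nu al,
    flex_path A P (E :|: [set [set a; b]] :|: [set [set d; c]])%SET N.+2 nu al.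
Proof.
move=> ha hd hb hc bc hA; have hm : d = b \/ (d < N)%N by right.
have db : d == b = false by apply/negbTE; apply: contraTneq hd => ->; lia.
have [aA|aA] := boolP (a \in A); have [dA|dA] := boolP (d \in A).
- apply: (two_pendants ha hb hc bc hm affs_factor _ affc_factor); rewrite ?aA ?dA //.
  apply: filterS3 gt0 (aff1_gt0 (@abs_cos_le1 R)) (aff1_gt0 (@abs_sin_le1 R)).
  move=> r r0 h1 h2 phi; rewrite ?db /frel aA dA !divr1; split=> //.
  by move=> [/aff1_eq1 e1 /aff1_eq1 e2]; apply: loop_nontrivial r0 e2 e1.
- apply: (two_pendants ha hb hc bc hm affc_factor _ rots_factor);
    rewrite ?aA ?(negPf dA) ?db //.
  apply: filterS2 gt0 (aff1_gt0 (@abs_cos_le1 R)) => r r0 h1 phi.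
  rewrite ?db /frel aA (negPf dA) divr1 norm_rot normr1 oner_neq0; split=> //.
  by move=> [/aff1_eq1 e1 /rot_eq1 e2]; apply: loop_nontrivial r0 e1 e2.
- apply: (two_pendants ha hb hc bc hm rots_factor _ affc_factor);
    rewrite ?(negPf aA) ?dA //.
  apply: filterS2 gt0 (aff1_gt0 (@abs_cos_le1 R)) => r r0 h1 phi.
  rewrite ?db /frel (negPf aA) dA divr1 norm_rot normr1 oner_neq0; split=> //.
  by move=> [/rot_eq1 e1 /aff1_eq1 e2]; apply: loop_nontrivial r0 e2 e1.
by move: hA; rewrite (negPf aA) (negPf dA).
Qed.

End EarDeletion.
End Deletions.

(** * Deleting an edge of a short path, or the initial edge *)

Section SmallDeletions.
Variables (R : realType) (n : nat) (A : {set 'I_n}) (P : 'I_n -> R[i]).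
Hypothesis P_inj : injective P.
Local Notation C := R[i].
Implicit Types (E : {set {set 'I_n}}) (N : nat).
Implicit Types (a b j u v x : 'I_n) (r phi : R).

Lemma loop_nearby E S N nu al q f phi0 : loop_data A P E S nu al q f ->
  (\forall r \near (0 : R)^'+, ~ similar_below A P N (q (r, phi0)) (f (r, phi0))) ->
  nearby_flex A P E N.
Proof.
move=> [_ [h1 h2 _ _]] h5.
exists (fun r => q (r, phi0)), (fun r => f (r, phi0)); split.
  have h0 : (fun r : R => (r, phi0)) @ (0 : R)^'+ --> @uniform_at_right R.
    move=> S' hS; have hS' : \forall r \near (0 : R)^'+, forall phi, S' (r, phi) by exact: hS.
    by have : \forall r \near (0 : R)^'+, S' (r, phi0) by apply: filterS hS' => r; apply.
  move=> v; have [hq hf] := h1 v; split.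
    exact: (cvg_comp _ _ h0 hq).
  exact: (cvg_comp _ _ h0 hf).
by apply: filterS2 h2 h5 => r h2 h5; split.
Qed.

(** The one-vertex addition is itself the place of the deletion, so no overdetermined step follows
    and one angle of the loop suffices: [phi0] is where the driving cosine or sine equals 1. *)
Lemma delete_link E N v0 v1 j x : below E N -> v0 != v1 ->
  (v0 < N)%N -> (v1 < N)%N -> (j < N)%N -> x = N :> nat ->
  nearby_flex A P (E :|: [set [set j; x]])%SET N.+1.
Proof.
move=> hE h01 hv0 hv1 hj hx.
pose S0 : {set 'I_n} := [set v : 'I_n | (v < N)%N]%SET.
have hE0 e : e \in E -> forall v, v \in e -> v \in S0.
  by move=> he' v hv; rewrite inE; apply: hE hv.
have hj0 : j \in S0 by rewrite inE.
have hx0 : x \notin S0 by rewrite inE hx ltnn.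
have [eta [e1 [phi0 [he he0 hef hn]]]] : exists (eta : R * R -> C) (e1 : C) phi0,
    [/\ loop_factor eta e1, j \notin A -> e1 = 0,
        \forall r \near (0 : R)^'+, forall phi, frel A j 1 (eta (r, phi)) &
        forall r, eta (r, phi0) = 1 -> r = 0].
  have [jA|jA] := boolP (j \in A).
    exists (aff 1 cos), 1, 0; split=> //; first exact: affc_factor.
      apply: filterS (aff1_gt0 (@abs_cos_le1 R)) => r h phi.
      by rewrite /frel jA divr1.
    by move=> r /aff1_eq1 /=; rewrite cos0 mulr1.
  exists (rot sin), 0, (pi / 2); split=> //; first exact: rots_factor.
    by apply: nearW => r phi; rewrite /frel (negPf jA) norm_rot normr1 oner_neq0.
  by move=> r /rot_eq1 /=; rewrite sin_pihalf mulr1.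
have h1 := pendant_loop P_inj (base_loop A P_inj E S0) hE0 hj0 hx0 he he0 hef.
apply: (loop_nearby (phi0 := phi0) h1).
have : \forall r \near (0 : R)^'+, 0 < r by apply: nbhs_right_gt.
apply: filterS => r r0 hs.
have nx v : (v < N)%N -> v != x by move=> hv; apply: contraTneq hv => ->; rewrite hx ltnn.
have hq z v : (v < N)%N -> upd P x z v = P v by move=> hv; rewrite upd_neq ?nx.
have hP := base_similar P_inj h01 hv0 hv1 (leqnSn N) (hq _ v0 hv0) (hq _ v1 hv1) hs.
have /= := hP x; rewrite updE hx ltnSn => /(_ isT) e.
have xj : x != j by rewrite eq_sym nx.
have /hn r00 : eta (r, phi0) = 1.
  apply: (mulIf (subP_neq0 P_inj xj)); rewrite mul1r; apply: (addrI (P j)).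
  by rewrite e addrC subrK.
by move: r0; rewrite r00 ltxx.
Qed.

(** Unlike in [loop_factor] the slope may be nonreal: once their edge is deleted, nothing restricts
    the factor of the two initial vertices. *)
Definition loop_curve (zeta : R * R -> C) (z1 : C) : Prop :=
  [/\ zeta @ @uniform_at_right R --> (1 : C),
      forall r phi, (fun psi => zeta (r, psi)) @ phi --> zeta (r, phi) &
      forall r, zeta (r, 0) = 1 + r%:C%C * z1 /\ zeta (r, pi) = 1 + (- r)%:C%C * z1].

Lemma aff_cos_curve (k : C) : loop_curve (aff k cos) k.
Proof.
split; first exact: aff_tends (@abs_cos_le1 R).
  by move=> r phi; apply: aff_cont; apply: continuous_cos.
by move=> r; rewrite aff_cos0 aff_cospi.
Qed.

Lemma aff_sin_curve (k : C) : loop_curve (aff k sin) 0.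
Proof.
split; first exact: aff_tends (@abs_sin_le1 R).
  by move=> r phi; apply: aff_cont; apply: continuous_sin.
by move=> r; rewrite aff_sin0 aff_sinpi !mulr0 addr0.
Qed.

Lemma one_curve : loop_curve (fun=> 1) 0.
Proof.
split; first exact: cvg_cst.
  by move=> r phi; apply: cvg_cst.
by move=> r; rewrite !mulr0 addr0.
Qed.

Lemma mul_curve z w (k : C) : loop_curve z k -> loop_curve w 0 ->
  loop_curve (fun t => z t * w t) k.
Proof.
move=> [h1 h2 h3] [h1' h2' h3']; split.
- by rewrite -[X in _ --> X]mulr1; exact: (cvgMC h1 h1').
- by move=> r phi; exact: (cvgMC (h2 r phi) (h2' r phi)).
move=> r; have [-> ->] := h3 r; have [-> ->] := h3' r.
by rewrite !mulr0 !addr0 !mulr1.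
Qed.

Lemma aff_eq1 (k : C) (g : R -> R) t : t.1 * g t.2 = 0 -> aff k g t = 1.
Proof. by rewrite /aff => ->; rewrite mul0r addr0. Qed.

Lemma base_path a b (zeta fa fb : R * R -> C) (z1 a1 b1 : C) :
  a = 0%N :> nat -> b = 1%N :> nat ->
  loop_curve zeta z1 -> loop_curve fa a1 -> loop_curve fb b1 ->
  a1 \is Num.real -> b1 \is Num.real ->
  (\forall r \near (0 : R)^'+, forall phi,
     ~ (frel A a (fa (r, phi)) (zeta (r, phi)) /\
        frel A b (fb (r, phi)) (zeta (r, phi)))) ->
  flex_path A P finset.set0 2 (upd (fun=> 0) b (z1 * (P b - P a)))
    (upd (upd (fun=> 0) a a1) b b1).
Proof.
move=> ea eb [hz1 hz2 hz3] [ha1 ha2 ha3] [hb1 hb2 hb3] ra rb hn.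
have ab : a != b by rewrite -val_eqE /= ea eb.
have ba : b != a by rewrite eq_sym.
have ePb (s : C) : P b + s * (P b - P a) = P a + (1 + s) * (P b - P a) by ring.
have hd : loop_data A P finset.set0 [set: 'I_n]%SET
  (upd (fun=> 0) b (z1 * (P b - P a))) (upd (upd (fun=> 0) a a1) b b1)
  (fun t => upd P b (P a + zeta t * (P b - P a)))
  (fun t => upd (upd (fun=> 1) a (fa t)) b (fb t)).
  split.
- split; first by move=> v; rewrite /upd; case: ifP => // _; case: ifP.
  by move=> u v _; rewrite inE.
- split.
  + move=> v; rewrite /upd; case: (eqVneq v b) => [->|_].
      split; last exact: hb1.
      have e : P b = P a + 1 * (P b - P a) by rewrite mul1r addrC subrK.
      rewrite [X in _ --> X]e; exact: (cvgDC (cvg_cst _) (cvgMk hz1)).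
    split; first exact: cvg_cst.
    by case: (v == a); [exact: ha1|exact: cvg_cst].
  + by apply: nearW => r phi u v _; rewrite inE.
  + apply: nearW => r phi v; rewrite /upd; case: (eqVneq v b) => [_|_].
      split; last exact: hb2.
      exact: (cvgDC (cvg_cst _) (cvgMk (hz2 r phi))).
    split; first exact: cvg_cst.
    by case: (v == a); [exact: ha2|exact: cvg_cst].
  apply: nearW => r v _; rewrite /upd.
  have [e1 e2] := hz3 r; have [e3 e4] := ha3 r; have [e5 e6] := hb3 r.
  case: (eqVneq v b) => [->|_].
    by rewrite e1 e2 e5 e6 !mulrA -!ePb.
  by case: (v == a); rewrite ?e3 ?e4 !mulr0 !addr0.
apply: (loop_flex_path hd); first by move=> v _; rewrite inE.
apply: filterS hn => r hn phi [z [t h]]; apply: (hn phi).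
  have a2 : (a < 2)%N by rewrite ea.
  have b2 : (b < 2)%N by rewrite eb.
  have [/= qa fra] := h a a2; have [/= qb frb] := h b b2.
  rewrite updE in qb; rewrite updE in frb.
  rewrite (upd_neq _ _ ab) in qa; rewrite (upd_neq _ _ ab) updE in fra.
  have ez : zeta (r, phi) = z.
    apply: (mulIf (subP_neq0 P_inj ba)).
    apply: (addrI (P a)); rewrite qb.
    have -> : t = P a - z * P a by rewrite {1}qa addrC addKr.
    by ring.
  by rewrite ez.
Qed.

Lemma frel_one v (z : C) : v \in A -> frel A v 1 z -> 0 < z.
Proof. by rewrite /frel => ->; rewrite divr1. Qed.

(** The relation at an angle vertex is broken by turning, that at a distance vertex by stretching.
    Frames need real slopes, so a turned frame is driven by the sine. For two distance vertices
    nothing moves and only the frames are stretched, both with slope 1: this is the second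
    alternative, the state available when there is no angle vertex yet. *)
Lemma delete_base a b : a = 0%N :> nat -> b = 1%N :> nat ->
  exists nu al, flex_path A P finset.set0 2 nu al /\
    ((exists2 v : 'I_n, (v < 2)%N & v \in A) \/
     (forall v, (v < 2)%N -> nu v = 0 /\ al v = 1)).
Proof.
move=> ea eb; have gt0 := @nbhs_right_gt R 0.
have ab : a != b by rewrite -val_eqE /= ea eb.
have hi (g : R -> R) t : 0 < aff 'i%C g t -> t.1 * g t.2 = 0.
  by move=> /gtr0_real; apply: aff_i_real.
have nrm (g : R -> R) t : 0 < aff 1 g t -> `|1 : C| = `|aff 1 g t| -> t.1 * g t.2 = 0.
  by move=> h; rewrite normr1 (gtr0_norm h) => /esym; apply: aff1_eq1.
have [aA|aA] := boolP (a \in A); have [bA|bA] := boolP (b \in A).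
- eexists; eexists; split; last by left; exists a; rewrite ?ea.
  apply: (base_path ea eb (aff_cos_curve 'i%C) one_curve (aff_sin_curve 'i%C));
    rewrite ?rpred0 //.
  apply: filterS gt0 => r r0 phi [/(frel_one aA) /hi e1].
  rewrite (aff_eq1 _ (t := (r, phi)) e1) /frel bA mul1r invr_gt0 => /hi e2.
  exact: loop_nontrivial r0 e1 e2.
- eexists; eexists; split; last by left; exists a; rewrite ?ea.
  apply: (base_path ea eb (aff_sin_curve 'i%C) one_curve (aff_cos_curve 1));
    rewrite ?rpred0 ?rpred1 //.
  apply: filterS2 gt0 (aff1_gt0 (@abs_cos_le1 R)) => r r0 h1 phi.
  move=> [/(frel_one aA) /hi e1]; rewrite (aff_eq1 _ (t := (r, phi)) e1).
  rewrite /frel (negPf bA) => -[/(nrm _ _ (h1 phi)) e2 _].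
  exact: loop_nontrivial r0 e2 e1.
- eexists; eexists; split; last by left; exists b; rewrite ?eb.
  apply: (base_path ea eb (aff_sin_curve 'i%C) (aff_cos_curve 1) one_curve);
    rewrite ?rpred0 ?rpred1 //.
  apply: filterS2 gt0 (aff1_gt0 (@abs_cos_le1 R)) => r r0 h1 phi.
  move=> [+ /(frel_one bA) /hi e1]; rewrite (aff_eq1 _ (t := (r, phi)) e1).
  rewrite /frel (negPf aA) => -[/(nrm _ _ (h1 phi)) e2 _].
  exact: loop_nontrivial r0 e2 e1.
eexists; eexists; split.
  apply: (base_path ea eb one_curve
    (mul_curve (aff_cos_curve 1) (aff_sin_curve 1)) (aff_cos_curve 1));
    rewrite ?rpred1 //.
  apply: filterS3 gt0 (aff1_gt0 (@abs_cos_le1 R)) (aff1_gt0 (@abs_sin_le1 R)).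
  move=> r r0 h1 h2 phi; rewrite /frel (negPf aA) (negPf bA).
  move=> [[+ _] [/(nrm _ _ (h1 phi)) e1 _]].
  rewrite (aff_eq1 _ (t := (r, phi)) e1) mul1r => /(nrm _ _ (h2 phi)) e2.
  exact: loop_nontrivial r0 e1 e2.
right => v hv; have [->|vb] := eqVneq v b; first by rewrite !updE mul0r.
have -> : v = a by apply: val_inj => /=; move: vb; rewrite -val_eqE /=; lia.
by rewrite !(upd_neq _ _ ab) updE.
Qed.

End SmallDeletions.

(** * Genericity *)

Section GenericRank.
Variables (R : realType) (n : nat).
Local Notation colsub g := (mxsub id g).
Local Notation rowsub f := (mxsub f id).
Local Notation MP := (mpoly (n * 2) int).

Definition ev (p : 'M[R]_(n, 2)) : MP -> R :=
  mmap intr (fun k => mxvec p 0 k).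

HB.instance Definition _ p := GRing.RMorphism.copy (ev p)
  (mmap intr (fun k => mxvec p 0 k)).

(** A nonzero minor of maximal size at [p'] is a value of a nonzero integer polynomial, and
    genericity keeps that polynomial nonzero at [p]. *)
Lemma generic_rank_max (m k : nat) (M : 'M[MP]_(m, k)) (p p' : 'M[R]_(n, 2)) :
  generic p -> (\rank (map_mx (ev p') M) <= \rank (map_mx (ev p) M))%N.
Proof.
move=> hgen; set M' := map_mx (ev p') M.
pose B := rowsub (maxrankfun M') M'.
have fB : row_full B^T by rewrite /row_full mxrank_tr; exact: (maxrowsub_free M').
pose D := mxsub (maxrankfun M') (fullrankfun fB) M.
have uD : \det (map_mx (ev p') D) != 0.
  rewrite -unitfE -unitmxE -unitmx_tr.
  have := fullrowsub_unit fB; congr (_ \in unitmx).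
  by apply/matrixP => i j; rewrite !mxE.
have pD : \det D != 0.
  by apply: contraNneq uD => e; rewrite det_map_mx e rmorph0.
have := hgen _ pD; rewrite -/(ev p _) -det_map_mx -unitfE -unitmxE => /mxrank_unit <-.
have -> : map_mx (ev p) D =
    colsub (fullrankfun fB) (rowsub (maxrankfun M') (map_mx (ev p) M)).
  by apply/matrixP => i j; rewrite !mxE.
rewrite -mxrank_tr -[in X in (_ <= X)%N]mxrank_tr.
have -> : (colsub (fullrankfun fB) (rowsub (maxrankfun M') (map_mx (ev p) M)))^T =
    rowsub (fullrankfun fB) (rowsub (maxrankfun M') (map_mx (ev p) M))^T.
  by apply/matrixP => i j; rewrite !mxE.
apply: leq_trans (mxrankS (rowsub_sub _ _)) _.
rewrite mxrank_tr mxrank_tr.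
exact: mxrankS (rowsub_sub _ _).
Qed.

End GenericRank.

(** * Carrying a linear relation between flexes over to another configuration *)

Section Transfer.
Variables (R : realType) (n : nat) (A : {set 'I_n}).
Local Notation MP := (mpoly (n * 2) int).
Implicit Types (p : 'M[R]_(n, 2)) (E : {set {set 'I_n}}) (u v : 'I_n).

Definition c3 : 'I_3 := Ordinal (isT : 2 < 3)%N.
Definition c1 : 'I_3 := Ordinal (isT : 0 < 3)%N.
Definition c2 : 'I_3 := Ordinal (isT : 1 < 3)%N.

(* Row [v] of [X] lists the two coordinates of the velocity of [v] and its
   infinitesimal stretch factor. *)
Definition flex_form (S : comNzRingType) E (p : 'M[S]_(n, 2)) (X : 'M[S]_(n, 3))
    (u v : 'I_n) (k : 'I_3) : S :=
  if (u != v) && ([set u; v]%SET \in E) then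
    if k == c1 then
      (X v c1 - X u c1) * (p v 1 - p u 1) - (X v c2 - X u c2) * (p v 0 - p u 0)
    else if u \in A then 0
    else if k == c2 then X v c1 - X u c1 - X u c3 * (p v 0 - p u 0)
    else X v c2 - X u c2 - X u c3 * (p v 1 - p u 1)
  else 0.

Definition flex_eqs E p (X : 'M[R]_(n, 3)) : Prop :=
  forall u v k, flex_form E p X u v k = 0.

Definition flex_row (S : comNzRingType) E (p : 'M[S]_(n, 2)) (x : 'rV[S]_(n * 3)) :
    'rV[S]_(#|{: 'I_n * 'I_n * 'I_3}|) :=
  \row_j let t := enum_val j in flex_form E p (vec_mx x) t.1.1 t.1.2 t.2.

Lemma flex_row_eq0 E p x : flex_row E p x = 0 <-> flex_eqs E p (vec_mx x).
Proof.
split=> [h u v k|h]; last by apply/rowP => j; rewrite !mxE.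
by move/rowP: h => /(_ (enum_rank (u, v, k))); rewrite !mxE enum_rankK.
Qed.

Lemma flex_row_linear E p : linear (flex_row E p).
Proof.
move=> a x y; apply/rowP => j; rewrite !mxE; set t := enum_val j.
rewrite /flex_form; case: ifP => _; last by rewrite mulr0 addr0.
case: ifP => _; first by rewrite !linearP !mxE; ring.
case: ifP => _; first by rewrite mulr0 addr0.
by case: ifP => _; rewrite !linearP !mxE; ring.
Qed.

Lemma map_flex_row (S S' : comNzRingType) (phi : {rmorphism S -> S'}) E
    (p : 'M[S]_(n, 2)) x :
  map_mx phi (flex_row E p x) = flex_row E (map_mx phi p) (map_mx phi x).
Proof.
apply/rowP => j; rewrite !mxE; set t := enum_val j.
rewrite /flex_form -map_vec_mx; case: ifP => _; last by rewrite rmorph0.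
case: ifP => _; first by rewrite rmorphB !rmorphM !rmorphB !mxE.
case: ifP => _; first by rewrite rmorph0.
by case: ifP => _; rewrite !rmorphB rmorphM rmorphB !mxE.
Qed.

(** The coordinates are the indeterminates: the flex equations written at this point specialise to
    those of every configuration. This is why they are stated over an arbitrary commutative ring. *)
Definition generic_point : 'M[MP]_(n, 2) := \matrix_(i, j) @mpolyX (n * 2) int (mnm1 (mxvec_index i j)).

Lemma ev_generic_point p : map_mx (ev p) generic_point = p.
Proof.
by apply/matrixP => i j; rewrite !mxE /ev mmapX mmap1U mxvecE.
Qed.

Definition plane_map (a b c d : R) (X : 'M[R]_(n, 3)) : 'M[R]_(n, 3) :=
  \matrix_(v, k) if k == c1 then a * X v c1 + b * X v c2
    else if k == c2 then c * X v c1 + d * X v c2 else X v c3.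

Lemma plane_mapK (a b c d : R) X : a * d - b * c != 0 ->
  let D := a * d - b * c in
  plane_map a b c d (plane_map (d / D) (- b / D) (- c / D) (a / D) X) = X.
Proof.
move=> hdet D; apply/matrixP => v k.
have ek : k = c1 \/ k = c2 \/ k = c3.
  case: k => -[|[|[|//]]] hk; [left|right; left|right; right]; exact: val_inj.
by case: ek => [->|[->|->]]; rewrite !mxE //= /D; field; exact: hdet.
Qed.

(** The equations say that each relative velocity is a real multiple of its edge vector, the
    multiple being prescribed at distance vertices. A linear map applied to positions and velocities
    alike preserves this; the cross products get multiplied by the determinant. *)
Lemma flex_eqs_plane_map N E p p' (a b c d : R) X :
  (forall e, e \in E -> forall v, v \in e -> (v < N)%N) ->
  (forall v : 'I_n, (v < N)%N ->
     p' v 0 = a * p v 0 + b * p v 1 /\ p' v 1 = c * p v 0 + d * p v 1) ->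
  flex_eqs E p X -> flex_eqs E p' (plane_map a b c d X).
Proof.
move=> hE hp h u v k; have := h u v; rewrite /flex_form.
case: ifP => // /andP[uv he] h'.
have hu : (u < N)%N by apply: hE he _ _; rewrite !inE eqxx.
have hv : (v < N)%N by apply: hE he _ _; rewrite !inE eqxx orbT.
have [-> ->] := hp u hu; have [-> ->] := hp v hv.
have h1 := h' c1; have h2 := h' c2; have h3 := h' c3; rewrite /= in h1 h2 h3.
case: ifP => k1.
  rewrite !mxE /=.
  transitivity ((a * d - b * c) * 0 : R); last by rewrite mulr0.
  by rewrite -h1; ring.
case: ifP h2 h3 => // _ h2 h3; case: ifP => _; rewrite !mxE /=.
  transitivity (a * 0 + b * 0 : R); last by rewrite !mulr0 addr0.
  by rewrite -{1}h2 -h3; ring.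
transitivity (c * 0 + d * 0 : R); last by rewrite !mulr0 addr0.
by rewrite -{1}h2 -h3; ring.
Qed.

Lemma mul_lin1 m k (h : 'rV[R]_m -> 'rV[R]_k) (u : 'rV[R]_m) : linear h -> u *m lin1_mx h = h u.
Proof.
move=> hl; pose hh : {linear 'rV[R]_m -> 'rV[R]_k} :=
  HB.pack h (GRing.isLinear.Build _ _ _ _ h hl).
exact: (mul_rV_lin1 hh).
Qed.

(* By genericity the rank of the flex equations extended by [g] is maximal at
   [p], and the rank of the equations themselves is the same at [p] and [p']. *)
Lemma flex_transfer N E p p' (a b c d : R)
    (gZ : 'M[MP]_(n, 3) -> MP) (g : 'M[R]_(n, 2) -> 'M[R]_(n, 3) -> R) :
  generic p ->
  (forall q X, ev q (gZ X) = g q (map_mx (ev q) X)) ->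
  (forall q k X Y, g q (k *: X + Y) = k * g q X + g q Y) ->
  (forall e, e \in E -> forall v, v \in e -> (v < N)%N) ->
  a * d - b * c != 0 ->
  (forall v : 'I_n, (v < N)%N ->
     p' v 0 = a * p v 0 + b * p v 1 /\ p' v 1 = c * p v 0 + d * p v 1) ->
  (forall X, flex_eqs E p X -> g p X = 0) ->
  forall X, flex_eqs E p X -> g p' (plane_map a b c d X) = 0.
Proof.
move=> hgen hgZ hg hE hdet hp h X hX.
pose D := a * d - b * c.
pose inv := plane_map (d / D) (- b / D) (- c / D) (a / D).
have hp' (v : 'I_n) : (v < N)%N -> p v 0 = d / D * p' v 0 + - b / D * p' v 1 /\
    p v 1 = - c / D * p' v 0 + a / D * p' v 1.
  move=> /hp [-> ->]; rewrite /D; split; field; exact: hdet.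
pose G q x : 'rV[R]_1 := \row_j g q (vec_mx x).
have Glin q : linear (G q).
  by move=> k x y; apply/rowP => j; rewrite !mxE linearP hg.
pose F (q : 'M[R]_(n, 2)) := lin1_mx (flex_row E q); pose K q := lin1_mx (G q).
pose H q := row_mx (F q) (K q).
pose HZ := row_mx (lin1_mx (flex_row E generic_point))
  (lin1_mx (fun x : 'rV[MP]_(n * 3) => \row_(j < 1) gZ (vec_mx x))).
have hHZ q : map_mx (ev q) HZ = H q.
  rewrite /HZ map_row_mx; congr row_mx.
    by apply: map_lin1_mx => x; rewrite map_flex_row ev_generic_point.
  apply: map_lin1_mx => x; apply/rowP => j; rewrite !mxE -map_vec_mx.
  exact: hgZ.
have rk1 : (\rank (H p') <= \rank (H p))%N by rewrite -!hHZ; apply: generic_rank_max.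
have mulF q x : x *m F q = flex_row E q x by apply/mul_lin1/flex_row_linear.
have mulK q x : x *m K q = G q x by apply: mul_lin1.
have rk2 : (\rank (H p) <= \rank (F p))%N.
  have : (kermx (F p) <= kermx (H p))%MS.
    apply/row_subP => i; apply/sub_kermxP.
    have /sub_kermxP hi : (row i (kermx (F p)) <= kermx (F p))%MS by apply: row_sub.
    rewrite mul_mx_row hi mulK; move: hi; rewrite mulF => /flex_row_eq0 /h e.
    rewrite (_ : G _ _ = 0) ?row_mx0 //.
    by apply/rowP => j; rewrite !mxE e.
  move/mxrankS; rewrite !mxrank_ker.
  have := rank_leq_row (F p); have := rank_leq_row (H p); lia.
pose J := lin1_mx (fun x : 'rV[R]_(n * 3) => mxvec (inv (vec_mx x))).
pose J' := lin1_mx (fun x : 'rV[R]_(n * 3) => mxvec (plane_map a b c d (vec_mx x))).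
have plin a' b' c' d' : linear
    (fun x : 'rV[R]_(n * 3) => mxvec (plane_map a' b' c' d' (vec_mx x))).
  move=> k x y; rewrite -linearP; congr mxvec; apply/matrixP => i j.
  rewrite !mxE.
  by case: ifP => _; [|case: ifP => _]; ring.
have mulJ x : x *m J = mxvec (inv (vec_mx x)).
  by apply: mul_lin1; apply: plin.
have mulJ' x : x *m J' = mxvec (plane_map a b c d (vec_mx x)).
  by apply: mul_lin1; apply: plin.
have JJ : J *m J' = 1%:M.
  apply/row_matrixP => i; rewrite rowE mulmxA mulJ mulJ' mxvecK row1.
  by rewrite plane_mapK // vec_mxK.
have fJ : row_free J by apply/row_freeP; exists J'.
have rk3 : (\rank (F p) <= \rank (F p'))%N.
  have : (kermx (F p') *m J <= kermx (F p))%MS.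
    apply/row_subP => i; rewrite row_mul; apply/sub_kermxP.
    have /sub_kermxP hi : (row i (kermx (F p')) <= kermx (F p'))%MS by apply: row_sub.
    rewrite mulF mulJ; apply/flex_row_eq0; rewrite mxvecK.
    apply: flex_eqs_plane_map hE hp' _.
    by apply/flex_row_eq0; rewrite -mulF.
  move/mxrankS; rewrite mxrankMfree // !mxrank_ker.
  have := rank_leq_row (F p); have := rank_leq_row (F p'); lia.
have hsub : (kermx (H p') <= kermx (F p'))%MS.
  apply/row_subP => i; apply/sub_kermxP.
  have /sub_kermxP : (row i (kermx (H p')) <= kermx (H p'))%MS by apply: row_sub.
  by rewrite mul_mx_row -row_mx0 => /eq_row_mx [].
(* The bounds form a chain: $H(p')$, $H(p)$, $F(p)$, $F(p')$ have nondecreasing ranks. As the kernel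
   of $H(p')$ lies in that of $F(p')$, the two kernels coincide. *)
have heq : (kermx (F p') <= kermx (H p'))%MS.
  have := (mxrank_leqif_sup hsub).2; rewrite !mxrank_ker => <-.
  have := rank_leq_row (F p'); have := rank_leq_row (H p').
  move/mxrankS: hsub; rewrite !mxrank_ker; lia.
have : (mxvec (plane_map a b c d X) <= kermx (F p'))%MS.
  apply/sub_kermxP; rewrite mulF; apply/flex_row_eq0; rewrite mxvecK.
  exact: flex_eqs_plane_map hE hp hX.
move=> /submx_trans /(_ heq) /sub_kermxP; rewrite mul_mx_row -row_mx0.
move=> /eq_row_mx [_]; rewrite mulK => /rowP /(_ 0).
by rewrite !mxE mxvecK.
Qed.

End Transfer.

(** * One-vertex additions *)

Section LinkExtension.
Variables (R : realType) (n : nat) (A : {set 'I_n}) (P : 'I_n -> R[i]).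
Hypothesis P_inj : injective P.
Local Notation C := R[i].
Implicit Types (qi fi qj fj z r s : C).

Definition link_ok i x j (qi fi qx fx qj fj : C) : Prop :=
  (frel A i fi ((qx - qi) / (P x - P i)) /\ frel A x fx ((qx - qi) / (P x - P i))) /\
  (frel A x fx ((qj - qx) / (P j - P x)) /\ frel A j fj ((qj - qx) / (P j - P x))).

(* A vertex [x] linked to [i] and [j] is placed at [linkx], with frame [linkf],
   provided that the real equation [lF = 0] holds. *)
Record link_extension (i x j : 'I_n) := LinkExtension {
  linkx : C -> C -> C -> C -> C;
  linkf : C -> C -> C -> C -> C;
  lF : C -> C -> C -> C -> C;
  lc : C -> C -> C -> C -> C;
  ld : C -> C -> C -> C -> C;
  link_cvg : forall T (F : set_system T) (FF : Filter F) (qi fi qj fj : T -> C),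
    qi @ F --> P i -> fi @ F --> (1 : C) -> qj @ F --> P j -> fj @ F --> (1 : C) ->
    [/\ (fun t => linkx (qi t) (fi t) (qj t) (fj t)) @ F --> P x,
        (fun t => linkf (qi t) (fi t) (qj t) (fj t)) @ F --> (1 : C) &
        \forall t \near F, lF (qi t) (fi t) (qj t) (fj t) = 0 ->
          link_ok i x j (qi t) (fi t) (linkx (qi t) (fi t) (qj t) (fj t))
            (linkf (qi t) (fi t) (qj t) (fj t)) (qj t) (fj t)];
  lF_real : forall qi fi qj fj, lF qi fi qj fj \is Num.real;
  lF_cvg : forall T (F : set_system T) (FF : Filter F) (qi fi qj fj : T -> C)
      (li ki lj kj : C), ki != 0 -> kj != 0 ->
    qi @ F --> li -> fi @ F --> ki -> qj @ F --> lj -> fj @ F --> kj ->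
    (fun t => lF (qi t) (fi t) (qj t) (fj t)) @ F --> lF li ki lj kj;
  lc_real : forall ni ai nj aj, ai \is Num.real -> aj \is Num.real ->
    lc ni ai nj aj \is Num.real;
  ld_real : forall ni ai nj aj, ai \is Num.real -> aj \is Num.real ->
    ld ni ai nj aj \is Num.real;
  lF_parallel : forall ni ai nj aj, ai \is Num.real -> aj \is Num.real ->
    forall r, r \is Num.real -> 0 < 1 + r * ai -> 0 < 1 + r * aj ->
    lF (P i + r * ni) (1 + r * ai) (P j + r * nj) (1 + r * aj)
      = r * lc ni ai nj aj + r ^+ 2 * ld ni ai nj aj
}.

Lemma icr_real (a b : C) : 'i%C * cr a b \is Num.real.
Proof.
apply/conjc_realP; rewrite conjcM conj_cr mulrN -mulNr; congr (_ * _).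
by apply/eqP; rewrite eq_complex /= oppr0 opprK !eqxx.
Qed.

Lemma icr_eq0 (a b : C) : 'i%C * cr a b = 0 -> cr a b = 0.
Proof. by move=> /eqP; rewrite mulf_eq0 eq_complex /= oner_eq0 andbF => /eqP. Qed.

Lemma cr0_div_real (a b : C) : b != 0 -> cr a b = 0 -> a / b \is Num.real.
Proof.
move=> b0 h; have {}h : cr b a = 0 by rewrite crN h oppr0.
by have [k ->] := cr_eq0 b0 h; rewrite mulfK //; apply/complex_realP; exists k.
Qed.

Lemma near_real_gt0 T (F : set_system T) {FF : Filter F} (f : T -> C) :
  f @ F --> (1 : C) -> \forall t \near F, f t \is Num.real -> 0 < f t.
Proof.
move=> /cvgrPdist_lt /(_ 1 ltr01); apply: filterS => x h hr; move: h.
rewrite real_ltr_norml ?rpredB ?rpred1 //.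
by move=> /andP[_]; rewrite ltrBlDr -{1}[1]addr0 ltrD2l.
Qed.

Lemma cvg_eq T (F : set_system T) (f : T -> C) (a b : C) : a = b ->
  f @ F --> a -> f @ F --> b.
Proof. by move->. Qed.

Lemma cvg_norm_sqr T (F : set_system T) {FF : Filter F} (f : T -> C) (a : C) :
  f @ F --> a -> (fun t => `|f t| ^+ 2) @ F --> `|a| ^+ 2.
Proof. by move=> h; exact: (cvgMC (cvg_normC h) (cvg_normC h)). Qed.

Lemma norm_sqr_real z : `|z| ^+ 2 \is Num.real.
Proof. by rewrite rpredX // normr_real. Qed.

Section Types.
Variables i x j : 'I_n.
Hypotheses (ix : i != x) (xj : x != j) (ij : i != j).
Let u : C := P x - P i.
Let v : C := P j - P x.
Let w : C := P j - P i.

Let u_neq0 : u != 0. Proof. by rewrite subP_neq0 // eq_sym. Qed.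
Let v_neq0 : v != 0. Proof. by rewrite subP_neq0 // eq_sym. Qed.
Let w_neq0 : w != 0. Proof. by rewrite subP_neq0 // eq_sym. Qed.
Let wE : w = u + v. Proof. by rewrite /u /v /w; ring. Qed.
Let Pxu : P x = P i + u. Proof. by rewrite /u addrC subrK. Qed.
Let hat1 : hat 1 = 1 :> C. Proof. by rewrite hat_pos. Qed.
Let oneC : (1 : C) != 0. Proof. exact: oner_neq0. Qed.

(* The suffixes tell the classes of [i], [x] and [j], in this order. *)
Lemma link_extension_AAA : x \in A -> i \in A -> j \in A -> cr u v != 0 ->
  exists X : link_extension i x j, forall ni ai nj aj,
    lc X ni ai nj aj = 0 /\ ld X ni ai nj aj = 0.
Proof.
move=> hx hi hj D0.
pose D fi fj : C := cr (hat fi * u) (hat fj * v).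
pose sb qi fi qj fj : C := cr (qj - qi) (hat fj * v) / D fi fj.
pose tb qi fi qj fj : C := cr (hat fi * u) (qj - qi) / D fi fj.
pose xq qi fi qj fj : C := qi + sb qi fi qj fj * hat fi * u.
pose xf (qi fi qj fj : C) : C := fi.
(* All three are angle vertices, so the remaining condition is that the frames at [i] and [j] have
   the same argument. The factor ['i] turns the purely imaginary [cr] into a real number. *)
pose F0 (qi fi qj fj : C) : C := 'i%C * cr fi fj.
pose o (ni ai nj aj : C) : C := 0.
suff X : {X : link_extension i x j | lc X = o /\ ld X = o}.
  by case: X => X [ec ed]; exists X => *; rewrite ec ed.
unshelve eexists; first apply: (@LinkExtension i x j xq xf F0 o o).
- move=> T F FF qi fi qj fj hqi hfi hqj hfj.
  have hh : (fun t => hat (fi t)) @ F --> hat 1 by apply: cvg_hat.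
  have hh' : (fun t => hat (fj t)) @ F --> hat 1 by apply: cvg_hat.
  have hD : (fun t => D (fi t) (fj t)) @ F --> D 1 1.
    exact: (cvg_cr (cvgMk hh) (cvgMk hh')).
  have D1 : D 1 1 = cr u v by rewrite /D hat1 !mul1r.
  have nD : D 1 1 != 0 by rewrite D1.
  have hs : (fun t => sb (qi t) (fi t) (qj t) (fj t)) @ F --> sb (P i) 1 (P j) 1.
    exact: (cvgMC (cvg_cr (cvgBC hqj hqi) (cvgMk hh')) (cvgVC nD hD)).
  have ht : (fun t => tb (qi t) (fi t) (qj t) (fj t)) @ F --> tb (P i) 1 (P j) 1.
    exact: (cvgMC (cvg_cr (cvgMk hh) (cvgBC hqj hqi)) (cvgVC nD hD)).
  have s1 : sb (P i) 1 (P j) 1 = 1.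
    by rewrite /sb D1 hat1 mul1r -/w wE crDl crrr addr0 divff.
  have t1 : tb (P i) 1 (P j) 1 = 1.
    by rewrite /tb D1 hat1 mul1r -/w wE crDr crrr add0r divff.
  rewrite s1 in hs; rewrite t1 in ht.
  split; [|exact: hfi|].
    apply: (cvg_eq _ (cvgDC hqi (cvgMk (k := u) (cvgMC hs hh)))).
    by rewrite hat1 !mul1r -Pxu.
  have g1 : \forall t \near F, fi t != 0 by apply: cvg_neq0 hfi.
  have g2 : \forall t \near F, fj t != 0 by apply: cvg_neq0 hfj.
  have g3 : \forall t \near F, D (fi t) (fj t) != 0 by apply: cvg_neq0 hD.
  have g4 : \forall t \near F, 0 < sb (qi t) (fi t) (qj t) (fj t).
    by apply: (real_cvg1_gt0 _ hs) => t; apply: cr_ratio_real.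
  have g5 : \forall t \near F, 0 < tb (qi t) (fi t) (qj t) (fj t).
    by apply: (real_cvg1_gt0 _ ht) => t; apply: cr_ratio_real.
  have g6 : \forall t \near F, fj t / fi t \is Num.real -> 0 < fj t / fi t.
    apply: near_real_gt0; apply: (cvg_eq _ (cvgMC hfj (cvgVC oneC hfi))).
    by rewrite divr1.
  near=> t => hF.
  have fi0 : fi t != 0 by near: t.
  have fj0 : fj t != 0 by near: t.
  have Dt : D (fi t) (fj t) != 0 by near: t.
  have st : 0 < sb (qi t) (fi t) (qj t) (fj t) by near: t.
  have tt : 0 < tb (qi t) (fi t) (qj t) (fj t) by near: t.
  have hr : 0 < fj t / fi t.
    have h6 : fj t / fi t \is Num.real -> 0 < fj t / fi t by near: t.
    by apply: h6; apply: cr0_div_real => //; rewrite crN (icr_eq0 hF) oppr0.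
  have hW : qj t - qi t = sb (qi t) (fi t) (qj t) (fj t) * (hat (fi t) * u)
      + tb (qi t) (fi t) (qj t) (fj t) * (hat (fj t) * v) by exact: cramer.
  have e1 : (xq (qi t) (fi t) (qj t) (fj t) - qi t) / (P x - P i) =
      sb (qi t) (fi t) (qj t) (fj t) * hat (fi t).
    by apply: div_scaled => //; rewrite /xq addrC addKr.
  have e2 : (qj t - xq (qi t) (fi t) (qj t) (fj t)) / (P j - P x) =
      tb (qi t) (fi t) (qj t) (fj t) * hat (fj t).
    apply: div_scaled => //; rewrite /xq opprD addrA hW -/v.
    by move: (sb _ _ _ _) (tb _ _ _ _) => s1' t1'; ring.
  rewrite /link_ok e1 e2 /frel hx hi hj /xf !hat_div //.
  have nfi : 0 < `|fi t| by rewrite normr_gt0.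
  have nfj : 0 < `|fj t| by rewrite normr_gt0.
  have e3 : tb (qi t) (fi t) (qj t) (fj t) * hat (fj t) / fi t =
      tb (qi t) (fi t) (qj t) (fj t) / `|fj t| * (fj t / fi t).
    by rewrite /hat !mulrA; congr (_ / _); rewrite mulrAC.
  rewrite e3; do ?split; do ?apply: divr_gt0 => //.
  by apply: mulr_gt0 => //; apply: divr_gt0.
- by move=> *; apply: icr_real.
- move=> T F FF qi fi qj fj li ki lj kj _ _ _ hfi _ hfj.
  exact: (cvgMC (cvg_cst _) (cvg_cr hfi hfj)).
- by move=> *; apply: rpred0.
- by move=> *; apply: rpred0.
- move=> ni ai nj aj rai raj r rr hi' hj'; rewrite /F0 !mulr0 addr0.
  have -> : 1 + r * ai = (1 + r * ai) * 1 by rewrite mulr1.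
  have -> : 1 + r * aj = (1 + r * aj) * 1 by rewrite mulr1.
  by rewrite crZl ?gtr0_real // crZr ?gtr0_real // crrr !mulr0.
by split.
Unshelve. all: by end_near.
Qed.

(** The factor of [ix] takes its modulus from the frame at [i] and, through [x], its argument from
    the frame at [j]. This places [x]; what remains is that the edge [xj] has the direction
    prescribed at [j]. *)
Lemma link_extension_DAA : x \in A -> i \notin A -> j \in A ->
  exists X : link_extension i x j, forall ni ai nj aj, ld X ni ai nj aj = 0.
Proof.
move=> hx hi hj.
pose xq (qi fi qj fj : C) : C := qi + `|fi| * hat fj * u.
pose xf (qi fi qj fj : C) : C := hat fj.
pose W qi fi qj fj : C := qj - xq qi fi qj fj.
pose F0 (qi fi qj fj : C) : C := 'i%C * cr (W qi fi qj fj) (hat fj * v).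
pose c0 (ni ai nj aj : C) : C := 'i%C * cr (nj - ni - ai * u) v.
suff X : {X : link_extension i x j | ld X = fun _ _ _ _ => 0}.
  by case: X => X eX; exists X => *; rewrite eX.
unshelve eexists; first apply: (@LinkExtension i x j xq xf F0 c0 (fun _ _ _ _ => 0)).
- move=> T F FF qi fi qj fj hqi hfi hqj hfj.
  have hh' : (fun t => hat (fj t)) @ F --> hat 1 by apply: cvg_hat.
  have hxq : (fun t => xq (qi t) (fi t) (qj t) (fj t)) @ F --> xq (P i) 1 (P j) 1.
    exact: (cvgDC hqi (cvgMk (cvgMC (cvg_normC hfi) hh'))).
  have xq1 : xq (P i) 1 (P j) 1 = P x by rewrite /xq normr1 hat1 !mul1r -Pxu.
  have hW : (fun t => W (qi t) (fi t) (qj t) (fj t)) @ F --> W (P i) 1 (P j) 1.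
    exact: (cvgBC hqj hxq).
  have W1 : W (P i) 1 (P j) 1 = v by rewrite /W xq1.
  rewrite xq1 in hxq; rewrite W1 in hW.
  split; [exact: hxq|exact: (cvg_eq hat1 hh')|].
  have g1 : \forall t \near F, fi t != 0 by apply: cvg_neq0 hfi.
  have g2 : \forall t \near F, fj t != 0 by apply: cvg_neq0 hfj.
  have g6 : \forall t \near F, W (qi t) (fi t) (qj t) (fj t) / (hat (fj t) * v) \is Num.real ->
      0 < W (qi t) (fi t) (qj t) (fj t) / (hat (fj t) * v).
    have n0 : hat 1 * v != 0 by rewrite hat1 mul1r.
    apply: near_real_gt0; apply: (cvg_eq _ (cvgMC hW (cvgVC n0 (cvgMk hh')))).
    by rewrite hat1 mul1r divff.
  near=> t => hF.
  have fi0 : fi t != 0 by near: t.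
  have fj0 : fj t != 0 by near: t.
  have n0 : hat (fj t) * v != 0 by rewrite mulf_neq0 // hat_neq0.
  pose s : C := W (qi t) (fi t) (qj t) (fj t) / (hat (fj t) * v).
  have s0 : 0 < s.
    have h6 : W (qi t) (fi t) (qj t) (fj t) / (hat (fj t) * v) \is Num.real ->
      0 < W (qi t) (fi t) (qj t) (fj t) / (hat (fj t) * v) by near: t.
    by apply: h6; apply: cr0_div_real => //; apply: icr_eq0.
  have e1 : (xq (qi t) (fi t) (qj t) (fj t) - qi t) / (P x - P i) = `|fi t| * hat (fj t).
    by apply: div_scaled => //; rewrite /xq addrC addKr.
  have e2 : (qj t - xq (qi t) (fi t) (qj t) (fj t)) / (P j - P x) = s * hat (fj t).
    apply: div_scaled => //; rewrite -/(W _ _ _ _) -mulrA -/v.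
    by rewrite /s divfK.
  rewrite /link_ok e1 e2 /frel hx (negPf hi) hj /xf !hat_div //.
  rewrite !(mulf_hatK _ fj0) (normM_hat _ fj0) normr_id.
  have nfi : 0 < `|fi t| by rewrite normr_gt0.
  have nfj : 0 < `|fj t| by rewrite normr_gt0.
  by do ?split=> //; apply: divr_gt0.
- by move=> *; apply: icr_real.
- move=> T F FF qi fi qj fj li ki lj kj k0 k0' hqi hfi hqj hfj.
  have hh' : (fun t => hat (fj t)) @ F --> hat kj by apply: cvg_hat.
  have hxq : (fun t => xq (qi t) (fi t) (qj t) (fj t)) @ F --> xq li ki lj kj.
    exact: (cvgDC hqi (cvgMk (cvgMC (cvg_normC hfi) hh'))).
  exact: (cvgMC (cvg_cst _) (cvg_cr (cvgBC hqj hxq) (cvgMk hh'))).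
- by move=> *; apply: icr_real.
- by move=> *; apply: rpred0.
- move=> ni ai nj aj rai raj r rr hi' hj'.
  rewrite /F0 /W /xq hat_pos // gtr0_norm // mulr1 mul1r mulr0 addr0 /c0.
  have -> : P j + r * nj - (P i + r * ni + (1 + r * ai) * u) =
      v + r * (nj - ni - ai * u) by rewrite /u /v; ring.
  by rewrite crDl crrr add0r crZl // mulrCA.
by [].
Unshelve. all: by end_near.
Qed.

(** The directions of both factors are known and [x] makes their moduli equal to a common [rho], so
    $q_j-q_i$ is [rho] times a known vector. The remaining condition is that [rho] is real. *)
Lemma link_extension_ADA : x \notin A -> i \in A -> j \in A ->
  exists X : link_extension i x j, forall ni ai nj aj, ld X ni ai nj aj = 0.
Proof.
move=> hx hi hj.
pose D fi fj : C := hat fi * u + hat fj * v.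
pose rho qi fi qj fj : C := (qj - qi) / D fi fj.
pose xq (qi fi qj fj : C) : C := qi + rho qi fi qj fj * hat fi * u.
pose F0 (qi fi qj fj : C) : C := 'i%C * cr (qj - qi) (D fi fj).
pose c0 (ni ai nj aj : C) : C := 'i%C * cr (nj - ni) w.
suff X : {X : link_extension i x j | ld X = fun _ _ _ _ => 0}.
  by case: X => X eX; exists X => *; rewrite eX.
have D1 : D 1 1 = w by rewrite /D hat1 !mul1r wE.
unshelve eexists; first apply: (@LinkExtension i x j xq rho F0 c0 (fun _ _ _ _ => 0)).
- move=> T F FF qi fi qj fj hqi hfi hqj hfj.
  have hh : (fun t => hat (fi t)) @ F --> hat 1 by apply: cvg_hat.
  have hh' : (fun t => hat (fj t)) @ F --> hat 1 by apply: cvg_hat.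
  have hD : (fun t => D (fi t) (fj t)) @ F --> D 1 1.
    exact: (cvgDC (cvgMk hh) (cvgMk hh')).
  have nD : D 1 1 != 0 by rewrite D1.
  have hr : (fun t => rho (qi t) (fi t) (qj t) (fj t)) @ F --> rho (P i) 1 (P j) 1.
    exact: (cvgMC (cvgBC hqj hqi) (cvgVC nD hD)).
  have r1 : rho (P i) 1 (P j) 1 = 1 by rewrite /rho D1 -/w divff.
  rewrite r1 in hr.
  split; [|exact: hr|].
    apply: (cvg_eq _ (cvgDC hqi (cvgMk (k := u) (cvgMC hr hh)))).
    by rewrite hat1 !mul1r -Pxu.
  have g1 : \forall t \near F, fi t != 0 by apply: cvg_neq0 hfi.
  have g2 : \forall t \near F, fj t != 0 by apply: cvg_neq0 hfj.
  have g3 : \forall t \near F, D (fi t) (fj t) != 0 by apply: cvg_neq0 hD.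
  have g6 : \forall t \near F, rho (qi t) (fi t) (qj t) (fj t) \is Num.real ->
      0 < rho (qi t) (fi t) (qj t) (fj t) by exact: near_real_gt0 hr.
  near=> t => hF.
  have fi0 : fi t != 0 by near: t.
  have fj0 : fj t != 0 by near: t.
  have Dt : D (fi t) (fj t) != 0 by near: t.
  have s0 : 0 < rho (qi t) (fi t) (qj t) (fj t).
    have h6 : rho (qi t) (fi t) (qj t) (fj t) \is Num.real ->
      0 < rho (qi t) (fi t) (qj t) (fj t) by near: t.
    by apply: h6; apply: cr0_div_real => //; apply: icr_eq0.
  have e1 : (xq (qi t) (fi t) (qj t) (fj t) - qi t) / (P x - P i) =
      rho (qi t) (fi t) (qj t) (fj t) * hat (fi t).
    by apply: div_scaled => //; rewrite /xq addrC addKr.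
  have e2 : (qj t - xq (qi t) (fi t) (qj t) (fj t)) / (P j - P x) =
      rho (qi t) (fi t) (qj t) (fj t) * hat (fj t).
    have hW : qj t - qi t = rho (qi t) (fi t) (qj t) (fj t) * D (fi t) (fj t).
      by rewrite /rho divfK.
    apply: div_scaled => //; rewrite /xq opprD addrA hW /D -/v; ring.
  rewrite /link_ok e1 e2 /frel (negPf hx) hi hj !hat_div //.
  rewrite !(normM_hat _ fi0) !(normM_hat _ fj0) lt0r_neq0 //.
  have nfi : 0 < `|fi t| by rewrite normr_gt0.
  have nfj : 0 < `|fj t| by rewrite normr_gt0.
  by do ?split=> //; apply: divr_gt0.
- by move=> *; apply: icr_real.
- move=> T F FF qi fi qj fj li ki lj kj k0 k0' hqi hfi hqj hfj.
  have hh : (fun t => hat (fi t)) @ F --> hat ki by apply: cvg_hat.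
  have hh' : (fun t => hat (fj t)) @ F --> hat kj by apply: cvg_hat.
  exact: (cvgMC (cvg_cst _) (cvg_cr (cvgBC hqj hqi)
    (cvgDC (cvgMk (k := u) hh) (cvgMk (k := v) hh')))).
- by move=> *; apply: icr_real.
- by move=> *; apply: rpred0.
- move=> ni ai nj aj rai raj r rr hi' hj'.
  rewrite /F0 /D !hat_pos // !mul1r mulr0 addr0 -wE /c0.
  have -> : P j + r * nj - (P i + r * ni) = w + r * (nj - ni) by rewrite /w; ring.
  by rewrite crDl crrr add0r crZl // mulrCA.
by [].
Unshelve. all: by end_near.
Qed.

(** The modulus of the frame at [j] passes through [x] to the edge [ix], whose direction is known
    from [i]. What remains is a condition on the length of [xj], which is quadratic. The vector [mu]
    is the defect of the flex from stretching the segment [ij] by the factor of [j]. *)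
Lemma link_extension_ADD : x \notin A -> i \in A -> j \notin A ->
  exists X : link_extension i x j, forall ni ai nj aj, aj \is Num.real ->
    let mu := nj - ni - aj * w in
    lc X ni ai nj aj = v * conjc mu + conjc v * mu /\ (mu = 0 -> ld X ni ai nj aj = 0).
Proof.
move=> hx hi hj.
pose xq (qi fi qj fj : C) : C := qi + `|fj| * hat fi * u.
pose xf (qi fi qj fj : C) : C := `|fj|.
pose W qi fi qj fj : C := qj - xq qi fi qj fj.
pose F0 (qi fi qj fj : C) : C := `|W qi fi qj fj| ^+ 2 - `|fj| ^+ 2 * `|v| ^+ 2.
pose mu (ni ai nj aj : C) : C := nj - ni - aj * w.
pose eta (ni ai nj aj : C) : C := nj - ni - aj * u.
pose c0 (ni ai nj aj : C) : C := v * conjc (mu ni ai nj aj) + conjc v * mu ni ai nj aj.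
pose d0 (ni ai nj aj : C) : C := `|eta ni ai nj aj| ^+ 2 - aj ^+ 2 * `|v| ^+ 2.
suff X : {X : link_extension i x j | lc X = c0 /\ ld X = d0}.
  case: X => X [ec ed]; exists X => ni ai nj aj raj; split; first by rewrite ec.
  move=> h; rewrite ed /d0 /eta.
  have -> : nj - ni - aj * u = (nj - ni - aj * w) + aj * v by rewrite wE; ring.
  by rewrite h add0r normrM exprMn real_normK // subrr.
unshelve eexists; first apply: (@LinkExtension i x j xq xf F0 c0 d0).
- move=> T F FF qi fi qj fj hqi hfi hqj hfj.
  have hh : (fun t => hat (fi t)) @ F --> hat 1 by apply: cvg_hat.
  have hxq : (fun t => xq (qi t) (fi t) (qj t) (fj t)) @ F --> xq (P i) 1 (P j) 1.
    exact: (cvgDC hqi (cvgMk (cvgMC (cvg_normC hfj) hh))).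
  have xq1 : xq (P i) 1 (P j) 1 = P x by rewrite /xq normr1 hat1 !mul1r -Pxu.
  rewrite xq1 in hxq.
  split; [exact: hxq|exact: (cvg_eq (normr1 _) (cvg_normC hfj))|].
  have g1 : \forall t \near F, fi t != 0 by apply: cvg_neq0 hfi.
  have g2 : \forall t \near F, fj t != 0 by apply: cvg_neq0 hfj.
  near=> t => hF.
  have fi0 : fi t != 0 by near: t.
  have fj0 : fj t != 0 by near: t.
  have e1 : (xq (qi t) (fi t) (qj t) (fj t) - qi t) / (P x - P i) = `|fj t| * hat (fi t).
    by apply: div_scaled => //; rewrite /xq addrC addKr.
  have e2 : `|(qj t - xq (qi t) (fi t) (qj t) (fj t)) / (P j - P x)| = `|fj t|.
    rewrite -/(W _ _ _ _) -/v normf_div; apply: (mulIf (x := `|v|)).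
      by rewrite normr_eq0.
    rewrite divfK ?normr_eq0 //; move/eqP: hF; rewrite subr_eq0 -exprMn.
    by rewrite eqrXn2 // ?mulr_ge0 // => /eqP.
  rewrite /link_ok /frel (negPf hx) hi (negPf hj) e2 e1 /xf !hat_div //.
  rewrite (normM_hat _ fi0) !normr_id normr_eq0 fj0.
  have nfi : 0 < `|fi t| by rewrite normr_gt0.
  have nfj : 0 < `|fj t| by rewrite normr_gt0.
  by do ?split=> //; apply: divr_gt0.
- by move=> *; apply: rpredB; [exact: norm_sqr_real|apply: rpredM; exact: norm_sqr_real].
- move=> T F FF qi fi qj fj li ki lj kj k0 k0' hqi hfi hqj hfj.
  have hh : (fun t => hat (fi t)) @ F --> hat ki by apply: cvg_hat.
  have hxq : (fun t => xq (qi t) (fi t) (qj t) (fj t)) @ F --> xq li ki lj kj.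
    exact: (cvgDC hqi (cvgMk (cvgMC (cvg_normC hfj) hh))).
  exact: (cvgBC (cvg_norm_sqr (cvgBC hqj hxq)) (cvgMk (cvg_norm_sqr hfj))).
- move=> ni ai nj aj _ _; apply/conjc_realP.
  by rewrite /c0 conjcD !conjcM !conjcK addrC.
- move=> ni ai nj aj _ raj; apply: rpredB; first exact: norm_sqr_real.
  by apply: rpredM; [exact: rpredX|exact: norm_sqr_real].
- move=> ni ai nj aj rai raj r rr hi' hj'.
  rewrite /F0 /W /xq hat_pos // (gtr0_norm hj') mulr1.
  have -> : P j + r * nj - (P i + r * ni + (1 + r * aj) * u) =
      v + r * eta ni ai nj aj by rewrite /eta /u /v; ring.
  rewrite /c0 /d0 !sqr_normc conjcD conjcM (conjc_realP _ rr).
  have -> : eta ni ai nj aj = mu ni ai nj aj + aj * v by rewrite /eta /mu wE; ring.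
  by rewrite conjcD conjcM (conjc_realP _ raj); ring.
by split.
Unshelve. all: by end_near.
Qed.

(** Both moduli are known and [x] gives the factors a common direction [th], which is also the frame
    of [x]. What remains is $|\mathtt{th}|=1$, a condition on the length of $q_j-q_i$. *)
Lemma link_extension_DAD : x \in A -> i \notin A -> j \notin A ->
  exists X : link_extension i x j, forall ni ai nj aj,
    ai \is Num.real -> aj \is Num.real ->
    let ka := ai * u + aj * v - (nj - ni) in
    lc X ni ai nj aj = w * conjc ka + conjc w * ka /\
    (ka = 0 -> ld X ni ai nj aj = 0).
Proof.
move=> hx hi hj.
pose D (fi fj : C) : C := `|fi| * u + `|fj| * v.
pose th qi fi qj fj : C := (qj - qi) / D fi fj.
pose xq (qi fi qj fj : C) : C := qi + `|fi| * th qi fi qj fj * u.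
pose F0 (qi fi qj fj : C) : C := `|D fi fj| ^+ 2 - `|qj - qi| ^+ 2.
pose ka (ni ai nj aj : C) : C := ai * u + aj * v - (nj - ni).
pose c0 (ni ai nj aj : C) : C := w * conjc (ka ni ai nj aj) + conjc w * ka ni ai nj aj.
pose d0 (ni ai nj aj : C) : C := `|ai * u + aj * v| ^+ 2 - `|nj - ni| ^+ 2.
suff X : {X : link_extension i x j | lc X = c0 /\ ld X = d0}.
  case: X => X [ec ed]; exists X => ni ai nj aj rai raj; split; first by rewrite ec.
  move=> /eqP; rewrite ed subr_eq0 => /eqP h.
  by rewrite /d0 h subrr.
have D1 : D 1 1 = w by rewrite /D normr1 !mul1r wE.
unshelve eexists; first apply: (@LinkExtension i x j xq th F0 c0 d0).
- move=> T F FF qi fi qj fj hqi hfi hqj hfj.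
  have hD : (fun t => D (fi t) (fj t)) @ F --> D 1 1.
    exact: (cvgDC (cvgMk (cvg_normC hfi)) (cvgMk (cvg_normC hfj))).
  have nD : D 1 1 != 0 by rewrite D1.
  have hr : (fun t => th (qi t) (fi t) (qj t) (fj t)) @ F --> th (P i) 1 (P j) 1.
    exact: (cvgMC (cvgBC hqj hqi) (cvgVC nD hD)).
  have r1 : th (P i) 1 (P j) 1 = 1 by rewrite /th D1 -/w divff.
  rewrite r1 in hr.
  split; [|exact: hr|].
    apply: (cvg_eq _ (cvgDC hqi (cvgMk (k := u) (cvgMC (cvg_normC hfi) hr)))).
    by rewrite normr1 !mul1r -Pxu.
  have g1 : \forall t \near F, fi t != 0 by apply: cvg_neq0 hfi.
  have g2 : \forall t \near F, fj t != 0 by apply: cvg_neq0 hfj.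
  have g3 : \forall t \near F, D (fi t) (fj t) != 0 by apply: cvg_neq0 hD.
  near=> t => hF.
  have fi0 : fi t != 0 by near: t.
  have fj0 : fj t != 0 by near: t.
  have Dt : D (fi t) (fj t) != 0 by near: t.
  have th1 : `|th (qi t) (fi t) (qj t) (fj t)| = 1.
    have nD' : `|D (fi t) (fj t)| != 0 by rewrite normr_eq0.
    rewrite normf_div; apply: (mulIf nD'); rewrite divfK // mul1r.
    by move/eqP: hF; rewrite subr_eq0 eqrXn2 // => /eqP.
  have th0 : th (qi t) (fi t) (qj t) (fj t) != 0 by rewrite -normr_eq0 th1 oner_eq0.
  have e1 : (xq (qi t) (fi t) (qj t) (fj t) - qi t) / (P x - P i) =
      `|fi t| * th (qi t) (fi t) (qj t) (fj t).
    by apply: div_scaled => //; rewrite /xq addrC addKr.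
  have e2 : (qj t - xq (qi t) (fi t) (qj t) (fj t)) / (P j - P x) =
      `|fj t| * th (qi t) (fi t) (qj t) (fj t).
    have hW : qj t - qi t = th (qi t) (fi t) (qj t) (fj t) * D (fi t) (fj t).
      by rewrite /th divfK.
    apply: div_scaled => //; rewrite /xq opprD addrA hW /D -/v; ring.
  rewrite /link_ok /frel hx (negPf hi) (negPf hj) e2 e1 !mulfK //.
  have nth (k : C) : `|k * th (qi t) (fi t) (qj t) (fj t)| = `|k|.
    by rewrite normrM th1 mulr1.
  rewrite !nth !normr_id.
  have nfi : 0 < `|fi t| by rewrite normr_gt0.
  have nfj : 0 < `|fj t| by rewrite normr_gt0.
  by do ?split=> //.
- by move=> *; apply: rpredB; exact: norm_sqr_real.
- move=> T F FF qi fi qj fj li ki lj kj k0 k0' hqi hfi hqj hfj.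
  exact: (cvgBC (cvg_norm_sqr (cvgDC (cvgMk (cvg_normC hfi))
    (cvgMk (cvg_normC hfj)))) (cvg_norm_sqr (cvgBC hqj hqi))).
- move=> ni ai nj aj _ _; apply/conjc_realP.
  by rewrite /c0 conjcD !conjcM !conjcK addrC.
- by move=> *; apply: rpredB; exact: norm_sqr_real.
- move=> ni ai nj aj rai raj r rr hi' hj'.
  rewrite /F0 /D (gtr0_norm hi') (gtr0_norm hj').
  have -> : (1 + r * ai) * u + (1 + r * aj) * v = w + r * (ai * u + aj * v).
    by rewrite wE; ring.
  have -> : P j + r * nj - (P i + r * ni) = w + r * (nj - ni) by rewrite /w; ring.
  rewrite /c0 /d0 /ka !sqr_normc; move: (ai * u + aj * v) (nj - ni) => k dl.
  by rewrite conjcB !conjcD !conjcM (conjc_realP _ rr); ring.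
by split.
Unshelve. all: by end_near.
Qed.

End Types.
End LinkExtension.

(** * Solving the equation of a one-vertex addition on a loop *)

Section LinkStep.
Variables (R : realType) (n : nat) (A : {set 'I_n}) (P : 'I_n -> R[i]).
Hypothesis P_inj : injective P.
Local Notation C := R[i].
Implicit Types (E : {set {set 'I_n}}) (N : nat).
Implicit Types (u v : 'I_n) (r phi : R).

Lemma loop_at_right (T : Type) (G : R * R -> T) (FT : set_system T) (phi : R -> R) :
  G @ @uniform_at_right R --> FT -> (fun r => G (r, phi r)) @ (0 : R)^'+ --> FT.
Proof.
move=> h S hS; have h1 : \forall r \near (0 : R)^'+, forall psi, S (G (r, psi)).
  exact: (h S hS).
have : \forall r \near (0 : R)^'+, S (G (r, phi r)) by apply: filterS h1 => r; apply.
exact.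
Qed.

Lemma min_max_sign (a b : R) : a * b < 0 -> Order.min a b <= 0 <= Order.max a b.
Proof.
rewrite ge_min le_max; case: (ltgtP a 0) => ha /=; last by rewrite ha mul0r ltxx.
  by rewrite nmulr_rlt0 // => /ltW ->.
by rewrite pmulr_rlt0 // => /ltW ->.
Qed.

Section Link.
Variables (i x j : 'I_n) (X : link_extension A P i x j).
Variables (E : {set {set 'I_n}}) (N : nat).
Hypotheses (hE : below E N) (hi : (i < N)%N) (hj : (j < N)%N) (hx : x = N :> nat).

Definition link_edges : {set {set 'I_n}} := [set [set i; x]; [set x; j]]%SET.

Lemma nearby_link (q f : R -> 'I_n -> C) :
  tends_to_base P (0 : R)^'+ q f ->
  (\forall r \near (0 : R)^'+, moves A P E N (q r) (f r)) ->
  (\forall r \near (0 : R)^'+, lF X (q r i) (f r i) (q r j) (f r j) = 0) ->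
  nearby_flex A P (E :|: link_edges) N.+1.
Proof.
move=> ht hm hF.
pose q' r := upd (q r) x (linkx X (q r i) (f r i) (q r j) (f r j)).
pose f' r := upd (f r) x (linkf X (q r i) (f r i) (q r j) (f r j)).
have [hqi hfi] := ht i; have [hqj hfj] := ht j.
have [h1 h2 h3] := link_cvg X (F := (0 : R)^'+) _ hqi hfi hqj hfj.
have nx v : (v < N)%N -> v != x by move=> hv; apply: contraTneq hv => ->; rewrite hx ltnn.
exists q', f'; split.
  move=> v; rewrite /q' /f' /upd; case: eqVneq => [->|_]; last exact: ht.
  by split; [exact: h1|exact: h2].
apply: filterS3 h3 hm hF => r h3 [hm1 hm2] hF.
have e v : (v < N)%N -> q r v = q' r v /\ f r v = f' r v.
  by move=> hv; rewrite /q' /f' !upd_neq ?nx.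
split; last by move=> h; apply: hm2; apply: similar_below_ext e h.
apply: edges_satisfyU.
  exact: (edges_satisfy_ext (S := fun v : 'I_n => (v < N)%N) hE e hm1).
have [[g1 g2] [g3 g4]] := h3 hF.
have [ei ei'] := e i hi; have [ej ej'] := e j hj.
by apply: edges_satisfyU; apply: edges_satisfy1;
  rewrite /edge_factor -?ei -?ei' -?ej -?ej' /q' /f' !updE.
Qed.

Lemma lF_zero (f : C) : f \is Num.real -> complex.Re f = 0 -> f = 0.
Proof. by move=> hr h; rewrite -(RRe_real hr) h. Qed.

Lemma real_complexRe (a : C) : a \is Num.real -> a = (complex.Re a)%:C%C.
Proof. by move=> h; rewrite (RRe_real h). Qed.

Lemma nearby_link_ivt nu al : flex_path A P E N nu al ->
  lc X (nu i) (al i) (nu j) (al j) != 0 ->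
  nearby_flex A P (E :|: link_edges) N.+1.
Proof.
move=> [[hal _] [q [f [h1 h2 h3 h4]]]].
set c := lc _ _ _ _ _ => c0; set d := ld X (nu i) (al i) (nu j) (al j).
have rc : c \is Num.real by apply: lc_real.
have rd : d \is Num.real by apply: ld_real.
pose G r phi : R := complex.Re (lF X (q (r, phi) i) (f (r, phi) i)
   (q (r, phi) j) (f (r, phi) j)).
pose cr' := complex.Re c; pose dr := complex.Re d.
have cr0 : cr' != 0.
  by apply: contraNneq c0 => e; apply/eqP/lF_zero.
have hfn : \forall r \near (0 : R)^'+, forall phi, f (r, phi) i != 0 /\ f (r, phi) j != 0.
  have [_ hfi] := h1 i; have [_ hfj] := h1 j.
  have g1 := cvg_neq0 (oner_neq0 _) hfi; have g2 := cvg_neq0 (oner_neq0 _) hfj.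
  have g1' : \forall r \near (0 : R)^'+, forall phi, f (r, phi) i != 0 by exact: g1.
  have g2' : \forall r \near (0 : R)^'+, forall phi, f (r, phi) j != 0 by exact: g2.
  by apply: filterS2 g1' g2' => r g1' g2' phi; split.
have hcont : \forall r \near (0 : R)^'+, continuous (G r).
  apply: filterS2 h3 hfn => r h3 hfn phi; apply: cvg_Re.
  have [n1 n2] := hfn phi; have [a1 a2] := h3 phi i; have [a3 a4] := h3 phi j.
  exact: lF_cvg n1 n2 a1 a2 a3 a4.
have hpar (s : R) : 0 < 1 + s%:C%C * al i -> 0 < 1 + s%:C%C * al j ->
    complex.Re (lF X (P i + s%:C%C * nu i) (1 + s%:C%C * al i)
      (P j + s%:C%C * nu j) (1 + s%:C%C * al j)) = s * (cr' + s * dr).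
  move=> p1 p2; rewrite lF_parallel ?hal //; last by apply/complex_realP; exists s.
  rewrite -/c -/d (real_complexRe rc) (real_complexRe rd) -rmorphXn -!rmorphM -rmorphD /=.
  by rewrite -/cr' -/dr; ring.
have hends : \forall r \near (0 : R)^'+, G r 0 * G r pi < 0.
  (* The bound gives $r|d|<|c|$, so that the linear term decides the signs at [r] and at [- r]; the
     [+ 1] covers $d=0$. *)
  have hsmall : \forall r \near (0 : R)^'+, r < `|cr'| / (`|dr| + 1).
    by apply: nbhs_right_lt; rewrite divr_gt0 ?normr_gt0 // ltr_wpDl.
  have hpos : \forall r \near (0 : R)^'+, 0 < r by apply: nbhs_right_gt.
  have hp : \forall r \near (0 : R)^'+, 0 < r /\ r < `|cr'| / (`|dr| + 1).
    by apply: filterS2 hpos hsmall => r; split.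
  have ai := affine_gt0_near (hal i); have aj := affine_gt0_near (hal j).
  have aij : \forall r \near (0 : R)^'+,
     (0 < 1 + r%:C%C * al i /\ 0 < 1 + (- r)%:C%C * al i) /\
     (0 < 1 + r%:C%C * al j /\ 0 < 1 + (- r)%:C%C * al j).
    by apply: filterS2 ai aj => r; split.
  apply: filterS3 h4 hp aij => r h4 [r0 rs] [[p1 p2] [p3 p4]].
  have [a1 a2 a3 a4] := h4 i hi; have [b1 b2 b3 b4] := h4 j hj.
  rewrite /G a1 a2 a3 a4 b1 b2 b3 b4 !hpar //.
  have -> : r * (cr' + r * dr) * (- r * (cr' + - r * dr)) =
      - (r ^+ 2 * (cr' ^+ 2 - (r * dr) ^+ 2)) by ring.
  rewrite oppr_lt0 mulr_gt0 ?exprn_gt0 // subr_gt0 -(real_normK (num_real cr')).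
  rewrite -(real_normK (num_real (r * dr))) ltrXn2r //.
  rewrite normrM (gtr0_norm r0).
  have d1 : 0 < `|dr| + 1 by rewrite ltr_wpDl.
  move: rs; rewrite ltr_pdivlMr // mulrDr mulr1; apply: le_lt_trans.
  by rewrite lerDl ltW.
have hzero : \forall r \near (0 : R)^'+, exists phi, G r phi = 0.
  apply: filterS2 hcont hends => r hc he.
  have hw : {within `[0, pi], continuous (G r)}.
    by apply: continuous_subspaceT => phi; apply: hc.
  have hp0 : (0 : R) <= pi by apply: pi_ge0.
  have hmm : Order.min (G r 0) (G r pi) <= 0 <= Order.max (G r 0) (G r pi).
    exact: min_max_sign.
  by have [phi _ e] := IVT hp0 hw hmm; exists phi.
(* An angle is chosen for each [r] separately; the chosen states still tend to the base because the
   loops shrink uniformly in the angle. *)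
have [phi hphi] : {phi : R -> R | forall r, (exists psi, G r psi = 0) -> G r (phi r) = 0}.
  exists (fun s : R => if pselect (exists psi, G s psi = 0) is left e
    then projT1 (cid e) else 0) => s e.
  by case: pselect => // e'; case: (cid e').
apply: (@nearby_link (fun r => q (r, phi r)) (fun r => f (r, phi r))).
- move=> v; have [hq hf] := h1 v; split.
    exact: (@loop_at_right _ (fun t => q t v) _ phi hq).
  exact: (@loop_at_right _ (fun t => f t v) _ phi hf).
- by apply: filterS h2 => r; apply.
by apply: filterS hzero => r /hphi; apply: lF_zero; apply: lF_real.
Qed.

Lemma nearby_link_flat nu al : flex_path A P E N nu al ->
  lc X (nu i) (al i) (nu j) (al j) = 0 -> ld X (nu i) (al i) (nu j) (al j) = 0 ->
  nearby_flex A P (E :|: link_edges) N.+1.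
Proof.
move=> [[hal _] [q [f [h1 h2 h3 h4]]]] c0 d0.
apply: (@nearby_link (fun r => q (r, 0)) (fun r => f (r, 0))).
- move=> v; have [hq hf] := h1 v; split.
    exact: (@loop_at_right _ (fun t => q t v) _ (fun=> 0) hq).
  exact: (@loop_at_right _ (fun t => f t v) _ (fun=> 0) hf).
- by apply: filterS h2 => r; apply.
apply: filterS3 h4 (affine_gt0_near (hal i)) (affine_gt0_near (hal j)).
move=> r h4 [p1 _] [p2 _]; have [-> -> _ _] := h4 i hi; have [-> -> _ _] := h4 j hj.
rewrite lF_parallel ?hal //; last by apply/complex_realP; exists r.
by rewrite c0 d0 !mulr0 addr0.
Qed.

End Link.

End LinkStep.

(** * Parallel flexes in real coordinates *)

Section FlexCoordinates.
Variables (R : realType) (n : nat) (A : {set 'I_n}) (p : 'M[R]_(n, 2)).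
Hypothesis hinj : injective (fun i : 'I_n => row i p).
Local Notation C := R[i].
Local Notation P := (positions p).
Implicit Types (X : 'M[R]_(n, 3)) (E : {set {set 'I_n}}).

Definition nu_of X v : C := Complex (X v c1) (X v c2).
Definition al_of X v : C := (X v c3)%:C%C.

Definition coords (nu al : 'I_n -> C) : 'M[R]_(n, 3) :=
  \matrix_(v, k) if k == c1 then complex.Re (nu v)
    else if k == c2 then complex.Im (nu v) else complex.Re (al v).

Lemma nu_of_coords nu al v : nu_of (coords nu al) v = nu v.
Proof. by rewrite /nu_of !mxE /=; case: (nu v). Qed.

Lemma al_of_coords nu al v : al v \is Num.real -> al_of (coords nu al) v = al v.
Proof. by move=> h; rewrite /al_of !mxE /= RRe_real. Qed.

Lemma positionsE v : P v = Complex (p v 0) (p v 1).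
Proof. by rewrite /positions /toC !mxE. Qed.

Lemma real_divP (a b : C) : b != 0 ->
  (a / b \is Num.real) =
  (complex.Re a * complex.Im b - complex.Im a * complex.Re b == 0).
Proof.
move=> b0; have e : cr b a = Complex 0 (2 * (complex.Re a * complex.Im b
    - complex.Im a * complex.Re b)).
  case: a b {b0} => a1 a2 [b1 b2]; rewrite /cr /=; simpc.
  by apply/eqP; rewrite eq_complex /=; apply/andP; split; apply/eqP; ring.
apply/idP/eqP => [h|h].
  have : cr b a = 0 by rewrite -[a](divfK b0) crZr // crrr mulr0.
  rewrite e => -[] /eqP; rewrite mulf_eq0 pnatr_eq0 /= => /eqP.
  exact.
by apply: cr0_div_real => //; rewrite crN e h mulr0 oppr0.
Qed.

Lemma flex_eqsP E X : flex_eqs A E p X <-> parallel_flex A P E (nu_of X) (al_of X).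
Proof.
have hP u v : u != v -> P v - P u != 0.
  by move=> uv; rewrite subP_neq0 //; [exact: positions_inj|rewrite eq_sym].
split=> [h|[_ h] u v k].
  split; first by move=> v; apply/complex_realP; eexists.
  move=> u v uv he; have h1 := h u v c1; have h2 := h u v c2; have h3 := h u v c3.
  rewrite /flex_form uv he /= in h1 h2 h3; split.
    by rewrite real_divP ?hP // !positionsE /= h1.
  move=> hu; rewrite (negPf hu) in h2 h3.
  apply: div_scaled; first exact: hP.
  rewrite !positionsE /nu_of /al_of; apply/eqP; rewrite eq_complex /=.
  move/eqP: h2; rewrite subr_eq0 => /eqP h2; move/eqP: h3; rewrite subr_eq0 => /eqP h3.
  by apply/andP; split; apply/eqP; rewrite ?h2 ?h3; ring.
rewrite /flex_form; case: ifP => // /andP[uv he].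
have [h1 h2] := h u v uv he.
case: ifP => _.
  by move: h1; rewrite real_divP ?hP // !positionsE /= => /eqP.
case: ifPn => // hu; have e := h2 hu.
have {}e : nu_of X v - nu_of X u = al_of X u * (P v - P u).
  by rewrite -e /edge_factor divfK // hP.
move: e; rewrite !positionsE /nu_of /al_of => -[e1 e2].
case: ifP => _; first by rewrite e1; ring.
by rewrite e2; ring.
Qed.

Lemma flex_eqs_coords E nu al : parallel_flex A P E nu al ->
  flex_eqs A E p (coords nu al).
Proof.
move=> [h1 h2]; apply/flex_eqsP; split.
  by move=> v; apply/complex_realP; eexists.
move=> u v uv he; rewrite /edge_factor !nu_of_coords al_of_coords //.
exact: h2.
Qed.

End FlexCoordinates.

(** * Flexes on which the linear term does not vanish *)

Section GenericFlexes.
Variables (R : realType) (n : nat) (A : {set 'I_n}) (p : 'M[R]_(n, 2)).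
Hypothesis hinj : injective (fun i : 'I_n => row i p).
Hypothesis hgen : generic p.
Local Notation C := R[i].
Local Notation P := (positions p).
Local Notation MP := (mpoly (n * 2) int).
Variables (N : nat) (E : {set {set 'I_n}}) (i x j : 'I_n).
Hypotheses (hE : below E N) (hi : (i < N)%N) (hj : (j < N)%N) (hx : x = N :> nat).
Hypothesis ij : i != j.
Let u : C := P x - P i.
Let v : C := P j - P x.
Let w : C := P j - P i.

Let nx (y : 'I_n) : (y < N)%N -> y != x.
Proof. by move=> hy; apply: contraTneq hy => ->; rewrite hx ltnn. Qed.

(** The inner product of [v] with $\nu_j-\nu_i-\alpha_jw$, that is, half of the linear coefficient
    of type ADD. *)
Definition formADD (S : comNzRingType) (q : 'M[S]_(n, 2)) (X : 'M[S]_(n, 3)) : S :=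
  (q j 0 - q x 0) * (X j c1 - X i c1 - X j c3 * (q j 0 - q i 0)) +
  (q j 1 - q x 1) * (X j c2 - X i c2 - X j c3 * (q j 1 - q i 1)).

(** The inner product of [w] with $\alpha_iu+\alpha_jv-(\nu_j-\nu_i)$, that is, half of the linear
    coefficient of type DAD. *)
Definition formDAD (S : comNzRingType) (q : 'M[S]_(n, 2)) (X : 'M[S]_(n, 3)) : S :=
  (q j 0 - q i 0) * (X i c3 * (q x 0 - q i 0) + X j c3 * (q j 0 - q x 0)
     - (X j c1 - X i c1)) +
  (q j 1 - q i 1) * (X i c3 * (q x 1 - q i 1) + X j c3 * (q j 1 - q x 1)
     - (X j c2 - X i c2)).

(** The edges of [E] contain only old vertices, so [x] may be put anywhere while the others undergo
    a linear map. *)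
Let put_x (a b : R) (T1 T2 T3 T4 : R) : 'M[R]_(n, 2) :=
  \matrix_(y, k) if y == x then (if k == 0 then a else b)
    else if k == 0 then T1 * p y 0 + T2 * p y 1 else T3 * p y 0 + T4 * p y 1.

Lemma map_formADD (S S' : comNzRingType) (phi : {rmorphism S -> S'}) q X :
  phi (formADD q X) = formADD (map_mx phi q) (map_mx phi X).
Proof. by rewrite /formADD rmorphD !rmorphM !rmorphB !rmorphM !rmorphB !mxE. Qed.

Lemma map_formDAD (S S' : comNzRingType) (phi : {rmorphism S -> S'}) q X :
  phi (formDAD q X) = formDAD (map_mx phi q) (map_mx phi X).
Proof.
by rewrite /formDAD rmorphD !rmorphM !rmorphB !rmorphD !rmorphM !rmorphB !mxE.
Qed.

Lemma formADD_linear (q : 'M[R]_(n, 2)) k X Y :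
  formADD q (k *: X + Y) = k * formADD q X + formADD q Y.
Proof. by rewrite /formADD !mxE; ring. Qed.

Lemma formDAD_linear (q : 'M[R]_(n, 2)) k X Y :
  formDAD q (k *: X + Y) = k * formDAD q X + formDAD q Y.
Proof. by rewrite /formDAD !mxE; ring. Qed.

Lemma transferADD (a b c d s t : R) X : a * d - b * c != 0 ->
  (forall Y, flex_eqs A E p Y -> formADD p Y = 0) -> flex_eqs A E p X ->
  formADD (put_x s t a b c d) (plane_map a b c d X) = 0.
Proof.
move=> hdet hall hX.
apply: (@flex_transfer R n A N E p (put_x s t a b c d) a b c d
  (@formADD MP (generic_point n)) (@formADD R)) => //.
- by move=> q Y; rewrite (map_formADD (ev q)) ev_generic_point.
- by move=> q k Y Z; apply: formADD_linear.
by move=> y /nx hy; rewrite !mxE (negPf hy).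
Qed.

Lemma transferDAD (a b c d s t : R) X : a * d - b * c != 0 ->
  (forall Y, flex_eqs A E p Y -> formDAD p Y = 0) -> flex_eqs A E p X ->
  formDAD (put_x s t a b c d) (plane_map a b c d X) = 0.
Proof.
move=> hdet hall hX.
apply: (@flex_transfer R n A N E p (put_x s t a b c d) a b c d
  (@formDAD MP (generic_point n)) (@formDAD R)) => //.
- by move=> q Y; rewrite (map_formDAD (ev q)) ev_generic_point.
- by move=> q k Y Z; apply: formDAD_linear.
by move=> y /nx hy; rewrite !mxE (negPf hy).
Qed.

Lemma plane_mapE (a b c d : R) (X : 'M[R]_(n, 3)) (y : 'I_n) :
  [/\ plane_map a b c d X y c1 = a * X y c1 + b * X y c2,
      plane_map a b c d X y c2 = c * X y c1 + d * X y c2 &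
      plane_map a b c d X y c3 = X y c3].
Proof. by rewrite !mxE. Qed.

Lemma put_xE (s t a b c d : R) : 
  [/\ put_x s t a b c d x 0 = s, put_x s t a b c d x 1 = t &
   forall y : 'I_n, (y < N)%N -> put_x s t a b c d y 0 = a * p y 0 + b * p y 1 /\
     put_x s t a b c d y 1 = c * p y 0 + d * p y 1].
Proof.
rewrite !mxE eqxx; split=> // y /nx hy.
by rewrite !mxE (negPf hy).
Qed.

Lemma sqr_sum_eq0 (a b : R) : a ^+ 2 + b ^+ 2 = 0 -> a = 0 /\ b = 0.
Proof.
move=> /eqP; rewrite paddr_eq0 ?sqr_ge0 // !sqrf_eq0 => /andP[/eqP -> /eqP ->].
by [].
Qed.

(** If the coefficient vanished on all flexes, it would still do so with [x] moved to $p_j-\mu$.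
    There $v=\mu$, and the inner product is $|\mu|^2$. *)
Lemma generic_ADD nu al : parallel_flex A P E nu al ->
  nu j - nu i - al j * w != 0 ->
  exists nu' al', parallel_flex A P E nu' al' /\
    let mu := nu' j - nu' i - al' j * w in v * conjc mu + conjc v * mu != 0.
Proof.
move=> hL hmu; apply: contrapT => hno.
have hall X : flex_eqs A E p X -> formADD p X = 0.
  move=> /(flex_eqsP A hinj) hX; apply: contrapT => /eqP h; apply: hno.
  exists (nu_of X), (al_of X); split=> //=.
  have -> : v * conjc (nu_of X j - nu_of X i - al_of X j * w) +
      conjc v * (nu_of X j - nu_of X i - al_of X j * w) = (2 * formADD p X)%:C%C.
    rewrite /v /w !positionsE /formADD /nu_of /al_of /=; simpc.
    by apply/eqP; rewrite eq_complex /=; apply/andP; split; apply/eqP; ring.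
  by rewrite eq_complex /= eqxx andbT mulf_neq0 // pnatr_eq0.
pose X := coords nu al; have hX : flex_eqs A E p X by apply: flex_eqs_coords.
have hdet : (1 : R) * 1 - 0 * 0 != 0 by rewrite mulr1 mulr0 subr0 oner_neq0.
pose mu1 := X j c1 - X i c1 - X j c3 * (p j 0 - p i 0).
pose mu2 := X j c2 - X i c2 - X j c3 * (p j 1 - p i 1).
have h := transferADD (p j 0 - mu1) (p j 1 - mu2) hdet hall hX.
have [e5 e6 e] := put_xE (p j 0 - mu1) (p j 1 - mu2) 1 0 0 1.
have [e1 e2] := e i hi; have [e3 e4] := e j hj.
have [a1 a2 a3] := plane_mapE 1 0 0 1 X i; have [b1 b2 b3] := plane_mapE 1 0 0 1 X j.
rewrite /formADD e1 e2 e3 e4 e5 e6 a1 a2 b1 b2 b3 in h.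
have [m1 m2] : mu1 = 0 /\ mu2 = 0.
  by apply: sqr_sum_eq0; rewrite -[RHS]h /mu1 /mu2; ring.
move/eqP: hmu; apply.
rewrite -(nu_of_coords nu al j) -(nu_of_coords nu al i) -(al_of_coords nu (hL.1 j)).
rewrite /w !positionsE /nu_of /al_of -/X; apply/eqP; rewrite eq_complex /=.
by apply/andP; split; apply/eqP; [rewrite -[RHS]m1 /mu1|rewrite -[RHS]m2 /mu2]; ring.
Qed.

(** Suppose the coefficient vanishes on all flexes. Putting [x] at $p_i$ and at $p_j$ gives
    $\alpha_i=\alpha_j$, so that $\kappa=\alpha_jw-(\nu_j-\nu_i)$ no longer depends on [x] and is
    orthogonal to [w]. The linear map $1+w\kappa^\top/|\kappa|^2$ fixes [w] and sends $\kappa$ to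
    $\kappa+w$; orthogonality after this map would give $|w|^2=0$. *)
Lemma generic_DAD nu al : parallel_flex A P E nu al ->
  al i * u + al j * v - (nu j - nu i) != 0 ->
  exists nu' al', parallel_flex A P E nu' al' /\
    let ka := al' i * u + al' j * v - (nu' j - nu' i) in
    w * conjc ka + conjc w * ka != 0.
Proof.
move=> hL hka; apply: contrapT => hno.
have hall X : flex_eqs A E p X -> formDAD p X = 0.
  move=> /(flex_eqsP A hinj) hX; apply: contrapT => /eqP h; apply: hno.
  exists (nu_of X), (al_of X); split=> //=.
  have -> : w * conjc (al_of X i * u + al_of X j * v - (nu_of X j - nu_of X i)) +
      conjc w * (al_of X i * u + al_of X j * v - (nu_of X j - nu_of X i)) =
      (2 * formDAD p X)%:C%C.
    rewrite /u /v /w !positionsE /formDAD /nu_of /al_of /=; simpc.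
    by apply/eqP; rewrite eq_complex /=; apply/andP; split; apply/eqP; ring.
  by rewrite eq_complex /= eqxx andbT mulf_neq0 // pnatr_eq0.
pose X := coords nu al; have hX : flex_eqs A E p X by apply: flex_eqs_coords.
have hdet : (1 : R) * 1 - 0 * 0 != 0 by rewrite mulr1 mulr0 subr0 oner_neq0.
pose w1 := p j 0 - p i 0; pose w2 := p j 1 - p i 1.
pose d1 := X j c1 - X i c1; pose d2 := X j c2 - X i c2.
pose ai := X i c3; pose aj := X j c3.
have w0 : w1 ^+ 2 + w2 ^+ 2 != 0.
  have : w != 0 by rewrite subP_neq0 //; [exact: positions_inj|rewrite eq_sym].
  apply: contraNneq => /sqr_sum_eq0 [m1 m2].
  by rewrite /w !positionsE eq_complex /= -/w1 -/w2 m1 m2 eqxx.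
have key (s t a b c d : R) : a * d - b * c != 0 ->
    (a * w1 + b * w2) * (ai * (s - (a * p i 0 + b * p i 1))
      + aj * (a * p j 0 + b * p j 1 - s) - (a * d1 + b * d2)) +
    (c * w1 + d * w2) * (ai * (t - (c * p i 0 + d * p i 1))
      + aj * (c * p j 0 + d * p j 1 - t) - (c * d1 + d * d2)) = 0.
  move=> hd; have h := transferDAD s t hd hall hX.
  have [e5 e6 e] := put_xE s t a b c d.
  have [e1 e2] := e i hi; have [e3 e4] := e j hj.
  have [a1 a2 a3] := plane_mapE a b c d X i; have [b1 b2 b3] := plane_mapE a b c d X j.
  rewrite /formDAD e1 e2 e3 e4 e5 e6 a1 a2 a3 b1 b2 b3 in h.
  by rewrite -[RHS]h /w1 /w2 /ai /aj /d1 /d2; ring.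
have k1 := key (p i 0) (p i 1) _ _ _ _ hdet.
have k2 := key (p j 0) (p j 1) _ _ _ _ hdet.
have eij : ai = aj.
  apply: (mulIf w0).
  transitivity (w1 * d1 + w2 * d2); last first.
    by rewrite -[LHS]addr0 -[X in _ + X = _]k1 /w1 /w2; ring.
  by rewrite -[RHS]addr0 -[X in _ = _ + X]k2 /w1 /w2; ring.
pose ka1 := aj * w1 - d1; pose ka2 := aj * w2 - d2.
have k3 : w1 * ka1 + w2 * ka2 = 0.
  by rewrite -[RHS]k1 /ka1 /ka2 /w1 /w2; ring.
have ka0 : ka1 ^+ 2 + ka2 ^+ 2 != 0.
  apply: contraNneq hka => /sqr_sum_eq0 [m1 m2].
  have ei : ai = complex.Re (al i) by rewrite /ai /X !mxE.
  have ej : aj = complex.Re (al j) by rewrite /aj /X !mxE.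
  rewrite -(nu_of_coords nu al j) -(nu_of_coords nu al i).
  rewrite -(al_of_coords nu (hL.1 j)) -(al_of_coords nu (hL.1 i)).
  rewrite /u /v !positionsE /nu_of /al_of -/X -/ai -/aj eij eq_complex /=.
  by apply/andP; split; apply/eqP; [rewrite -[RHS]m1 /ka1 /w1 /d1|
    rewrite -[RHS]m2 /ka2 /w2 /d2]; ring.
(* The shear along [w] which moves the flex out of the relation found above. *)
pose K := ka1 ^+ 2 + ka2 ^+ 2.
pose a := 1 + w1 * ka1 / K; pose b := w1 * ka2 / K.
pose c := w2 * ka1 / K; pose d := 1 + w2 * ka2 / K.
have dE : a * d - b * c = 1.
  have -> : a * d - b * c = 1 + (w1 * ka1 + w2 * ka2) / K.
    by rewrite /a /b /c /d; field; exact: ka0.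
  by rewrite k3 mul0r addr0.
have hd : a * d - b * c != 0 by rewrite dE oner_neq0.
have k4 := key (a * p i 0 + b * p i 1) (c * p i 0 + d * p i 1) _ _ _ _ hd.
have s1 : a * w1 + b * w2 = w1.
  have -> : a * w1 + b * w2 = w1 + w1 * (w1 * ka1 + w2 * ka2) / K.
    by rewrite /a /b; field; exact: ka0.
  by rewrite k3 mulr0 mul0r addr0.
have s2 : c * w1 + d * w2 = w2.
  have -> : c * w1 + d * w2 = w2 + w2 * (w1 * ka1 + w2 * ka2) / K.
    by rewrite /c /d; field; exact: ka0.
  by rewrite k3 mulr0 mul0r addr0.
have t1 : a * ka1 + b * ka2 = ka1 + w1.
  by rewrite /a /b -[w1 in RHS](mulfK ka0) /K; field; exact: ka0.
have t2 : c * ka1 + d * ka2 = ka2 + w2.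
  by rewrite /c /d -[w2 in RHS](mulfK ka0) /K; field; exact: ka0.
move/eqP: w0; apply.
have : (a * w1 + b * w2) * (a * ka1 + b * ka2) + (c * w1 + d * w2) * (c * ka1 + d * ka2) = 0.
  by rewrite -[RHS]k4 eij /ka1 /ka2 /w1 /w2; ring.
rewrite s1 s2 t1 t2 => e.
by rewrite -[RHS](subrr 0) -{1}e -k3; ring.
Qed.

End GenericFlexes.

(** * Loops spanned by two parallel flexes *)

Section LinearPaths.
Variables (R : realType) (n : nat) (A : {set 'I_n}) (P : 'I_n -> R[i]).
Hypothesis P_inj : injective P.
Local Notation C := R[i].
Implicit Types (E : {set {set 'I_n}}) (N : nat) (t : R * R) (r phi : R).

Definition ellipse (b k1 k0 : C) t : C :=
  b + (aff k1 cos t - 1) + (aff k0 sin t - 1).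

Lemma ellipseE b k1 k0 t :
  ellipse b k1 k0 t = b + (t.1 * cos t.2)%:C%C * k1 + (t.1 * sin t.2)%:C%C * k0.
Proof. by rewrite /ellipse /aff ![1 + _]addrC !addrK. Qed.

Lemma ellipse_tends b k1 k0 : ellipse b k1 k0 @ @uniform_at_right R --> b.
Proof.
have h1 := aff_tends k1 (@abs_cos_le1 R); have h2 := aff_tends k0 (@abs_sin_le1 R).
have e : b = b + (1 - 1) + (1 - 1) by rewrite subrr !addr0.
rewrite [X in _ --> X]e.
apply: cvgDC; last by apply: cvgBC; [exact: h2|exact: cvg_cst].
apply: cvgDC; first exact: cvg_cst.
by apply: cvgBC; [exact: h1|exact: cvg_cst].
Qed.

Lemma ellipse_cont b k1 k0 r phi :
  (fun psi => ellipse b k1 k0 (r, psi)) @ phi --> ellipse b k1 k0 (r, phi).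
Proof.
have h1 := @aff_cont R k1 _ r phi (@continuous_cos R).
have h2 := @aff_cont R k0 _ r phi (@continuous_sin R).
apply: cvgDC; last by apply: cvgBC; [exact: h2|exact: cvg_cst].
apply: cvgDC; first exact: cvg_cst.
by apply: cvgBC; [exact: h1|exact: cvg_cst].
Qed.

Lemma ellipse_ends b k1 k0 r : ellipse b k1 k0 (r, 0) = b + r%:C%C * k1 /\
  ellipse b k1 k0 (r, pi) = b + (- r)%:C%C * k1.
Proof.
by rewrite !ellipseE /= cos0 sin0 cospi sinpi mulr1 mulrN1 !mulr0 !mul0r !addr0.
Qed.

Lemma ellipse_gt0 k1 k0 : k1 \is Num.real -> k0 \is Num.real ->
  \forall r \near (0 : R)^'+, forall phi, 0 < ellipse 1 k1 k0 (r, phi).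
Proof.
move=> r1 r0; have hr t : ellipse 1 k1 k0 t \is Num.real.
  have rr (s : R) : (s%:C%C : C) \is Num.real by apply/complex_realP; exists s.
  by rewrite ellipseE !rpredD ?rpred1 // rpredM.
have h : \forall t \near @uniform_at_right R, 0 < ellipse 1 k1 k0 t.
  by apply: real_cvg1_gt0 => //; apply: ellipse_tends.
exact: h.
Qed.

Section Combination.
Variables (E : {set {set 'I_n}}) (nu1 al1 nu0 al0 : 'I_n -> C).
Hypotheses (flex1 : parallel_flex A P E nu1 al1) (flex0 : parallel_flex A P E nu0 al0).

Definition lin_q t v : C := ellipse (P v) (nu1 v) (nu0 v) t.
Definition lin_f t v : C := ellipse 1 (al1 v) (al0 v) t.

Lemma edge_factor_lin t u v : u != v -> edge_factor P (lin_q t) u v =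
  ellipse 1 (edge_factor P nu1 u v) (edge_factor P nu0 u v) t.
Proof.
move=> uv; apply: div_scaled; first by rewrite subP_neq0 // eq_sym.
have h1 := edge_factorK P_inj nu1 uv; have h0 := edge_factorK P_inj nu0 uv.
rewrite /lin_q !ellipseE.
transitivity ((P v - P u) + (t.1 * cos t.2)%:C%C * (nu1 v - nu1 u)
  + (t.1 * sin t.2)%:C%C * (nu0 v - nu0 u)); first by ring.
by rewrite -h1 -h0; ring.
Qed.

Lemma lin_f_gt0 : \forall r \near (0 : R)^'+, forall v phi, 0 < lin_f (r, phi) v.
Proof. by apply: filter_forall => v; apply: ellipse_gt0; [apply: flex1.1|apply: flex0.1]. Qed.

Lemma lin_compatible : \forall r \near (0 : R)^'+, forall phi,
  compatible A P E (lin_q (r, phi)) (lin_f (r, phi)).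
Proof.
have hz : \forall r \near (0 : R)^'+, forall (uv : 'I_n * 'I_n) phi,
    uv.1 != uv.2 -> [set uv.1; uv.2]%SET \in E ->
    0 < edge_factor P (lin_q (r, phi)) uv.1 uv.2.
  apply: filter_forall => -[u v] /=.
  have [uv|uv] := boolP (u != v); last by apply: nearW.
  have [he|he] := boolP ([set u; v]%SET \in E); last by apply: nearW.
  have [r1 _] := flex1.2 u v uv he; have [r0 _] := flex0.2 u v uv he.
  apply: filterS (ellipse_gt0 r1 r0) => r h phi _ _.
  by rewrite edge_factor_lin.
apply: filterS2 lin_f_gt0 hz => r hf hz phi u v uv he.
have f0 := hf u phi; rewrite /frel; case: ifPn => hu.
  by apply: divr_gt0 => //; apply: (hz (u, v)).
have [_ e1] := flex1.2 u v uv he; have [_ e0] := flex0.2 u v uv he.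
by rewrite edge_factor_lin // e1 // e0 // lt0r_neq0.
Qed.

(** Edge factors of parallel flexes are real, so small combinations of two of them give exactly
    compatible states. The loop they span has the first flex at its marked points. *)
Lemma linear_path N :
  (\forall r \near (0 : R)^'+, forall phi, (forall v, 0 < lin_f (r, phi) v) ->
     ~ similar_below A P N (lin_q (r, phi)) (lin_f (r, phi))) ->
  flex_path A P E N nu1 al1.
Proof.
move=> hn; split; first exact: flex1.
exists lin_q, lin_f; split.
- by move=> v; split; apply: ellipse_tends.
- apply: filterS3 hn lin_f_gt0 lin_compatible => r hn hf hc phi.
  by split; [exact: hc|apply: hn => v; apply: hf].
- by apply: nearW => r phi v; split; apply: ellipse_cont.
apply: nearW => r v _; rewrite /lin_q /lin_f.
have [-> ->] := ellipse_ends (P v) (nu1 v) (nu0 v) r.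
by have [-> ->] := ellipse_ends 1 (al1 v) (al0 v) r.
Qed.

(** The frame of the angle vertex [a] is positive, hence so is the similarity factor, and it equals
    the frames of all distance vertices. The combined flex is then a dilation as far as [i] and [j]
    can tell. *)
Lemma lin_similar N (a i j : 'I_n) t : a \in A -> j \notin A ->
  (a < N)%N -> (i < N)%N -> (j < N)%N -> (forall v, 0 < lin_f t v) ->
  similar_below A P N (lin_q t) (lin_f t) ->
  ellipse 0 (nu1 j - nu1 i - al1 j * (P j - P i))
    (nu0 j - nu0 i - al0 j * (P j - P i)) t = 0 /\
  (i \notin A -> ellipse 0 (al1 i - al1 j) (al0 i - al0 j) t = 0).
Proof.
move=> aA jA ha hi hj hf [z [s h]].
have [_ fa] := h a ha; have [qi fi] := h i hi; have [qj fj] := h j hj.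
have z0 : 0 < z by move: fa; rewrite (frelA _ _ aA); apply: gt0_divl.
have zf (v : 'I_n) : (v < N)%N -> v \notin A -> lin_f t v = z.
  move=> hv vA; have [_] := h v hv; rewrite (frelD _ _ vA) => -[+ _].
  by rewrite (gtr0_norm z0) (gtr0_norm (hf v)).
split.
  have : lin_q t j - lin_q t i = lin_f t j * (P j - P i).
    by rewrite qi qj (zf j) //; ring.
  rewrite /lin_q /lin_f !ellipseE => /eqP; rewrite -subr_eq0 => /eqP e.
  by rewrite -[RHS]e; ring.
move=> iA; have : lin_f t i - lin_f t j = 0 by rewrite !zf // subrr.
by rewrite /lin_f !ellipseE => e; rewrite -[RHS]e; ring.
Qed.

End Combination.

(* [k |-> x * conjc k + conjc x * k] is real-linear. *)
Lemma ellipse_neq0 (x k1 k0 : C) r phi : 0 < r ->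
  x * conjc k1 + conjc x * k1 != 0 -> x * conjc k0 + conjc x * k0 = 0 -> k0 != 0 ->
  ellipse 0 k1 k0 (r, phi) = 0 -> False.
Proof.
move=> r0 h1 h0 n0; rewrite ellipseE /= add0r.
set s := r * cos phi; set s' := r * sin phi => e.
have e1 : (s%:C)%C * (x * conjc k1 + conjc x * k1) = 0.
  have cR (y : R) : conjc (y%:C%C : C) = y%:C%C by rewrite conjc_real.
  transitivity (x * conjc (s%:C%C * k1 + s'%:C%C * k0) +
      conjc x * (s%:C%C * k1 + s'%:C%C * k0) -
      s'%:C%C * (x * conjc k0 + conjc x * k0)).
    by rewrite conjcD !conjcM !cR; ring.
  by rewrite h0 e conjc0 !mulr0 addr0 subr0.
have R0 (y : R) : (y%:C%C : C) = 0 -> y = 0 by case.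
have /R0 s0 : (s%:C)%C = 0 :> C.
  by move/eqP: e1; rewrite mulf_eq0 (negPf h1) orbF => /eqP.
have /R0 s0' : (s'%:C)%C = 0 :> C.
  by move/eqP: e; rewrite s0 mul0r add0r mulf_eq0 (negPf n0) orbF => /eqP.
exact: loop_nontrivial r0 s0 s0'.
Qed.

End LinearPaths.

(** * One-vertex additions, type by type *)

Section LinkSteps.
Variables (R : realType) (n : nat) (A : {set 'I_n}) (p : 'M[R]_(n, 2)).
Hypothesis hinj : injective (fun i : 'I_n => row i p).
Hypothesis hgen : generic p.
Local Notation C := R[i].
Local Notation P := (positions p).
Let P_inj := positions_inj hinj.
Variables (N : nat) (E : {set {set 'I_n}}) (i x j : 'I_n).
Hypotheses (hE : below E N) (hi : (i < N)%N) (hj : (j < N)%N) (hx : x = N :> nat).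
Hypothesis ij : i != j.
Let u : C := P x - P i.
Let v : C := P j - P x.
Let w : C := P j - P i.

Let ix : i != x. Proof. by apply: contraTneq hi => ->; rewrite hx ltnn. Qed.
Let xj : x != j. Proof. by apply: contraTneq hj => <-; rewrite hx ltnn. Qed.

Lemma link_step_flat (X : link_extension A P i x j) nu al :
  (forall ni ai nj aj, ld X ni ai nj aj = 0) -> flex_path A P E N nu al ->
  nearby_flex A P (E :|: link_edges i x j) N.+1.
Proof.
move=> hd hL; have [e|e] := eqVneq (lc X (nu i) (al i) (nu j) (al j)) 0.
  exact (nearby_link_flat hE hi hj hx hL e (hd _ _ _ _)).
exact (nearby_link_ivt hE hi hj hx hL e).
Qed.

(** In the case $c=0$, $\mu\neq0$ the given flex is traded for one with $c\neq0$. On the loop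
    spanned by both, a trivial state would have zero combined defect: applying $c$ kills the
    coefficient of the new flex, and $\mu\neq0$ that of the old one. *)
Lemma link_step_ADD nu al : x \notin A -> i \in A -> j \notin A ->
  flex_path A P E N nu al -> nearby_flex A P (E :|: link_edges i x j) N.+1.
Proof.
move=> xA iA jA hL; have [X hX] := link_extension_ADD P_inj ix xj xA iA jA.
have flex0 := hL.1; have raj := flex0.1 j.
have [ec ed] := hX (nu i) (al i) (nu j) (al j) raj.
have [e|e] := eqVneq (lc X (nu i) (al i) (nu j) (al j)) 0; last first.
  exact (nearby_link_ivt hE hi hj hx hL e).
have [m|m] := eqVneq (nu j - nu i - al j * w) 0.
  exact (nearby_link_flat hE hi hj hx hL e (ed m)).
have [nu1 [al1 [flex1 /= m1]]] := generic_ADD hinj hgen hE hi hj hx flex0 m.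
have [ec1 _] := hX (nu1 i) (al1 i) (nu1 j) (al1 j) (flex1.1 j).
have e1 : lc X (nu1 i) (al1 i) (nu1 j) (al1 j) != 0 by rewrite ec1.
rewrite ec in e.
have hL1 : flex_path A P E N nu1 al1.
  apply: (linear_path P_inj flex1 flex0).
  have : \forall r \near (0 : R)^'+, 0 < r by apply: nbhs_right_gt.
  apply: filterS => r r0 phi hf hs.
  have [h _] := lin_similar iA jA hi hi hj hf hs.
  exact: ellipse_neq0 r0 m1 e m h.
exact (nearby_link_ivt hE hi hj hx hL1 e1).
Qed.

Lemma link_step_DAD nu al : x \in A -> i \notin A -> j \notin A ->
  ((exists2 v : 'I_n, (v < N)%N & v \in A) \/
     (forall v : 'I_n, (v < N)%N -> nu v = 0 /\ al v = 1)) ->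
  flex_path A P E N nu al -> nearby_flex A P (E :|: link_edges i x j) N.+1.
Proof.
move=> xA iA jA hA hL; have [X hX] := link_extension_DAD P_inj ix xj ij xA iA jA.
have flex0 := hL.1; have rai := flex0.1 i; have raj := flex0.1 j.
have [ec ed] := hX (nu i) (al i) (nu j) (al j) rai raj.
have [e|e] := eqVneq (lc X (nu i) (al i) (nu j) (al j)) 0; last first.
  exact (nearby_link_ivt hE hi hj hx hL e).
have [m|m] := eqVneq (al i * u + al j * v - (nu j - nu i)) 0.
  exact (nearby_link_flat hE hi hj hx hL e (ed m)).
rewrite ec in e.
case: hA => [[a ha aA]|h0]; last first.
  (* When only the frames are stretched, the defect is $u+v=w$ and the linear coefficient is
     $2|w|^2$, against its assumed vanishing. *)
  have [ni ai] := h0 i hi; have [nj aj] := h0 j hj.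
  have w0 : w != 0 by rewrite subP_neq0 // eq_sym.
  have ew : al i * u + al j * v - (nu j - nu i) = w.
    by rewrite ni ai nj aj /u /v /w; ring.
  move: e; rewrite -/u -/v -/w ew [conjc w * w]mulrC -mulr2n -sqr_normc => /eqP.
  by rewrite mulrn_eq0 /= expf_eq0 /= normr_eq0 (negPf w0).
have [nu1 [al1 [flex1 /= m1]]] := generic_DAD hinj hgen hE hi hj hx ij flex0 m.
have [ec1 _] := hX (nu1 i) (al1 i) (nu1 j) (al1 j) (flex1.1 i) (flex1.1 j).
have e1 : lc X (nu1 i) (al1 i) (nu1 j) (al1 j) != 0 by rewrite ec1.
have hL1 : flex_path A P E N nu1 al1.
  apply: (linear_path P_inj flex1 flex0).
  have : \forall r \near (0 : R)^'+, 0 < r by apply: nbhs_right_gt.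
  apply: filterS => r r0 phi hf hs.
  have [h1 /(_ iA) h2] := lin_similar aA jA ha hi hj hf hs.
  apply: (ellipse_neq0 (phi := phi) r0 m1 e m); move: h1 h2.
  rewrite !ellipseE => h1 h2.
  (* The defect splits as $(\alpha_i-\alpha_j)u-(\nu_j-\nu_i-\alpha_jw)$, and both parts vanish on a
     trivial state. *)
  have := congr2 (fun y z => y * u - z) h2 h1; rewrite mul0r subr0 => h3.
  by rewrite -[RHS]h3 /u /v; ring.
exact (nearby_link_ivt hE hi hj hx hL1 e1).
Qed.

Lemma link_step nu al : link_cond A P i x j ->
  ((exists2 v : 'I_n, (v < N)%N & v \in A) \/
     (forall v : 'I_n, (v < N)%N -> nu v = 0 /\ al v = 1)) ->
  flex_path A P E N nu al -> nearby_flex A P (E :|: link_edges i x j) N.+1.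
Proof.
case=> [[xA iA jA huv]|[[xA iA jA]|[xA iA jA]|[xA iA jA]|[xA iA jA]]] hA hL.
- have [X hX] := link_extension_AAA P_inj ix xj xA iA jA huv.
  exact (link_step_flat (fun ni ai nj aj => (hX ni ai nj aj).2) hL).
- have [X hX] := link_extension_DAA P_inj ix xj xA iA jA.
  exact (link_step_flat hX hL).
- have [X hX] := link_extension_ADA P_inj ix xj ij xA iA jA.
  exact (link_step_flat hX hL).
- exact (link_step_ADD xA iA jA hL).
exact (link_step_DAD xA iA jA hA hL).
Qed.

End LinkSteps.

(** * Minimality *)

Section Minimality.
Variables (R : realType) (n : nat) (A : {set 'I_n}) (p : 'M[R]_(n, 2)).
Hypothesis hinj : injective (fun i : 'I_n => row i p).
Hypothesis hgen : generic p.
Local Notation C := R[i].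
Local Notation P := (positions p).
Let P_inj := positions_inj hinj.
Implicit Types (E F : {set {set 'I_n}}) (e : {set 'I_n}) (a b c d i j x v : 'I_n).

Lemma setUD1_sub E F e : (E :|: F) :\ e \subset (E :\ e) :|: F.
Proof. by rewrite finset.setDUl finset.setUS // subsetDl. Qed.

Lemma ear_cond_pair a b c d : ear_cond A P a b c d ->
  [/\ (a \in A) || (b \in A), (a \in A) || (d \in A) & (d \in A) || (c \in A)].
Proof. by case=> -[[_ h1 h2 h3] _]; rewrite ?h1 ?h2 ?h3 ?orbT. Qed.

(** The extra information used for type DAD. The pure stretch of frames is the state left by the
    initial edge; any two-vertex addition brings an angle vertex and so the first alternative. *)
Definition anchored N (nu al : 'I_n -> C) : Prop :=
  (exists2 v : 'I_n, (v < N)%N & v \in A) \/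
  (forall v : 'I_n, (v < N)%N -> nu v = 0 /\ al v = 1).

Lemma built_below o N E : built A P o N E -> below E N.
Proof.
move=> hb e' /(built_edge_lt hb) [s [t [-> _ hs ht]]] v.
by rewrite !inE => /orP[] /eqP ->.
Qed.

Lemma belowD1 E N e : below E N -> below (E :\ e) N.
Proof. by move=> h e'; rewrite !inE => /andP[_]; apply: h. Qed.

(** A loop is carried while $o=0$. The one-vertex addition reduces it to a curve, which is enough
    because every later addition is a path with two new vertices and extends all states near the
    base. *)
Lemma built_delete o N E e : built A P o N E -> (o <= 1)%N -> e \in E ->
  nearby_flex A P (E :\ e) N /\
  (o = 0%N -> exists nu al, flex_path A P (E :\ e) N nu al /\ anchored N nu al).
Proof.
move=> hb; elim: hb => {o N E}.
- move=> a b ea eb _; rewrite inE => /eqP ->; rewrite finset.setDv.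
  have [nu [al [h1 h2]]] := delete_base A P_inj ea eb.
  by split=> [|_]; [exact: flex_path_nearby h1|exists nu, al].
- move=> o N E i j x hb IH hi hj ij hx hl; rewrite ltnS leqn0 => /eqP o0.
  have hE0 := built_below hb.
  move=> hee; split=> //; move: hee; rewrite inE => /orP[he|].
    have o1 : (o <= 1)%N by rewrite o0.
    have [_ /(_ o0) [nu [al [h1 h2]]]] := IH o1 he.
    apply: nearby_flex_sub (setUD1_sub _ _ _) _.
    exact (link_step hinj hgen (belowD1 (e := e) hE0) hi hj hx ij hl h2 h1).
  rewrite !inE => /orP[] /eqP ->.
    apply: nearby_flex_sub (delete_link A P_inj hE0 ij hi hj hj hx).
    apply/fintype.subsetP => y; rewrite !inE (finset.setUC [set j]%SET).
    by case: (y == [set i; x]%SET).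
  apply: nearby_flex_sub (delete_link A P_inj hE0 ij hi hj hi hx).
  apply/fintype.subsetP => y; rewrite !inE.
  by case: (y == [set x; j]%SET); rewrite ?orbF.
move=> o N E a b c d hb IH ha hd ad hb' hc bc he ho.
have hE0 := built_below hb.
have [hA1 hA2 hA3] := ear_cond_pair he.
have hanch nu al : anchored N.+2 nu al.
  left; move: hA1 => /orP[h|h]; [exists a|exists b] => //; lia.
have new e' : (exists nu al, flex_path A P
      ((E :|: [set [set a; b]; [set b; c]; [set c; d]])%SET :\ e') N.+2 nu al) ->
    nearby_flex A P ((E :|: [set [set a; b]; [set b; c]; [set c; d]])%SET :\ e') N.+2 /\
    (o = 0%N -> exists nu al, flex_path A P
      ((E :|: [set [set a; b]; [set b; c]; [set c; d]])%SET :\ e') N.+2 nu al /\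
      anchored N.+2 nu al).
  move=> [nu [al h]]; split=> [|_]; first exact: flex_path_nearby h.
  by exists nu, al.
rewrite finset.in_setU => /orP[hee|].
  have hN : (N <= N.+2)%N by lia.
  have hbN : (N <= b)%N by case/andP: hb'.
  have hcN : (N <= c)%N by case/andP: hc.
  have [X] : inhabited (ear_extension A P a b c d).
    have ab : a != b by rewrite -val_eqE /=; lia.
    have cd : c != d by rewrite -val_eqE /=; lia.
    exact: (ear_extension_exists P_inj ab bc cd he).
  have hE := belowD1 (e := e) hE0.
  have [h1 h2] := IH ho hee; split.
    apply: nearby_flex_sub (setUD1_sub _ _ _) _.
    exact (nearby_flex_ear X ha hd hbN hcN bc hE hN h1).
  move=> /h2 [nu [al [h3 _]]].
  have hM (v : 'I_n) : (v < N.+2)%N -> (v < N)%N \/ v = b \/ v = c.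
    move=> hv; have [vN|vN] := ltnP v N; [by left|right].
    have [/eqP h'|h'] := boolP (v == b :> nat); first by left; apply: val_inj.
    right; apply: val_inj => /=; move: bc; rewrite -val_eqE /=; lia.
  have [nu' [al' [_ h4]]] := flex_path_ear X ha hd hbN hcN bc hE hN hM h3.
  exists nu', al'; split; last exact: hanch.
  exact: flex_path_sub (setUD1_sub _ _ _) h4.
have cb : c != b by rewrite eq_sym.
rewrite !inE => /orP[/orP[]|] /eqP ->; apply: new.
(* The first edge of the path is the deleted one, so the rest is read backwards from [d]. *)
- have [nu [al h]] := delete_last P_inj hE0 ad ha hd hd hc hb' cb hA3.
  exists nu, al; apply: flex_path_sub h; apply/fintype.subsetP => y; rewrite !inE.
  rewrite (finset.setUC [set d]%SET) (finset.setUC [set c]%SET [set b]%SET).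
  by case: (y == [set a; b]%SET) => //=; case: (y \in E) => //=; rewrite orbC.
- have [nu [al h]] := delete_middle P_inj hE0 ad ha hd ha hd hb' hc bc hA2.
  exists nu, al; apply: flex_path_sub h; apply/fintype.subsetP => y; rewrite !inE.
  rewrite (finset.setUC [set d]%SET).
  by case: (y == [set b; c]%SET) => //=; rewrite orbF orbA.
have [nu [al h]] := delete_last P_inj hE0 ad ha hd ha hb' hc bc hA1.
exists nu, al; apply: flex_path_sub h; apply/fintype.subsetP => y; rewrite !inE.
by case: (y == [set c; d]%SET) => //=; rewrite orbF orbA.
Qed.

End Minimality.

(** * From nontrivial states to the failure of rigidity *)

Section Conclusion.
Variables (R : realType) (n : nat) (VA VD : {set 'I_n}) (p : 'M[R]_(n, 2)).
Hypothesis hAD : bipartition VA VD.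
Hypothesis hinj : injective (fun i : 'I_n => row i p).
Hypothesis hgen : generic p.
Local Notation C := R[i].
Local Notation P := (positions p).
Let P_inj := positions_inj hinj.
Implicit Types (E : {set {set 'I_n}}) (u v : 'I_n).

Lemma isolated_compatible E v z : (forall u, u != v -> [set v; u]%SET \notin E) ->
  compatible VA P E (upd P v z) (fun=> 1).
Proof.
move=> hv a b ab hab.
have av : a != v.
  by apply/eqP => e; have := hv b; rewrite -e eq_sym ab hab => /(_ isT).
have bv : b != v.
  by apply/eqP => e; have := hv a; rewrite -e ab finset.setUC hab => /(_ isT).
rewrite /edge_factor !(upd_neq _ _ av, upd_neq _ _ bv) -/(edge_factor P P a b) (edge_factor_base P_inj ab).
by apply: frel_refl; rewrite oner_neq0.
Qed.

Lemma similar_framework o E q f : built VA P o n E -> compatible VA P E q f ->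
  exists z t : C, z != 0 /\ forall v, q v = z * P v + t.
Proof.
move=> hb /(built_rigid P_inj hb) [z [t [z0 h]]].
by exists z, t; split=> // v; have [] := h v (ltn_ord v).
Qed.

(** Rigidity would make the positions similar, so the state could only be nontrivial through its
    frames. A vertex with an edge left has its frame related to the factor [z]. A vertex without any
    can be moved alone, and this is no similarity because two further vertices stay in place; hence
    $n>2$. *)
Lemma nearby_flex_not_rigid o E e : built VA P o n E -> (2 < n)%N ->
  nearby_flex VA P (E :\ e) n -> ~ globally_rigid (E :\ e) VA VD p.
Proof.
move=> hb n2 [q [f [_ h]]] hr.
have key := globally_rigidE hinj hAD (built_complete hb) (subD1set E e)
  (fun q c => @similar_framework _ _ q c hb) hr.
have [r [h1 h2]] := @filter_ex _ (0 : R)^'+ _ _ h.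
have [z [t [z0 hz]]] := key _ _ h1; apply: h2; exists z, t => v _; split=> //.
have [[u uv he]|hv] := pselect (exists2 u, u != v & [set v; u]%SET \in E :\ e).
  have vu : v != u by rewrite eq_sym.
  by have := h1 v u vu he; rewrite (edge_factor_similar hinj vu (hz v) (hz u)).
exfalso; have hiso u : u != v -> [set v; u]%SET \notin E :\ e.
  by move=> uv; apply/negP => he; apply: hv; exists u.
have [z' [t' [_ hz']]] := key _ _ (isolated_compatible (P v + 1) hiso).
have /card_gt1P [a [b [hav hbv ab]]] : (1 < #|[set~ v]%SET|)%N.
  by rewrite cardsC1 card_ord; lia.
move: hav hbv; rewrite !inE => hav hbv.
have ea := hz' a; have eb := hz' b; have ev := hz' v.
rewrite (upd_neq _ _ hav) in ea; rewrite (upd_neq _ _ hbv) in eb; rewrite updE in ev.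
have z1 : z' = 1.
  by apply: (mulIf (subP_neq0 P_inj ab)); rewrite mul1r [in RHS]ea [in RHS]eb; ring.
have t0 : t' = 0 by apply: (addrI (P a)); rewrite addr0 [in RHS]ea z1 mul1r.
move: ev; rewrite z1 t0 mul1r addr0 => /eqP.
by rewrite -subr_eq0 addrAC subrr add0r oner_eq0.
Qed.

Lemma built_minimally_rigid o E : built VA P o n E -> (o <= 1)%N -> (2 < n)%N ->
  minimally_globally_rigid E VA VD p.
Proof.
move=> hb ho n2; split.
  apply: (globally_rigidI hinj hAD (built_complete hb)) => q c.
  exact: similar_framework hb.
move=> e he; have [h _] := built_delete hinj hgen hb ho he.
exact: nearby_flex_not_rigid hb n2 h.
Qed.

End Conclusion.

Theorem mainTheorem7 (R : realType) (n k : nat) (VA VD : {set 'I_n})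
    (E : {set {set 'I_n}}) (p : 'M[R]_(n, 2))
    (hk : (1 <= k)%N)
    (hAD : bipartition VA VD)
    (hinj : injective (fun i : 'I_n => row i p))
    (hgen : generic p) :
  (constructed VA VD p k 0 n E ->
     [/\ n = (2 * k + 2)%N, #|E| = (3 * k + 1)%N,
         #|E|%:Z = Num.ceil ((3 * n%:R - 4) / 2 : rat)
       & minimally_globally_rigid E VA VD p]) /\
  (constructed VA VD p (k - 1) 1 n E ->
     [/\ n = (2 * k + 1)%N, #|E| = (3 * k)%N,
         #|E|%:Z = Num.ceil ((3 * n%:R - 4) / 2 : rat)
       & minimally_globally_rigid E VA VD p]).
Proof.
split=> /(constructed_built hinj hAD) [hb hn hE].
  have en : n = (2 * k + 2)%N by lia.
  have eE : #|E| = (3 * k + 1)%N by lia.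
  split=> //; last by apply: built_minimally_rigid hb _ _ => //; lia.
  have nQ : n%:R = 2 * k%:R + 2 :> rat by rewrite en natrD natrM.
  have EQ : #|E|%:Z%:~R = 3 * k%:R + 1 :> rat by rewrite -[LHS]/(#|E|%:R) eE natrD natrM.
  (* For $n=2k+2$ the fraction is the integer $3k+1$ itself. *)
  by apply/esym/ceil_def; rewrite intrB EQ nQ; apply/andP; split; lra.
have en : n = (2 * k + 1)%N by lia.
have eE : #|E| = (3 * k)%N by lia.
split=> //; last by apply: built_minimally_rigid hb _ _ => //; lia.
have nQ : n%:R = 2 * k%:R + 1 :> rat by rewrite en natrD natrM.
have EQ : #|E|%:Z%:~R = 3 * k%:R :> rat by rewrite -[LHS]/(#|E|%:R) eE natrM.
(* For $n=2k+1$ the fraction is $3k-1/2$, rounded up to $3k$. *)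
by apply/esym/ceil_def; rewrite intrB EQ nQ; apply/andP; split; lra.
Qed.
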